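(* Suppose that Assumption A holds with $\iota\in(1,1.5]$. Then for each $\gamma\in\big(0,(\iota-1)/(2-\iota)\big)$ one can select $K>0$ and a member of the mixture family of importance sampling distributions (see context) such that $$E^Q(Z_b^{1+\gamma})\le K\,u(b)^{1+\gamma}\quad\text{for all }b>0,\qquad\text{and}\qquad E^Q(\tau_b)\le\rho_0+\rho_1b$$ for some $\rho_0,\rho_1\in(0,\infty)$ (independent of $b$). Consequently, assuming that generating each increment under $q_s(\cdot)$ takes at most a constant number of units of computer time (uniformly in $s$), an expected total cost of $O(\varepsilon^{-2/\gamma}\delta^{-1/\gamma}b)$ suffices to obtain, from i.i.d. replications of $Z_b$ under $Q$, an estimate of $u(b)$ with relative error at most $\varepsilon$ with probability at least $1-\delta$.
   Context: Random walk. $X,X_1,X_2,\dots$ are i.i.d. real random variables with distribution function $F$, $\bar F(x)=1-F(x)=P(X>x)$, and mean $\mu=EX\in(-\infty,0)$. Write $\bar F(x)=e^{-\Lambda(x)}$, where $\Lambda$ is the cumulative hazard function; $F$ has density $f(x)=\lambda(x)e^{-\Lambda(x)}$, where $\lambda$ is the hazard function. $\Lambda^{-1}$ is the (generalized) inverse of $\Lambda$. $S_0=0$, $S_n=X_1+\dots+X_n$, $\tau_b=\inf\{n\ge1:S_n>b\}$, $u(b)=P(\tau_b<\infty)$. Assumption A: $\bar F(x)=L(x)x^{-\iota}$ with $\iota>1$ and $L$ slowly varying at infinity ($\lim_{x\to\infty}L(xt)/L(x)=1$ for all $t\in(0,1]$). Mixture family (under Assumption A). Given a level $b$ and current position $s$,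 the next increment is sampled from the density $$q_s(x)=\big[p_*f_*(x|s)+p_{**}f_{**}(x|s)\big]I(b-s>\eta_* )+f(x)I(b-s\le\eta_* ),$$ where $\eta_*>0$ is a constant, $p_*,p_{**}\in[0,1)$ with $p_*+p_{**}=1$ may depend on $b-s$, $a_{**}>0$ is a constant, $a_*>0$ (possibly depending on $b-s$) is such that $c:=b-s-\Lambda^{-1}(\Lambda(b-s)-a_* )=\Lambda^{-1}(\Lambda(b-s)-a_{**})$, and $$f_*(x|s)=\frac{f(x)I(x\le c)}{P(X\le c)},\qquad f_{**}(x|s)=\frac{f(x)I(x>c)}{P(X>c)}.$$ Importance sampling. $Q$ (expectation $E^Q$) is the law on path space under which $S_0=0$ and, given $S_1,\dots,S_n$, $X_{n+1}$ has density $q_{S_n}$. Put $r_s(x)=f(x)/q_s(x)$ and $Z_b=I(\tau_b<\infty)\prod_{j=1}^{\tau_b}r_{S_{j-1}}(S_j-S_{j-1})$. The cost of one replication of $Z_b$ is proportional to $\tau_b$. The $O(\cdot)$ constant does not depend on $b\ge1$, $\varepsilon,\delta\in(0,1)$. An estimate $\hat u$ has relative error at most $\varepsilon$ if $|\hat u-u(b)|\le\varepsilon u(b)$.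
   Formalization: The condition c = b−s−Λ^{-1}(Λ(b−s)−a_* ) is read as: b−s−c lies between the left and right generalized inverses of Λ at Λ(b−s)−a_*; with a single-valued inverse no a_* need exist when the density vanishes on intervals arbitrarily far out. *)

(* Defs.v *)
From HB Require Import structures.
From mathcomp Require Import all_boot all_order all_algebra.
From mathcomp Require Import all_classical all_reals all_analysis.

Set Implicit Arguments.
Unset Strict Implicit.
Unset Printing Implicit Defensive.

Import Order.TTheory GRing.Theory Num.Theory.
Import numFieldNormedType.Exports.

Local Open Scope classical_set_scope.
Local Open Scope ring_scope.

Section independence.
Context {d : measure_display} {T : measurableType d} {R : realType}.

Definition mutually_independent (P : probability T R) (I : choiceType)
    (Y : I -> T -> R) : Prop :=
  forall (s : seq I) (B : I -> set R), uniq s ->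
    (forall i, measurable (B i)) ->
    P (\bigcap_(i in [set` s]) (Y i @^-1` B i)) =
    (\prod_(i <- s) P (Y i @^-1` B i))%E.

Definition iid (P : probability T R) (X : nat -> {RV P >-> R}) : Prop :=
  mutually_independent P (fun n => X n : T -> R) /\
  (forall n (B : set R), measurable B ->
    distribution P (X n) B = distribution P (X 0%N) B).

Definition has_density (P : probability T R) (X : {RV P >-> R}) (f : R -> R) :
    Prop :=
  [/\ measurable_fun setT f, (forall x, 0 <= f x) &
      forall B : set R, measurable B ->
        distribution P X B = (\int[lebesgue_measure]_(x in B) (f x)%:E)%E].

End independence.

Section tail.
Context {R : realType}.

(* The ratio is 0 wherever L vanishes, so the limit forces L to be nonzero
   near +oo. *)
Definition slowly_varying (L : R -> R) : Prop :=
  forall t : R, 0 < t -> t <= 1 ->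
    L (x * t) / L x @[x --> +oo] --> (1 : R).

Definition assumptionA (Fbar : R -> R) (iota : R) : Prop :=
  1 < iota /\ exists2 L : R -> R, slowly_varying L &
    forall x, 0 < x -> Fbar x = L x * x `^ (- iota).

Definition hazard_density (lambda Lambda : R -> R) : R -> R :=
  fun x => lambda x * expR (- Lambda x).

(* Left- and right-continuous generalized inverses, extended-real valued:
   geninv Lambda y = -oo as soon as y <= inf Lambda. *)
Definition geninv (Lambda : R -> R) (y : R) : \bar R :=
  ereal_inf [set x%:E | x in [set x | y <= Lambda x]].

Definition geninv_right (Lambda : R -> R) (y : R) : \bar R :=
  ereal_sup [set x%:E | x in [set x | Lambda x <= y]].

End tail.

Section first_passage.
Context {R : realType} {T : Type}.

(* Increments are indexed from 0, so walk Y n is Y 0 + ... + Y n.-1. *)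
Definition walk (Y : nat -> T -> R) (n : nat) (t : T) : R :=
  \sum_(i < n) Y i t.

Definition passage_time (b : R) (Y : nat -> T -> R) (t : T) : \bar R :=
  ereal_inf [set (n%:R)%:E | n in [set n | (1 <= n)%N /\ b < walk Y n t]].

End first_passage.

Definition crossing_prob (d : measure_display) (T : measurableType d)
    (R : realType) (P : probability T R) (X : nat -> {RV P >-> R}) (b : R) : R :=
  fine (P [set t | (passage_time b (fun n => X n : T -> R) t < +oo)%E]).

(* The parameters that are allowed to depend on b - s are functions of w = b - s. *)
Record mixture (R : realType) := Mixture {
  eta_star : R;
  p_star : R -> R;
  p_2star : R -> R;
  a_star : R -> R;
  a_2star : R }.

Section mixture_family.
Context {d : measure_display} {T : measurableType d} {R : realType}.
Variables (P : probability T R) (X : {RV P >-> R}) (f Lambda : R -> R).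
Variable m : mixture R.

Definition cutoff (w : R) : R := fine (geninv Lambda (Lambda w - a_2star m)).

(* The relation w - c = Lambda^-1 (Lambda w - a_star w) is read with w - c
   anywhere between the two generalized inverses. This is the plain equation
   unless Lambda is flat to the left of w - c; such flat pieces carry no mass,
   and the image of a one-sided inverse misses all but one endpoint of each.
   Finiteness of the generalized inverse defining c amounts to P(X <= c) > 0. *)
Definition in_mixture_family : Prop :=
  [/\ 0 < eta_star m, 0 < a_2star m,
      measurable_fun setT (p_star m), measurable_fun setT (p_2star m) &
      forall w, eta_star m < w ->
        [/\ 0 <= p_star m w < 1, 0 <= p_2star m w < 1,
            p_star m w + p_2star m w = 1,
            0 < a_star m w &
            geninv Lambda (Lambda w - a_2star m) \is a fin_num /\
            (geninv Lambda (Lambda w - a_star m w) <= (w - cutoff w)%:E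
               <= geninv_right Lambda (Lambda w - a_star m w))%E]].

Definition f_star (w x : R) : R :=
  if x <= cutoff w then f x / fine (cdf X (cutoff w)) else 0.

Definition f_2star (w x : R) : R :=
  if cutoff w < x then f x / fine (ccdf X (cutoff w)) else 0.

Definition q_density (b s x : R) : R :=
  let w := b - s in
  if eta_star m < w then
    p_star m w * f_star w x + p_2star m w * f_2star w x
  else f x.

End mixture_family.

Section importance_sampling.
Context {d : measure_display} {T : measurableType d} {R : realType}.

Definition history (Y : nat -> T -> R) (n : nat) : set (set T) :=
  <<s [set A | exists k (B : set R),
         [/\ (k <= n)%N, measurable B & A = walk Y k @^-1` B] ]>>.

(* Given S_1, ..., S_n, the next increment has density q (S_n). *)
Definition path_law (Q : probability T R) (Y : nat -> {RV Q >-> R})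
    (q : R -> R -> R) : Prop :=
  let S := walk (fun n => Y n : T -> R) in
  forall n (A : set T), history (fun n => Y n : T -> R) n A ->
  forall B : set R, measurable B ->
    Q (A `&` (Y n @^-1` B)) =
    (\int[Q]_(t in A) \int[lebesgue_measure]_(x in B) (q (S n t) x)%:E)%E.

Definition estimator (f : R -> R) (q : R -> R -> R) (b : R)
    (Y : nat -> T -> R) (t : T) : R :=
  let S := fun n => walk Y n t in
  let tau := passage_time b Y t in
  if (tau < +oo)%E then
    \prod_(1 <= j < (Num.truncn (fine tau)).+1)
      (f (S j - S j.-1) / q (S j.-1) (S j - S j.-1))
  else 0.

(* c j t is the time spent on generating the (j+1)-st increment. *)
Definition replication_cost (c : nat -> T -> R) (b : R) (Y : nat -> T -> R)
    (t : T) : \bar R :=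
  (\sum_(0 <= j <oo)
     (if (j%:R)%:E < passage_time b Y t then (c j t)%:E else 0))%E.

End importance_sampling.

(* Main.v *)
(* Let N be the tail of X, H w = E (X - w)^+, m = - E X, and let w = b - S_n be
   the distance to the level.  The mixture jumps with probability
   p w = theta N w / H w, about theta (iota - 1) / w.  Two supermartingales are
   used along the importance sampling walk.
   - For the moment: C H w ^ (1 + gamma), cut off at 1.  Its decrease due to the
     negative drift, (1 + gamma) m N / H relatively, has to beat the likelihood
     ratio gain gamma p of the regular steps, i.e. gamma theta < (1 + gamma) m;
     what remains absorbs the jump term once C is large.  Moreover
     u b >= k H b, because from any time at which the walk is above a fixed
     decreasing line a single large increment crosses the level.
   - For the passage time: rho0 + rho1 w.  A jump covers almost the whole
     distance w, hence p w * w > m is needed, i.e. theta (iota - 1) > m.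
   Both constraints on theta are compatible iff
   gamma < (iota - 1) / (2 - iota).
   The sample mean is controlled by truncating Z at n eps u and applying
   Chebyshev's inequality to the truncated variables, which costs
   n = O(eps^(- (1 + gamma) / gamma) delta^(- 1 / gamma)) replications. *)
Require Import Defs.
From HB Require Import structures.
From mathcomp Require Import all_boot all_order all_algebra.
From mathcomp Require Import all_classical all_reals all_analysis.
From mathcomp Require Import measurable_realfun ring lra.

Set Implicit Arguments.
Unset Strict Implicit.
Unset Printing Implicit Defensive.

Import Order.TTheory GRing.Theory Num.Theory.
Import numFieldNormedType.Exports.

Local Open Scope classical_set_scope.
Local Open Scope ring_scope.

(** * Regularly varying tails *)

(** The sampled walk and the nominal one live on different probability spaces, and a path law
    prescribes only the conditional density of the next increment. Functionals of the stopped path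
    are therefore written as series of products of step weights, killed at the crossing, and
    compared one step at a time; unbiasedness and both supermartingale bounds are instances of this
    calculus. The estimates on [N] and [H] rest on monotonicity, on the pointwise limits of N (t x)
    / N x, and on the bracketing of H x - H y between (y - x) N y and (y - x) N x. Of the two
    comparisons of w N w with H w only the lower one has to be sharp, because it enters the rate
    condition for the passage time. A single z < 1 measures every loss: one factor in theta, one in
    the Karamata constant, three in the position of the cutoff. Their product z ^ 5 is fixed near 1
    before the threshold [eta] is chosen. The bound iota <= 3 / 2 forces gamma < 1, which enters
    through the concavity of t ^ gamma and through the second moments of the truncated variables. It
    also gives 1 + gamma < 2, so the sample size of the overview stays within the exponent 2 /
    gamma. *)

Section bernoulli.
Context {R : realType}.
Implicit Types v y p g : R.

Lemma powR_ge_tangent1 v p : 0 <= v -> 1 < p -> 1 + p * (v - 1) <= v `^ p.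
Proof.
move=> v0 p1; have p0 : 0 < p by lra.
have q0 : 0 < p / (p - 1) by rewrite divr_gt0//; lra.
have pp : p^-1 * p = 1 by rewrite mulVf// gt_eqF.
have qV : (p / (p - 1))^-1 = 1 - p^-1 by rewrite invf_div mulrBl mul1r mulfV ?gt_eqF.
have pq : p^-1 + (p / (p - 1))^-1 = 1 by rewrite qV subrKC.
(* Young's inequality for [v] and 1 with conjugate exponents [p] and [p / (p - 1)] becomes
   Bernoulli's inequality once multiplied by [p]. *)
have := conjugate_powR v0 ler01 p0 q0 pq.
rewrite mulr1 powR1 mul1r qV -(ler_pM2r p0) mulrDl mulrBl mulrVK ?unitfE ?gt_eqF//.
rewrite pp; lra.
Qed.

(** Convexity: the value 1 at v = 1 of the map v ^ (1 + g) lies above its tangent at [u]. The proof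
    takes the tangent at 1, evaluates it at [u^-1] and multiplies by u ^ (1 + g). *)
Lemma powR_tangent u g : 0 < u -> 0 < g ->
  u `^ (1 + g) <= 1 + (1 + g) * (u - 1) * u `^ g.
Proof.
move=> u0 g0; have := @powR_ge_tangent1 u^-1 (1 + g).
rewrite invr_ge0 ltW// => /(_ isT); rewrite ltrDl => /(_ g0).
have -> : u^-1 `^ (1 + g) = (u `^ (1 + g))^-1.
  by rewrite -(powR_inv1 (ltW u0)) -powRrM mulN1r powRN.
rewrite -(ler_pM2l (powR_gt0 (1 + g) u0)) divff ?gt_eqF ?powR_gt0//.
have -> : u `^ (1 + g) = u * u `^ g.
  by rewrite powRD ?(gt_eqF u0) ?implybT// powRr1 ?ltW.
move=> h.
have uu : u * u^-1 = 1 by rewrite divff// gt_eqF.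
have e : u * u `^ g * (1 + (1 + g) * (u^-1 - 1)) =
  u * u `^ g + (1 + g) * (u * u^-1 - u) * u `^ g by ring.
move: h; rewrite e uu; lra.
Qed.

(** Concavity, from Young's inequality for (1 + y) ^ g and 1 with exponents 1 / g and 1 / (1 -
    g). *)
Lemma powR1D_le y g : 0 <= y -> 0 < g < 1 -> (1 + y) `^ g <= 1 + g * y.
Proof.
move=> y0 /andP[g0 g1].
have p0 : 0 < g^-1 by rewrite invr_gt0.
have q0 : 0 < (1 - g)^-1 by rewrite invr_gt0; lra.
have pq : g^-1^-1 + (1 - g)^-1^-1 = 1 by rewrite !invrK; lra.
have := conjugate_powR (powR_ge0 (1 + y) g) ler01 p0 q0 pq.
rewrite mulr1 powR1 !invrK -powRrM mulfV ?gt_eqF// powRr1; last lra.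
lra.
Qed.

Lemma powR_near1 (a k : R) : 0 < a -> 1 < k ->
  exists2 t, 0 < t < 1 & t `^ (- a) < k.
Proof.
move=> a0 k1; pose k' := (1 + k) / 2.
have k'1 : 1 < k' by rewrite /k'; lra.
exists (k' `^ (- a^-1)); last first.
  by rewrite -powRrM mulrNN mulVf ?gt_eqF// powRr1 /k'; lra.
rewrite powR_gt0/=; last lra.
rewrite powRN invf_lt1 ?powR_gt0//; last lra.
have : 1 `^ a^-1 < k' `^ a^-1.
  by apply: gt0_ltr_powR; rewrite ?invr_gt0// ?nnegrE; lra.
by rewrite powR1.
Qed.

End bernoulli.

Section near_infinity.
Context {R : realType}.

(** Allows an eventual inequality to be used at several points derived from the running one, such as
    [l * y] or [w + A]. *)
Lemma near_pinfty_forall_ge (P : R -> Prop) :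
  (\forall w \near +oo, P w) -> \forall w \near +oo, forall y, w <= y -> P y.
Proof.
move=> [M [Mr PM]]; exists M; split => // w Mw y wy.
by apply: PM; exact: lt_le_trans wy.
Qed.

End near_infinity.

Section regularly_varying_tail.
Context {R : realType}.
Variables (N H : R -> R) (iota : R).
Hypothesis N_gt0 : forall x : R, 0 < N x.
Hypothesis N_noninc : forall x y : R, x <= y -> N y <= N x.
Hypothesis iota_gt1 : 1 < iota.
Hypothesis N_rv : forall t : R, 0 < t -> t <= 1 ->
  N (x * t) / N x @[x --> +oo] --> t `^ (- iota).
Hypothesis H_incr_le : forall x y : R, x <= y -> H x - H y <= (y - x) * N x.
Hypothesis H_incr_ge : forall x y : R, x <= y -> (y - x) * N y <= H x - H y.
Hypothesis H_cvg0 : H x @[x --> +oo] --> (0 : R).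

Lemma integrated_tail_noninc x y : x <= y -> H y <= H x.
Proof.
move=> xy; rewrite -subr_ge0 (le_trans _ (H_incr_ge xy))//.
by rewrite mulr_ge0 ?subr_ge0// ltW.
Qed.

(** If H x <= 0, positivity of [N] makes H (x + 1) negative, and a nonincreasing function that is
    negative somewhere cannot tend to 0. *)
Lemma integrated_tail_gt0 x : 0 < H x.
Proof.
rewrite ltNge; apply/negP => Hx0.
have x1 : x <= x + 1 by rewrite lerDl.
have Hx1 : H (x + 1) < 0.
  have := H_incr_ge x1; have := N_gt0 (x + 1); rewrite addrAC subrr add0r mul1r; lra.
near (pinfty_nbhs R) => y.
have : H (x + 1) < H y by near: y; exact: (cvgr_gt _ H_cvg0).
by rewrite ltNge integrated_tail_noninc.
Unshelve. all: by end_near. Qed.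

Lemma tail_ratio_le (t k : R) : 0 < t -> t <= 1 -> t `^ (- iota) < k ->
  \forall w \near +oo, N (t * w) <= k * N w.
Proof.
move=> t0 t1 tk; near=> w.
rewrite -ler_pdivrMr// (mulrC t); near: w.
exact: cvgr_le (N_rv t0 t1) _ tk.
Unshelve. all: by end_near. Qed.

Lemma tail_ratio_ge (t k : R) : 0 < t -> t <= 1 -> k < t `^ (- iota) ->
  \forall w \near +oo, k * N w <= N (t * w).
Proof.
move=> t0 t1 tk; near=> w.
rewrite -ler_pdivlMr// (mulrC t); near: w.
exact: cvgr_ge (N_rv t0 t1) _ tk.
Unshelve. all: by end_near. Qed.

(** The left-hand side has slope 1 - iota < - k at x = 0, so a small [x] works. *)
Lemma powR_lt_karamata (k : R) : 0 < k < iota - 1 ->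
  exists2 x, 0 < x & (1 + x) `^ (1 - iota) < 1 - k * x.
Proof.
move=> /andP[k0 ki]; pose a := iota - 1.
have a0 : 0 < a by rewrite /a; lra.
(* With a = iota - 1, the bound ln (1 + x) >= x / (1 + x) reduces the claim to k * (1 + a) * x < a -
   k; this [x] is half the critical value. *)
pose x := (a - k) / (2 * k * (1 + a)).
have den0 : 0 < 2 * k * (1 + a) by rewrite !mulr_gt0//; lra.
have x0 : 0 < x by rewrite divr_gt0// /a; lra.
exists x => //.
have xE : 2 * k * (1 + a) * x = a - k by rewrite /x mulrC divfK// gt_eqF.
have x10 : 0 < 1 + x by lra.
have ln_ge : x / (1 + x) <= ln (1 + x).
  have h : -1 < - (x / (1 + x)).
    by rewrite ltrN2 ltr_pdivrMr//; lra.
  have := le_ln1Dx h.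
  have -> : 1 + - (x / (1 + x)) = (1 + x)^-1.
    by rewrite -[X in X - _](divff (lt0r_neq0 x10)) -mulrBl addrK mul1r.
  by rewrite lnV ?posrE//; lra.
have pow_ge : 1 + a * (x / (1 + x)) <= (1 + x) `^ a.
  rewrite /powR gt_eqF// (le_trans _ (expR_ge1Dx _))// lerD2l.
  by rewrite ler_wpM2l// ltW.
have -> : 1 - iota = - a by rewrite /a; lra.
rewrite powRN.
have y0 : 0 < 1 + a * (x / (1 + x)).
  by have := mulr_ge0 (ltW a0) (divr_ge0 (ltW x0) (ltW x10)); lra.
apply: (@le_lt_trans _ _ (1 + a * (x / (1 + x)))^-1).
  by rewrite lef_pV2// ?posrE// (lt_le_trans y0).
rewrite -[X in X < _]mul1r ltr_pdivrMr//.
have -> : (1 - k * x) * (1 + a * (x / (1 + x))) =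
  (1 - k * x) * (1 + x + a * x) / (1 + x).
  have <- : (1 + x) / (1 + x) + a * (x / (1 + x)) = 1 + a * (x / (1 + x)).
    by rewrite (divff (lt0r_neq0 x10)).
  by rewrite -[RHS]mulrA; congr (_ * _); rewrite [in RHS]mulrDl -(mulrA a).
rewrite ltr_pdivlMr// mul1r.
have : x * (2 * k * (1 + a) * x) = x * (a - k) by rewrite xE.
have : 0 < x * (a - k) by rewrite mulr_gt0// /a; lra.
lra.
Qed.

(* The half of Karamata's theorem that is needed: with l = 1 + x the function
   D w = w * N w / k - H w satisfies D (l * w) <= D w, and D (l ^+ n * w) is
   eventually above any negative number. *)
Lemma karamata_ge (k : R) : 0 < k < iota - 1 ->
  \forall w \near +oo, k * H w <= w * N w.
Proof.
move=> kk; have /andP[k0 ki] := kk.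
have [x x0 xk] := powR_lt_karamata kk.
pose l := 1 + x; pose r := 1 - k * x.
have l0 : 0 < l by rewrite /l; lra.
have r0 : 0 < r by rewrite (le_lt_trans _ xk)// powR_ge0.
pose D w := w * N w / k - H w.
have step : \forall w \near +oo, forall y, w <= y -> D (l * y) <= D y.
  apply: near_pinfty_forall_ge.
  have t0 : 0 < l^-1 by rewrite invr_gt0.
  have t1 : l^-1 <= 1 by rewrite invf_le1// /l; lra.
  (* This is l ^ (1 - iota) < r rearranged. It yields l * N (l * w) <= r * N w, and the loss (1 - r)
     * w * N w / k = x * w * N w in the first term of [D] covers the decrease of [H] over
     [w, l * w]. *)
  have tk : l / r < l^-1 `^ (- iota).
    have -> : l^-1 `^ (- iota) = l `^ iota.
      by rewrite -(powR_inv1 (ltW l0)) -powRrM mulrNN mul1r.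
    rewrite ltr_pdivrMr// -[X in X < _](powRr1 (ltW l0)).
    have {1}-> : 1 = iota + (1 - iota) by lra.
    rewrite powRD ?(gt_eqF l0) ?implybT// ltr_pM2l ?powR_gt0//.
  have := near_pinfty_forall_ge (tail_ratio_ge t0 t1 tk).
  apply: filter_app; near=> w => /(_ (l * w)).
  have w0 : 0 < w by near: w; exact: nbhs_pinfty_gt.
  have wl : w <= l * w by rewrite /l mulrDl mul1r lerDl mulr_ge0// ltW.
  move=> /(_ wl); rewrite mulKf ?gt_eqF// => hN.
  have := H_incr_le wl.
  have -> : l * w - w = x * w by rewrite /l; ring.
  have hl : l * N (l * w) <= r * N w.
    by rewrite -ler_pdivrMl// mulrA (mulrC _ l).
  move=> hH; rewrite /D.
  have : l * w * N (l * w) / k <= r * w * N w / k.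
    rewrite ler_pM2r ?invr_gt0//.
    by have := ler_wpM2l (ltW w0) hl; lra.
  have -> : r * w * N w / k = w * N w / k - x * w * N w.
    by rewrite /r; field; rewrite gt_eqF.
  lra.
near=> w.
have w0 : 0 < w by near: w; exact: nbhs_pinfty_gt.
have stepw : forall y, w <= y -> D (l * y) <= D y by near: w; exact: step.
have Dn n : D (l ^+ n * w) <= D w.
  elim: n => [|n ih]; first by rewrite expr0 mul1r.
  rewrite exprS -mulrA (le_trans (stepw _ _))//.
  rewrite ler_peMl ?(ltW w0)// exprn_ege1//.
  by rewrite /l; lra.
have ln n : 1 + n%:R * x <= l ^+ n.
  elim: n => [|n ih]; first by rewrite expr0 mul0r addr0.
  rewrite exprS (@le_trans _ _ (l * (1 + n%:R * x)))//; last by rewrite ler_pM2l.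
  rewrite /l -natr1.
  have : 0 <= x * (n%:R * x) by rewrite !mulr_ge0// ltW.
  lra.
suff D0 : 0 <= D w.
  move: D0; rewrite /D subr_ge0 ler_pdivlMr//; lra.
rewrite leNgt; apply/negP => Dw0.
have [M [Mr MH]] : \forall y \near +oo, H y < - D w.
  by apply: (cvgr_lt _ H_cvg0); lra.
have [n Mn] : exists n, M < l ^+ n * w.
  have xw0 : 0 < x * w by rewrite mulr_gt0.
  exists (Num.truncn (`|M| / (x * w))).+1.
  have := truncnS_gt (`|M| / (x * w)).
  set n := (Num.truncn _).+1 => hn.
  have : M < n%:R * (x * w).
    by rewrite (le_lt_trans (ler_norm _))// -ltr_pdivrMr.
  have := ln n; rewrite -(ler_pM2r w0) mulrDl mul1r -mulrA; lra.
have := MH _ Mn; have := Dn n; rewrite /D.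
have : 0 < l ^+ n * w * N (l ^+ n * w) / k.
  by rewrite !mulr_gt0 ?invr_gt0// exprn_gt0.
lra.
Unshelve. all: by end_near. Qed.

(** Eventually w - A >= t * w for a [t] so close to 1 that t ^ (- iota) < k; regular variation at
    [t] and monotonicity do the rest. *)
Lemma tail_shift (A k : R) : 0 <= A -> 1 < k ->
  \forall w \near +oo, N (w - A) <= k * N w.
Proof.
move=> A0 k1; have iota0 : 0 < iota by exact: lt_trans ltr01 iota_gt1.
have [t /andP[t0 t1] tk] := powR_near1 iota0 k1.
near=> w.
apply: (@le_trans _ _ (N (t * w))); last first.
  by near: w; exact: tail_ratio_le (ltW t1) tk.
apply: N_noninc.
have : A / (1 - t) <= w by near: w; exact: (nbhs_pinfty_ge (num_real _)).
rewrite ler_pdivrMr; lra.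
Unshelve. all: by end_near. Qed.

(** The converse comparison, with a crude constant: H w >= H w - H (2 w) >= w * N (2 w), and N (2 w)
    is comparable to N w. *)
Lemma tail_le_integrated_tail : exists2 k, 0 < k &
  \forall w \near +oo, w * N w <= k * H w.
Proof.
pose k := (2^-1 : R) `^ (- iota) + 1.
have k0 : 0 < k by rewrite ltr_wpDl ?powR_ge0.
exists k => //.
have tk : (2^-1 : R) `^ (- iota) < k by rewrite /k ltrDl.
have h0 : 0 < (2^-1 : R) by rewrite invr_gt0.
have h1 : (2^-1 : R) <= 1 by rewrite invf_le1// ler1n.
have := near_pinfty_forall_ge (tail_ratio_le h0 h1 tk).
apply: filter_app; near=> w => /(_ (2 * w)).
have w0 : 0 < w by near: w; exact: nbhs_pinfty_gt.
have w2 : w <= 2 * w by lra.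
move=> /(_ w2); rewrite mulKf ?gt_eqF// => hN.
have := ler_wpM2l (ltW w0) hN.
have := H_incr_ge w2; have := integrated_tail_gt0 (2 * w).
have -> : 2 * w - w = w by lra.
move=> h2 h3 h4.
have : k * (w * N (2 * w)) <= k * H w by rewrite ler_pM2l//; lra.
lra.
Unshelve. all: by end_near. Qed.

Lemma tail_small (e : R) : 0 < e -> \forall w \near +oo, N w <= e * H w.
Proof.
move=> e0; have [k k0 hk] := tail_le_integrated_tail.
move: hk; apply: filter_app; near=> w => hk.
have w0 : 0 < w by near: w; exact: nbhs_pinfty_gt.
have kw : k / e <= w by near: w; exact: (nbhs_pinfty_ge (num_real _)).
have {}kw : k <= e * w by rewrite mulrC -ler_pdivrMr.
rewrite -(ler_pM2l w0) (le_trans hk)//.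
have := ler_wpM2r (ltW (integrated_tail_gt0 w)) kw; lra.
Unshelve. all: by end_near. Qed.

(** The increment H (w - A) - H w is at most A * N (w - A) <= 2 * A * N w, and N w / H w tends to 0;
    [e] is scaled so that 2 * (A + 1) * e = k - 1. *)
Lemma integrated_tail_shift (A k : R) : 0 <= A -> 1 < k ->
  \forall w \near +oo, H (w - A) <= k * H w.
Proof.
move=> A0 k1.
pose e := (k - 1) / (2 * (A + 1)).
have e0 : 0 < e by rewrite divr_gt0//; lra.
have eE : 2 * (A + 1) * e = k - 1 by rewrite mulrC divfK// gt_eqF//; lra.
near=> w.
have hN : N (w - A) <= 2 * N w by near: w; apply: tail_shift => //; rewrite ltr1n.
have hH : N w <= e * H w by near: w; exact: tail_small.
have wA : w - A <= w by lra.
have := H_incr_le wA; rewrite opprB subrKC => h.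
have := ler_wpM2l A0 hN; have := ler_wpM2l A0 hH.
have := integrated_tail_gt0 w => H0.
have : 2 * (A + 1) * e * H w = (k - 1) * H w by rewrite eE.
have := mulr_gt0 e0 H0.
lra.
Unshelve. all: by end_near. Qed.

Lemma integrated_tail_scale (t : R) : 0 < t < 1 -> exists2 k, 1 <= k &
  \forall w \near +oo, H (t * w) <= k * H w.
Proof.
move=> /andP[t0 t1].
have [k k0 hk] := tail_le_integrated_tail.
pose k' := t `^ (- iota) + 1.
have k'0 : 0 < k' by rewrite ltr_wpDl ?powR_ge0.
have tk : t `^ (- iota) < k' by rewrite /k' ltrDl.
exists (1 + k' * k); first by rewrite lerDl mulr_ge0 ?ltW.
move: hk; apply: filter_app; near=> w => hk.
have w0 : 0 < w by near: w; exact: nbhs_pinfty_gt.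
have hN : N (t * w) <= k' * N w by near: w; exact: tail_ratio_le (ltW t1) tk.
have tw : t * w <= w by rewrite ler_piMl ?ltW.
have := H_incr_le tw.
have : (w - t * w) * N (t * w) <= w * (k' * N w).
  by apply: ler_pM => //; rewrite ?subr_ge0// ?(ltW (N_gt0 _))// gerBl mulr_ge0// ltW.
have := ler_wpM2l (ltW k'0) hk.
lra.
Unshelve. all: by end_near. Qed.

(* The tangent inequality u^(1+g) - 1 <= (1+g) (u - 1) u^g at
   u = H (w - x) / H w reduces the claim to x * k_w x, where
   k_w x = N (w - x) / N w * u^g is close to 1 on [-A, A], nonnegative for
   x < -A and at most M for x <= z * w. *)
Lemma integrated_tail_powR_expansion (g z : R) : 0 < g -> 0 < z < 1 ->
  exists2 M, 1 <= M & forall A e, 0 <= A -> 0 < e ->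
  \forall w \near +oo, forall x, x <= z * w ->
    (H (w - x) / H w) `^ (1 + g) <= 1 + (1 + g) * (N w / H w) *
      (x + e * `|x| + M * (if A < `|x| then `|x| else 0)).
Proof.
move=> g0 /andP[z0 z1].
have z'01 : 0 < 1 - z < 1 by lra.
have [C2 C21 hC2] := integrated_tail_scale z'01.
pose C1 := (1 - z) `^ (- iota) + 1.
have C1k : (1 - z) `^ (- iota) < C1 by rewrite /C1 ltrDl.
have C11 : 1 <= C1 by rewrite /C1 lerDr powR_ge0.
have /andP[z'0 z'1] := z'01.
have hC1 := tail_ratio_le z'0 (ltW z'1) C1k.
(* For x <= z * w the point w - x stays above (1 - z) * w, so [C1] and [C2] bound the ratios of [N]
   and of [H], and [M] bounds [kk] below. *)
pose M := C1 * C2 `^ g.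
have M1 : 1 <= M.
  rewrite /M -[X in X <= _]mul1r ler_pM//.
  by rewrite -(powRr0 C2) ler_powR// ltW.
exists M => // A e A0 e0.
(* Chosen so that k * k ^ g = 1 + e: one factor [k] is allowed for the ratio of [N] and one for the
   ratio of [H]. *)
pose k := (1 + e) `^ (1 + g)^-1.
have g1 : 0 < 1 + g by lra.
have kE : k `^ (1 + g) = 1 + e.
  by rewrite /k -powRrM mulVf ?gt_eqF// powRr1//; lra.
have k1 : 1 < k.
  have : 1 `^ (1 + g)^-1 < (1 + e) `^ (1 + g)^-1.
    by apply: gt0_ltr_powR; rewrite ?invr_gt0// ?nnegrE; lra.
  by rewrite powR1.
have k0 : 0 < k by lra.
have kkg : k * k `^ g = 1 + e.
  by rewrite -kE powRD ?(gt_eqF k0) ?implybT// powRr1 ?ltW.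
have hN := near_pinfty_forall_ge (tail_shift A0 k1).
have hH := near_pinfty_forall_ge (integrated_tail_shift A0 k1).
near=> w => x xz.
have w0 : 0 < w by near: w; exact: nbhs_pinfty_gt.
have H0 := integrated_tail_gt0.
pose u := H (w - x) / H w.
have u0 : 0 < u by rewrite divr_gt0.
pose kk := N (w - x) / N w * u `^ g.
have Nw0 := N_gt0.
have kk0 : 0 < kk by rewrite mulr_gt0 ?divr_gt0// powR_gt0.
rewrite (le_trans (powR_tangent u0 g0))// lerD2l -[leLHS]mulrA -[leRHS]mulrA.
rewrite ler_pM2l//.
have step1 : (u - 1) * u `^ g <= N w / H w * (x * kk).
  have -> : N w / H w * (x * kk) = x * N (w - x) / H w * u `^ g.
    by rewrite /kk; field; rewrite !gt_eqF.
  rewrite ler_pM2r ?powR_gt0// ler_pdivlMr// mulrBl mul1r divfK ?gt_eqF//.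
  have [x0|/ltW x0] := leP 0 x.
    have : w - x <= w by lra.
    by move=> /H_incr_le; rewrite opprB subrKC.
  have : w <= w - x by lra.
  move=> /H_incr_ge; rewrite addrAC subrr add0r; lra.
apply: (le_trans step1).
rewrite ler_pM2l ?divr_gt0//.
have kk_le a b : 0 < a -> 0 < b -> N (w - x) <= a * N w -> H (w - x) <= b * H w ->
    kk <= a * b `^ g.
  move=> a0 b0 ha hb; apply: ler_pM; rewrite ?powR_ge0//.
  - by rewrite divr_ge0// ltW.
  - by rewrite ler_pdivrMr.
  - apply: ge0_ler_powR; rewrite ?nnegrE ?(ltW g0) ?(ltW u0) ?(ltW b0)//.
    by rewrite ler_pdivrMr.
have [x0|x0] := leP 0 x.
  rewrite (ger0_norm x0); have [xA|xA] := ltP A x.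
    have : kk <= M.
      apply: kk_le; [lra|lra| |].
        apply: (@le_trans _ _ (N ((1 - z) * w))); first by apply: N_noninc; lra.
        by near: w.
      apply: (@le_trans _ _ (H ((1 - z) * w))); last by near: w.
      by apply: integrated_tail_noninc; lra.
    move=> /(ler_wpM2l x0) h.
    have : 0 <= e * x by rewrite mulr_ge0// ltW.
    lra.
  have : kk <= 1 + e.
    rewrite -kkg; apply: kk_le => //.
      apply: (@le_trans _ _ (N (w - A))); first by apply: N_noninc; lra.
      by near: w; apply: tail_shift.
    apply: (@le_trans _ _ (H (w - A))).
      by apply: integrated_tail_noninc; lra.
    by near: w; apply: integrated_tail_shift.
  move=> /(ler_wpM2l x0); lra.
rewrite (ltr0_norm x0); have [xA|xA] := ltP A (- x).
  (* Far to the left no upper bound on [kk] is sought: the left-hand side is nonpositive, while M >=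
     1 makes the right-hand side nonnegative. *)
  have : x * kk <= 0 by rewrite nmulr_rle0// ltW.
  have : 1 * (- x) <= M * (- x) by rewrite ler_wpM2r//; lra.
  have : 0 <= e * (- x) by rewrite mulr_ge0; lra.
  lra.
(* As [x] is negative here, [kk] has to be bounded from below; the shift estimates are applied at w
   + A, and 1 / (1 + e) >= 1 - e. *)
suff : (1 - e) <= kk by move=> /(ler_wnM2l (ltW x0)); lra.
have Ng : N (w + A) * k >= N w.
  have -> : N w = N ((w + A) - A) by rewrite addrK.
  rewrite mulrC; have : w <= w + A by lra.
  by move: (w + A); near: w.
have Hg : H (w + A) * k >= H w.
  have -> : H w = H ((w + A) - A) by rewrite addrK.
  rewrite mulrC; have : w <= w + A by lra.
  by move: (w + A); near: w.
have Ng' : N (w + A) <= N (w - x) by apply: N_noninc; lra.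
have Hg' : H (w + A) <= H (w - x) by apply: integrated_tail_noninc; lra.
apply: (@le_trans _ _ (k^-1 * k^-1 `^ g)).
  have -> : k^-1 * k^-1 `^ g = (1 + e)^-1.
    rewrite -kkg invfM; congr (_ * _).
    by rewrite -(powR_inv1 (ltW k0)) -powRrM mulN1r powRN.
  rewrite -[leRHS]mul1r ler_pdivlMr; last lra.
  have : 0 <= e * e by rewrite mulr_ge0// ltW.
  lra.
apply: ler_pM; rewrite ?powR_ge0 ?invr_ge0 ?(ltW k0)//.
  by rewrite ler_pdivlMr// mulrC ler_pdivrMr// (le_trans Ng)// ler_pM2r.
apply: ge0_ler_powR; rewrite ?nnegrE ?invr_ge0 ?(ltW k0) ?(ltW u0) ?(ltW g0)//.
by rewrite ler_pdivlMr// mulrC ler_pdivrMr// (le_trans Hg)// ler_pM2r.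
Unshelve. all: by end_near. Qed.

End regularly_varying_tail.

(** * Integration against path laws *)

Section density_measure.
Local Open Scope ereal_scope.
Context {d : measure_display} {T : measurableType d} {R : realType}.
Variables (mu : {measure set T -> \bar R}) (k : T -> R).
Hypothesis k0 : forall x, (0 <= k x)%R.
Hypothesis mk : measurable_fun setT k.

Definition mdensity (k0 : forall x, (0 <= k x)%R) (mk : measurable_fun setT k)
  (C : set T) : \bar R := \int[mu]_(x in C) (k x)%:E.

Let mdensity0 : mdensity k0 mk set0 = 0.
Proof. exact: integral_set0. Qed.

Let mdensity_ge0 C : 0 <= mdensity k0 mk C.
Proof. by apply: integral_ge0 => x _; rewrite lee_fin. Qed.

Let mdensity_sigma_additive : semi_sigma_additive (mdensity k0 mk).
Proof.
move=> F mF tF mUF; rewrite /mdensity ge0_integral_bigcup//.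
- apply: is_cvg_nneseries => n _ _; exact: mdensity_ge0.
- exact/measurable_EFinP/measurable_funTS.
- by move=> x _; rewrite lee_fin.
Qed.

HB.instance Definition _ := isMeasure.Build _ _ _ (mdensity k0 mk)
  mdensity0 mdensity_ge0 mdensity_sigma_additive.

Import HBNNSimple.

(** [M] is known on measurable sets only; simple functions and monotone convergence carry the
    identity to [F]. *)
Lemma ge0_integral_density (M : {measure set T -> \bar R}) (F : T -> \bar R) :
  (forall C, measurable C -> M C = \int[mu]_(x in C) (k x)%:E) ->
  measurable_fun setT F -> (forall x, 0 <= F x) ->
  \int[M]_x F x = \int[mu]_x ((k x)%:E * F x).
Proof.
move=> Mk mF F0; pose f_ := nnsfun_approx measurableT mF.
have mk' : measurable_fun setT (fun x => (k x)%:E) by exact/measurable_EFinP.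
have mf_ n : measurable_fun setT (fun x => (f_ n x)%:E).
  by apply/measurable_EFinP; exact: measurable_funP.
transitivity (limn (fun n => \int[M]_x (f_ n x)%:E)).
  rewrite -monotone_convergence//.
  - apply: eq_integral => y _; apply/esym/cvg_lim => //.
    exact: cvg_nnsfun_approx.
  - by move=> n y _; rewrite lee_fin.
  - by move=> y _ m n mn; rewrite lee_fin; exact/lefP/nd_nnsfun_approx.
transitivity (limn (fun n => \int[mu]_x ((k x)%:E * (f_ n x)%:E))); last first.
  rewrite -monotone_convergence//.
  - apply: eq_integral => y _; apply/cvg_lim => //.
    apply: cvgeZl => //; exact: cvg_nnsfun_approx.
  - by move=> n; apply: emeasurable_funM.
  - by move=> n y _; rewrite mule_ge0// lee_fin.
  - move=> y _ m n mn; rewrite lee_wpmul2l ?lee_fin//.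
    exact/lefP/nd_nnsfun_approx.
congr (limn _); apply/funext => n.
under eq_integral do rewrite fimfunE -fsumEFin//.
rewrite ge0_integral_fsum//; last 2 first.
- by move=> y; exact/measurable_EFinP/measurable_funM.
- by move=> y x _; rewrite nnfun_muleindic_ge0.
under [RHS]eq_integral.
  move=> x xD; rewrite fimfunE -fsumEFin// ge0_mule_fsumr; last first.
    by move=> r; rewrite EFinM nnfun_muleindic_ge0.
  over.
rewrite [RHS]ge0_integral_fsum//; last 2 first.
- move=> r; apply: emeasurable_funM => //.
  exact/measurable_EFinP/measurable_funM.
- by move=> r x _; apply: mule_ge0; [rewrite lee_fin|rewrite EFinM nnfun_muleindic_ge0].
apply: eq_fsbigr => r _.
rewrite integralZl_indic_nnsfun// integral_indic// setIT.
have [r0|r0] := ltP r 0%R.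
  rewrite preimage_nnfun0// measure0 mule0 integral0_eq// => x _.
  by rewrite indicE in_set0 mulr0 mule0.
under [RHS]eq_integral do rewrite EFinM muleCA.
rewrite ge0_integralZl//; last 2 first.
- apply: emeasurable_funM => //; exact/measurable_EFinP.
- by move=> x _; rewrite mule_ge0 ?lee_fin.
rewrite Mk// [in LHS]integral_mkcond; congr (_ * _).
apply: eq_integral => x _; rewrite patchE indicE.
by case: ifPn; rewrite ?mule1 ?mule0.
Qed.

End density_measure.

Section path_law_integral.
Local Open Scope ereal_scope.
Context {d : measure_display} {T : measurableType d} {R : realType}.
Variables (Q : probability T R) (Y : nat -> {RV Q >-> R}) (q : R -> R -> R).

Local Notation hist := (history (fun n => Y n : T -> R)).
Local Notation S := (walk (fun n => Y n : T -> R)).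

Lemma measurable_walk n : measurable_fun setT (S n).
Proof.
rewrite /walk; under eq_fun do rewrite -(big_mkord xpredT (Y^~ _)).
rewrite (_ : (fun t => _) = fun t => \sum_(0 <= i < n) Y i t)%R; last first.
  by apply/funext => t; rewrite big_mkord.
by apply: measurable_sum => i.
Qed.

Lemma history_measurable n A : hist n A -> measurable A.
Proof.
move=> hA; apply: (hA measurable); split.
  split; [exact: measurable0| |exact: bigcupT_measurable].
  by move=> C mC; rewrite setTD; exact: measurableC.
move=> _ [k [B [_ mB ->]]].
by rewrite -[X in measurable X]setTI; exact: measurable_walk.
Qed.

(** The path law is the case of rectangles. Rectangles form a pi-system, so the joint law of (V, Y
    n) has density [k] with respect to the law of [V] times Lebesgue measure, and Tonelli gives the
    iterated integral. [V] may carry more of the past than the position, as long as [s] recovers S n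
    from it. *)
Lemma path_law_integral n {d0} {D : measurableType d0} (V : T -> D) (s : D -> R)
    (F : D * R -> \bar R) :
  measurable_fun setT (fun z : R * R => q z.1 z.2) ->
  (forall s x, 0 <= q s x)%R -> path_law Y q ->
  measurable_fun setT s -> (forall C, measurable C -> hist n (V @^-1` C)) ->
  (forall t, s (V t) = S n t) ->
  measurable_fun setT F -> (forall z, 0 <= F z) ->
  \int[Q]_t F (V t, Y n t) =
  \int[Q]_t \int[lebesgue_measure]_x ((q (S n t) x)%:E * F (V t, x)).
Proof.
move=> mq q0 lawY ms hV sV mF F0.
pose leb := @lebesgue_measure R; pose R' := measurableTypeR R.
have {}mF : measurable_fun [set: D * R'] F by exact: mF.
have mV : measurable_fun setT V.
  by move=> _ C mC; rewrite setTI; apply: history_measurable; exact: hV.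
pose V' : {mfun T >-> D} := HB.pack V (isMeasurableFun.Build _ _ _ _ V mV).
have mVY : measurable_fun setT (fun t => (V t, Y n t : R')).
  by apply: measurable_fun_pair => //; exact: (measurable_funP (Y n)).
pose VY : {mfun T >-> (D * R')%type} :=
  HB.pack (fun t => (V t, Y n t)) (isMeasurableFun.Build _ _ _ _ _ mVY).
pose nu := distribution Q V'.
have nuE (G : D -> \bar R) : measurable_fun setT G -> (forall v, 0 <= G v) ->
    \int[nu]_v G v = \int[Q]_t G (V t).
  by move=> mG G0; rewrite ge0_integral_pushforward// preimage_setT.
pose k (z : D * R') : R := q (s z.1) z.2.
have k0 z : (0 <= k z)%R by exact: q0.
have mk : measurable_fun setT k.
  have ms' : measurable_fun setT (fun z : D * R => (s z.1, z.2)).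
    exact: measurable_fun_pair (measurableT_comp ms (@measurable_fst _ _ _ _))
      (@measurable_snd _ _ _ _).
  have h : measurable_fun [set: D * R] k by exact: (measurableT_comp mq ms').
  exact: h.
have kE C : measurable C ->
    distribution Q VY C = \int[nu \x leb]_(z in C) (k z)%:E.
  move=> mC.
  pose m2 : {measure set (D * R') -> \bar R} := mdensity (nu \x leb) k0 mk.
  pose G := [set A `*` B | A in @measurable _ D & B in @measurable _ R'].
  rewrite -[RHS]/(m2 C).
  apply: (measure_unique G (fun _ => setT)) => //.
  - by rewrite measurable_prod_measurableType.
  - move=> _ _ [A1 mA1 [B1 mB1 <-]] [A2 mA2 [B2 mB2 <-]].
    rewrite -setXI; exists (A1 `&` A2); first exact: measurableI.
    by exists (B1 `&` B2) => //; exact: measurableI.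
  - by move=> _; exists setT => //; exists setT => //; rewrite setXTT.
  - by rewrite bigcup_const.
  - move=> _ [A mA [B mB <-]].
    transitivity (Q ((V @^-1` A) `&` (Y n @^-1` B))); first by [].
    rewrite lawY//; last exact: hV.
    rewrite /m2/= /mdensity.
    rewrite integral_mkcond fubini_tonelli1//; last 2 first.
    + apply/(measurable_restrictT _ (measurableX mA mB)).
      exact/measurable_EFinP/measurable_funTS.
    + by move=> z; rewrite patchE; case: ifPn => // _; rewrite lee_fin.
    rewrite [RHS]nuE; last 2 first.
    + apply: measurable_fun_fubini_tonelli_F => //.
        apply/(measurable_restrictT _ (measurableX mA mB)).
        exact/measurable_EFinP/measurable_funTS.
      by move=> z; rewrite patchE; case: ifPn => // _; rewrite lee_fin.
    + move=> v; apply: integral_ge0 => x _; rewrite patchE.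
      by case: ifPn => // _; rewrite lee_fin.
    rewrite [LHS]integral_mkcond; apply: eq_integral => t _ /=.
    rewrite patchE /fubini_F.
    case: ifPn => tA.
      rewrite [LHS]integral_mkcond; apply: eq_integral => x _.
      rewrite !patchE in_setX /= /k/= sV.
      by rewrite (_ : (V t \in A) = true)//; move: tA; rewrite inE/= => tA; rewrite inE.
    rewrite integral0_eq// => x _; rewrite patchE in_setX /=.
    by rewrite (_ : (V t \in A) = false)//; apply: contraNF tA; rewrite !inE.
  - by move=> _; rewrite -ge0_fin_numE ?measure_ge0//; exact: fin_num_measure.
transitivity (\int[distribution Q VY]_z F z).
  by rewrite ge0_integral_pushforward// preimage_setT.
rewrite (ge0_integral_density k0 mk kE)//.
have mkF : measurable_fun setT (fun z => (k z)%:E * F z).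
  by apply: emeasurable_funM => //; exact/measurable_EFinP.
have kF0 z : 0 <= (k z)%:E * F z by rewrite mule_ge0// lee_fin.
rewrite (fubini_tonelli1 _ mkF kF0).
rewrite [LHS]nuE; last 2 first.
- exact: measurable_fun_fubini_tonelli_F.
- by move=> v; apply: integral_ge0.
apply: eq_integral => t _ /=.
by rewrite /fubini_F /k/= sV.
Qed.

End path_law_integral.

(** * Series representations of functionals of the stopped path *)

Section first_passage_decomposition.
Context {R : realType} {d : measure_display} {T : measurableType d}.
Variables (b : R) (Y : nat -> T -> R).
Local Notation S := (walk Y).
Implicit Types (rho : R -> R -> R) (t : T) (n : nat).

(** Product of the step weights, killed at the first crossing. With rho = 1 it indicates that the
    first [n] partial sums stay below the level; with a power of the likelihood ratio it is the
    weight accumulated so far. *)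
Definition alive_weight rho n t : R :=
  \prod_(i < n) (rho (S i t) (Y i t) * (S i.+1 t <= b)%R%:R).

Definition hit_weight rho n t : R :=
  alive_weight rho n t * rho (S n t) (Y n t) * (b < S n.+1 t)%R%:R.

(** Increments are indexed from 0, so the passage time on this event is n + 1. *)
Definition passes n t : Prop := b < S n.+1 t /\ forall k, (k < n)%N -> S k.+1 t <= b.

Lemma walk0 t : S 0 t = 0.
Proof. by rewrite /walk big_ord0. Qed.

Lemma walkS n t : S n.+1 t = S n t + Y n t.
Proof. by rewrite /walk big_ord_recr. Qed.

Lemma alive_weight0 rho t : alive_weight rho 0 t = 1.
Proof. by rewrite /alive_weight big_ord0. Qed.

Lemma alive_weightS rho n t : alive_weight rho n.+1 t =
  alive_weight rho n t * (rho (S n t) (Y n t) * (S n.+1 t <= b)%R%:R).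
Proof. by rewrite /alive_weight big_ord_recr. Qed.

Lemma alive_weight_ge0 rho n t :
  (forall s x, 0 <= rho s x) -> 0 <= alive_weight rho n t.
Proof. by move=> rho0; apply: prodr_ge0 => i _; rewrite mulr_ge0// ler0n. Qed.

Lemma hit_weight_ge0 rho n t :
  (forall s x, 0 <= rho s x) -> 0 <= hit_weight rho n t.
Proof. by move=> rho0; rewrite !mulr_ge0 ?alive_weight_ge0// ler0n. Qed.

Lemma alive_weight_passes rho n k t : passes n t -> (k <= n)%N ->
  alive_weight rho k t = \prod_(i < k) rho (S i t) (Y i t).
Proof.
move=> [_ le_b] kn; apply: eq_bigr => i _.
by rewrite le_b ?mulr1// (leq_trans (ltn_ord i)).
Qed.

Lemma alive_weight_crossed rho k n t : b < S k.+1 t -> (k < n)%N ->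
  alive_weight rho n t = 0.
Proof.
move=> bk kn; apply/eqP/prodf_eq0; exists (Ordinal kn) => //=.
by rewrite leNgt bk mulr0.
Qed.

Lemma hit_weight_passes rho n k t : passes n t ->
  hit_weight rho k t =
  if k == n then \prod_(i < n.+1) rho (S i t) (Y i t) else 0.
Proof.
move=> pn; rewrite /hit_weight; have [bn le_b] := pn; case: ltngtP => kn.
- by rewrite ltNge le_b// mulr0.
- by rewrite (alive_weight_crossed _ bn kn) !mul0r.
- by rewrite kn (alive_weight_passes _ pn)// bn mulr1 big_ord_recr.
Qed.

Lemma passesP t : (exists n, passes n t) \/ (forall n, S n.+1 t <= b).
Proof.
have [nb|/existsNP[n0 /negP]] := pselect (forall n, S n.+1 t <= b); first by right.
rewrite -ltNge => bn0; left.
have ex : exists n, b < S n.+1 t by exists n0.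
exists (ex_minn ex); case: ex_minnP => m bm min_m; split => // k km.
by rewrite leNgt; apply/negP => /min_m; rewrite leqNgt km.
Qed.

Lemma passage_time_passes n t : passes n t ->
  passage_time b Y t = (n.+1%:R)%:E.
Proof.
move=> [bn le_b]; apply/eqP; rewrite eq_le; apply/andP; split.
  by apply: ereal_inf_lbound; exists n.+1.
apply: le_ereal_inf_tmp => _ [k [k0 bk] <-].
rewrite lee_fin ler_nat; case: k k0 bk => // k _ bk.
by rewrite ltnNge; apply/negP => kn; move: bk; rewrite ltNge le_b.
Qed.

Lemma passage_time_never t : (forall n, S n.+1 t <= b) ->
  passage_time b Y t = +oo%E.
Proof.
move=> nb; rewrite /passage_time (_ : [set n | _] = set0) ?image_set0 ?ereal_inf0//.
apply/seteqP; split => // -[|n] [] //= _.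
by rewrite ltNge nb.
Qed.

Lemma passage_time_ge0 t : (0 <= passage_time b Y t)%E.
Proof. by apply: le_ereal_inf_tmp => _ [n _ <-]; rewrite lee_fin ler0n. Qed.

Lemma nneseries_pt (u : nat -> \bar R) n : (forall k, k != n -> u k = 0%E) ->
  (\sum_(k <oo) u k)%E = u n.
Proof.
move=> u0; apply/cvg_lim => //; rewrite -(cvg_shiftn n.+1)/=.
rewrite (_ : (fun _ => _) = cst (u n)); first exact: cvg_cst.
apply/funext => m /=; rewrite big_mkord.
have nm : (n < m + n.+1)%N by rewrite addnS ltnS leq_addl.
rewrite (bigD1 (Ordinal nm))//= big1 ?adde0// => i ni; apply: u0.
by apply: contra ni => /eqP ni; apply/eqP/val_inj.
Qed.

Lemma estimator_passes (f : R -> R) (q : R -> R -> R) n t : passes n t ->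
  estimator f q b Y t = \prod_(i < n.+1) (f (Y i t) / q (S i t) (Y i t)).
Proof.
move=> pn; rewrite /estimator (passage_time_passes pn) ltry.
rewrite -[fine _]/(n.+1%:R) natrK big_add1 big_mkord; apply: eq_bigr => i _ /=.
by rewrite walkS addrAC subrr add0r.
Qed.

Lemma estimator_never (f : R -> R) (q : R -> R -> R) t :
  (forall n, S n.+1 t <= b) -> estimator f q b Y t = 0.
Proof. by move=> nb; rewrite /estimator (passage_time_never nb) ltxx. Qed.

Lemma hit_weight_never rho n t : (forall n, S n.+1 t <= b) ->
  hit_weight rho n t = 0.
Proof. by move=> nb; rewrite /hit_weight ltNge nb mulr0. Qed.

Lemma powR_prod (I : Type) (s : seq I) (F : I -> R) (p : R) :
  (forall i, 0 <= F i) ->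
  (\prod_(i <- s) F i) `^ p = \prod_(i <- s) (F i) `^ p.
Proof.
move=> F0; elim: s => [|i s ih]; first by rewrite !big_nil powR1.
by rewrite !big_cons powRM// ?ih// prodr_ge0.
Qed.

(** At most one term of the series is nonzero, hence the power can be taken inside. On paths that
    never cross both sides vanish, which uses 0 < p. *)
Lemma estimator_powR (f : R -> R) (q : R -> R -> R) (p : R) t :
  (forall x, 0 <= f x) -> (forall s x, 0 <= q s x) -> 0 < p ->
  ((estimator f q b Y t `^ p)%:E =
   \sum_(n <oo) (hit_weight (fun s x => (f x / q s x) `^ p) n t)%:E)%E.
Proof.
move=> f0 q0 p0; have [[n pn]|nb] := passesP t.
  rewrite (nneseries_pt (n := n)) => [|k kn]; last first.
    by rewrite (hit_weight_passes _ _ pn) (negbTE kn).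
  rewrite (hit_weight_passes _ _ pn) eqxx (estimator_passes _ _ pn).
  by rewrite powR_prod// => i; rewrite divr_ge0.
rewrite (estimator_never _ _ nb) powR0 ?gt_eqF// eseries0// => n _ _.
by rewrite hit_weight_never.
Qed.

(** The identity tau = sum over n >= 0 of the indicator of tau > n; the term n = 0 is 1. *)
Lemma passage_time_alive t :
  passage_time b Y t = (\sum_(n <oo) (alive_weight (fun _ _ => 1) n t)%:E)%E.
Proof.
have [[n pn]|nb] := passesP t.
  rewrite (passage_time_passes pn).
  rewrite (nneseries_split 0 n.+1) => [|k _]; last first.
    by rewrite lee_fin alive_weight_ge0.
  rewrite add0n eseries0 ?adde0; last first.
    move=> k nk _; have [bn _] := pn; rewrite (alive_weight_crossed _ bn)//.
  rewrite big_mkord (eq_bigr (fun _ => 1%E)); last first.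
    move=> i _; rewrite (alive_weight_passes _ pn) ?big1//.
    by rewrite -ltnS.
  by rewrite sumEFin sumr_const card_ord.
rewrite passage_time_never//; apply/esym/cvg_lim => //.
rewrite (_ : (fun n => _) = fun n => (n%:R)%:E).
  exact/cvgenyP.
apply/funext => n; rewrite big_mkord (eq_bigr (fun _ => 1%E)).
  by rewrite sumEFin sumr_const card_ord.
move=> i _; rewrite /alive_weight big1// => j _.
by rewrite nb mulr1.
Qed.

Lemma passage_time_lty t : ((passage_time b Y t < +oo)%E)%:R%:E =
  (\sum_(n <oo) (hit_weight (fun _ _ => 1) n t)%:E)%E.
Proof.
have [[n pn]|nb] := passesP t.
  rewrite (passage_time_passes pn) ltry (nneseries_pt (n := n)) => [|k kn].
    by rewrite (hit_weight_passes _ _ pn) eqxx big1.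
  by rewrite (hit_weight_passes _ _ pn) (negbTE kn).
rewrite (passage_time_never nb) ltxx eseries0// => n _ _.
by rewrite hit_weight_never.
Qed.

(** Increment number j + 1 is generated exactly when the walk is still alive after [j] steps. *)
Lemma replication_costE (c : nat -> T -> R) t : replication_cost c b Y t =
  (\sum_(j <oo) (c j t * alive_weight (fun _ _ => 1) j t)%:E)%E.
Proof.
apply: eq_eseriesr => j _.
have [[n pn]|nb] := passesP t.
  rewrite (passage_time_passes pn) lte_fin ltr_nat ltnS.
  case: leqP => jn; first by rewrite (alive_weight_passes _ pn jn) big1 ?mulr1.
  by have [bn _] := pn; rewrite (alive_weight_crossed _ bn jn) mulr0.
rewrite (passage_time_never nb) ltry /alive_weight big1 ?mulr1// => i _.
by rewrite nb mulr1.
Qed.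

Lemma replication_cost_le (kappa : R) (c : nat -> T -> R) t :
  (forall j, 0 <= c j t <= kappa) ->
  (replication_cost c b Y t <= kappa%:E * passage_time b Y t)%E.
Proof.
move=> hc; rewrite replication_costE passage_time_alive -nneseriesZl//; last first.
  by move=> n _; rewrite lee_fin alive_weight_ge0.
apply: lee_nneseries => [j _ _|j _]; have /andP[c0 ck] := hc j.
  by rewrite lee_fin mulr_ge0// alive_weight_ge0.
by rewrite -EFinM lee_fin ler_wpM2r// alive_weight_ge0.
Qed.

End first_passage_decomposition.

Section indicators.
Context {R : realType}.

Lemma measurable_le_indicator (b : R) :
  measurable_fun setT (fun x : R => (x <= b)%R%:R : R).
Proof.
rewrite (_ : (fun x : R => _) = \1_`]-oo, b]%classic); first exact: measurable_indic.
by apply/funext => x; rewrite indicE mem_setE in_itv.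
Qed.

Lemma measurable_gt_indicator (b : R) :
  measurable_fun setT (fun x : R => (b < x)%R%:R : R).
Proof.
rewrite (_ : (fun x : R => _) = \1_`]b, +oo[%classic); first exact: measurable_indic.
by apply/funext => x; rewrite indicE mem_setE in_itv/= andbT.
Qed.

End indicators.

Section weighted_walk.
Local Open Scope ereal_scope.
Context {R : realType} {d : measure_display} {T : measurableType d}.
Variables (Q : probability T R) (Y : nat -> {RV Q >-> R}).
Variables (b : R).

Local Notation S := (walk (fun n => Y n : T -> R)).
Local Notation alive := (alive_weight b (fun n => Y n : T -> R)).
Local Notation hit := (hit_weight b (fun n => Y n : T -> R)).
Local Notation gens n := [set A : set T | exists k (B : set R),
  [/\ (k <= n)%N, measurable B & A = S k @^-1` B]].

Lemma measurable_walk_history n k : (k <= n)%N ->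
  measurable_fun setT (S k : g_sigma_algebraType (gens n) -> R).
Proof.
move=> kn _ B mB; rewrite setTI.
by apply: sub_sigma_algebra; exists k, B.
Qed.

(** The history is generated by the partial sums, so each increment is first rewritten as a
    difference of two of them. *)
Lemma measurable_alive_history (rho : R -> R -> R) n :
  measurable_fun setT (fun z : R * R => rho z.1 z.2) ->
  measurable_fun setT (alive rho n : g_sigma_algebraType (gens n) -> R).
Proof.
move=> mrho; rewrite /alive_weight.
rewrite (_ : (fun t => _) = fun t =>
  (\prod_(i < n | true) (rho (S i t) (S i.+1 t - S i t) *
  (S i.+1 t <= b)%R%:R))%R); last first.
  by apply/funext => t; apply: eq_bigr => i _; rewrite walkS addrAC subrr add0r.
apply: measurable_prod => i _; apply: measurable_funM.
  have h : measurable_fun setT (fun t : g_sigma_algebraType (gens n) =>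
      (S i t, S i.+1 t - S i t)%R).
    apply: measurable_fun_pair; first exact: measurable_walk_history (ltnW (ltn_ord i)).
    apply: measurable_funB; first exact: measurable_walk_history (ltn_ord i).
    exact: measurable_walk_history (ltnW (ltn_ord i)).
  exact: (measurableT_comp mrho h).
exact: (measurableT_comp (measurable_le_indicator b)
  (measurable_walk_history (ltn_ord i))).
Qed.

Lemma history_walk_alive (rho : R -> R -> R) n (C : set (R * R)) :
  measurable_fun setT (fun z : R * R => rho z.1 z.2) -> measurable C ->
  history (fun n => Y n : T -> R) n ((fun t => (S n t, alive rho n t)) @^-1` C).
Proof.
move=> mrho mC.
have h : measurable_fun setT (fun t : g_sigma_algebraType (gens n) =>
    (S n t, alive rho n t)).
  apply: measurable_fun_pair; first exact: measurable_walk_history.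
  exact: measurable_alive_history.
by have := h measurableT _ mC; rewrite setTI.
Qed.

Lemma measurable_alive (rho : R -> R -> R) n :
  measurable_fun setT (fun z : R * R => rho z.1 z.2) ->
  measurable_fun setT (alive rho n).
Proof.
move=> mrho _ B mB; rewrite setTI.
apply: (@history_measurable _ _ _ Q Y n).
have := @measurable_alive_history rho n mrho measurableT _ mB.
by rewrite setTI.
Qed.

(** Allows drift inequalities to be required only at positions s <= b. At n = 0 the walk is at 0,
    which is where 0 <= b enters. *)
Lemma alive_weight_out (rho : R -> R -> R) n t : (0 <= b)%R ->
  (b < S n t)%R -> alive rho n t = 0%R.
Proof.
case: n => [|n] b0; first by rewrite walk0 ltNge b0.
by move=> bS; rewrite (alive_weight_crossed _ bS).
Qed.

Section one_step.
Variable q : R -> R -> R.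
Hypothesis mq : measurable_fun setT (fun z : R * R => q z.1 z.2).
Hypothesis q0 : forall s x, (0 <= q s x)%R.
Hypothesis lawY : path_law Y q.
Variable rho : R -> R -> R.
Hypothesis mrho : measurable_fun setT (fun z : R * R => rho z.1 z.2).
Hypothesis rho0 : forall s x, (0 <= rho s x)%R.

Lemma integral_alive_step n (G : R * R -> \bar R) :
  measurable_fun setT G -> (forall z, 0 <= G z) ->
  \int[Q]_t ((alive rho n t)%:E * G (S n t, Y n t)) =
  \int[Q]_t ((alive rho n t)%:E *
    \int[lebesgue_measure]_x ((q (S n t) x)%:E * G (S n t, x))).
Proof.
move=> mG G0.
pose V t := (S n t, alive rho n t).
(* The absolute value makes [F] nonnegative for every value of the second coordinate; it changes
   nothing on the weights, which are nonnegative. *)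
pose F (z : (R * R) * R) := (`|z.1.2|)%:E * G (z.1.1, z.2).
have mF : measurable_fun setT F.
  apply: emeasurable_funM.
    apply/measurable_EFinP; apply: measurableT_comp => //.
    exact: (measurableT_comp measurable_snd measurable_fst).
  have h : measurable_fun setT (fun z : (R * R) * R => (z.1.1, z.2)).
    apply: measurable_fun_pair => //.
    exact: (measurableT_comp measurable_fst measurable_fst).
  exact: (measurableT_comp mG h).
have F0 z : 0 <= F z by rewrite mule_ge0// lee_fin.
have alive0 t : (0 <= alive rho n t)%R by exact: alive_weight_ge0.
transitivity (\int[Q]_t F (V t, Y n t)).
  by apply: eq_integral => t _; rewrite /F/= ger0_norm.
rewrite (path_law_integral mq q0 lawY (@measurable_fst _ _ R R)
  (fun C => @history_walk_alive rho n C mrho))//.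
apply: eq_integral => t _; rewrite /F/= ger0_norm//.
have mqs : measurable_fun setT (fun x : R => (q (S n t) x)%:E * G (S n t, x)).
  have h : measurable_fun setT (fun x : R => (S n t, x)) by exact: measurable_fun_pair.
  apply: emeasurable_funM; last exact: (measurableT_comp mG h).
  apply/measurable_EFinP; exact: (measurableT_comp mq h).
rewrite -ge0_integralZl//; last 2 first.
- by move=> x _; rewrite mule_ge0// lee_fin.
- by rewrite lee_fin.
by apply: eq_integral => x _; rewrite muleCA.
Qed.

End one_step.

End weighted_walk.

(** * Lyapunov inequalities and change of law *)

Section lyapunov.
Local Open Scope ereal_scope.
Context {R : realType}.

Lemma measurable_step_integral (q : R -> R -> R) (G : R * R -> \bar R) :
  measurable_fun setT (fun z : R * R => q z.1 z.2) ->
  (forall s x, (0 <= q s x)%R) ->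
  measurable_fun setT G -> (forall z, 0 <= G z) ->
  measurable_fun setT
    (fun s : R => \int[lebesgue_measure]_x ((q s x)%:E * G (s, x))).
Proof.
move=> mq q0 mG G0.
pose F (z : R * measurableTypeR R) := (q z.1 z.2)%:E * G z.
have mF : measurable_fun setT F.
  have h : measurable_fun [set: R * R] F.
    apply: emeasurable_funM => //; exact/measurable_EFinP.
  exact: h.
have F0 z : 0 <= F z by rewrite mule_ge0// lee_fin.
exact: (@measurable_fun_fubini_tonelli_F _ _ _ _ _ (@lebesgue_measure R) F mF F0).
Qed.

Section one_law.
Context {d : measure_display} {T : measurableType d}.
Variables (Q : probability T R) (Y : nat -> {RV Q >-> R}) (b : R).
Variables q rho : R -> R -> R.
Hypothesis b0 : (0 <= b)%R.
Hypothesis mq : measurable_fun setT (fun z : R * R => q z.1 z.2).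
Hypothesis q0 : forall s x, (0 <= q s x)%R.
Hypothesis lawY : path_law Y q.
Hypothesis mrho : measurable_fun setT (fun z : R * R => rho z.1 z.2).
Hypothesis rho0 : forall s x, (0 <= rho s x)%R.

Local Notation S := (walk (fun n => Y n : T -> R)).
Local Notation alive := (alive_weight b (fun n => Y n : T -> R)).
Local Notation hit := (hit_weight b (fun n => Y n : T -> R)).

Let measurable_sum_fun : measurable_fun setT (fun z : R * R => (z.1 + z.2)%R).
Proof. exact: measurable_funD. Qed.

Lemma measurable_alive_kernel (h : R -> \bar R) : measurable_fun setT h ->
  measurable_fun setT
    (fun z : R * R => (rho z.1 z.2 * (z.1 + z.2 <= b)%R%:R)%:E * h (z.1 + z.2)%R).
Proof.
move=> mh; apply: emeasurable_funM.
  apply/measurable_EFinP; apply: measurable_funM => //.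
  exact: (measurableT_comp (measurable_le_indicator b) measurable_sum_fun).
exact: (measurableT_comp mh measurable_sum_fun).
Qed.

Lemma alive_kernel_ge0 (h : R -> \bar R) z : (forall s, 0 <= h s) ->
  0 <= (rho z.1 z.2 * (z.1 + z.2 <= b)%R%:R)%:E * h (z.1 + z.2)%R.
Proof. by move=> h0; rewrite mule_ge0// lee_fin mulr_ge0. Qed.

Lemma integral_alive_succ n (h : R -> \bar R) :
  measurable_fun setT h -> (forall s, 0 <= h s) ->
  \int[Q]_t ((alive rho n.+1 t)%:E * h (S n.+1 t)) =
  \int[Q]_t ((alive rho n t)%:E * \int[lebesgue_measure]_x ((q (S n t) x)%:E *
    ((rho (S n t) x * (S n t + x <= b)%R%:R)%:E * h (S n t + x)%R))).
Proof.
move=> mh h0.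
pose G (z : R * R) := (rho z.1 z.2 * (z.1 + z.2 <= b)%R%:R)%:E * h (z.1 + z.2)%R.
rewrite -(integral_alive_step b mq q0 lawY mrho rho0 n (G := G)).
- by apply: eq_integral => t _; rewrite alive_weightS walkS EFinM muleA.
- exact: measurable_alive_kernel.
- by move=> z; exact: alive_kernel_ge0.
Qed.

Lemma measurable_hit_kernel :
  measurable_fun setT (fun z : R * R => (rho z.1 z.2 * (b < z.1 + z.2)%R%:R)%:E).
Proof.
apply/measurable_EFinP; apply: measurable_funM => //.
exact: (measurableT_comp (measurable_gt_indicator b) measurable_sum_fun).
Qed.

Lemma integral_hit n :
  \int[Q]_t (hit rho n t)%:E =
  \int[Q]_t ((alive rho n t)%:E * \int[lebesgue_measure]_x ((q (S n t) x)%:E *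
    (rho (S n t) x * (b < S n t + x)%R%:R)%:E)).
Proof.
pose G (z : R * R) := (rho z.1 z.2 * (b < z.1 + z.2)%R%:R)%:E.
rewrite -(integral_alive_step b mq q0 lawY mrho rho0 n (G := G)).
- apply: eq_integral => t _; rewrite /hit_weight walkS -mulrA EFinM.
  by [].
- exact: measurable_hit_kernel.
- by move=> z; rewrite lee_fin mulr_ge0.
Qed.

Lemma measurable_hit n : measurable_fun setT (hit rho n).
Proof.
rewrite /hit_weight; apply: measurable_funM; last first.
  exact: (measurableT_comp (measurable_gt_indicator b) (measurable_walk Y n.+1)).
apply: measurable_funM; first exact: measurable_alive.
have h : measurable_fun setT (fun t => (S n t, Y n t)).
  by apply: measurable_fun_pair => //; exact: measurable_walk.
exact: (measurableT_comp mrho h).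
Qed.

(** The induction keeps the integral of alive n * g (S n) next to the partial sum, so that the drift
    inequality telescopes; that term is dropped in the limit. [ell] will be 1 for the passage time,
    and the expected weight of a crossing at the next step for the moment. *)
Lemma lyapunov_series (g : R -> R) (ell : R -> \bar R) :
  measurable_fun setT g -> (forall s, (0 <= g s)%R) ->
  measurable_fun setT ell -> (forall s, 0 <= ell s) ->
  (forall s, (s <= b)%R ->
    ell s + \int[lebesgue_measure]_x ((q s x)%:E *
      ((rho s x * (s + x <= b)%R%:R)%:E * (g (s + x)%R)%:E)) <= (g s)%:E) ->
  \sum_(n <oo) \int[Q]_t ((alive rho n t)%:E * ell (S n t)) <= (g 0%R)%:E.
Proof.
move=> mg g0 mell ell0 drift.
have mg' : measurable_fun setT (EFin \o g) by exact/measurable_EFinP.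
have g0' s : 0 <= (EFin \o g) s by rewrite lee_fin.
have alive0 n t : 0 <= (alive rho n t)%:E by rewrite lee_fin alive_weight_ge0.
have malive n : measurable_fun setT (fun t => (alive rho n t)%:E).
  by apply/measurable_EFinP; exact: measurable_alive.
have mS n := measurable_walk Y n.
pose I s := \int[lebesgue_measure]_x ((q s x)%:E *
      ((rho s x * (s + x <= b)%R%:R)%:E * (g (s + x)%R)%:E)).
have I0 s : 0 <= I s.
  by apply: integral_ge0 => x _; rewrite !mule_ge0// lee_fin// mulr_ge0.
have mI : measurable_fun setT I.
  exact: (measurable_step_integral mq q0 (measurable_alive_kernel mg')
    (fun z => alive_kernel_ge0 z g0')).
have partial n : \sum_(k < n) \int[Q]_t ((alive rho k t)%:E * ell (S k t)) +
    \int[Q]_t ((alive rho n t)%:E * (g (S n t))%:E) <= (g 0%R)%:E.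
  elim: n => [|n ih].
    rewrite big_ord0 add0e.
    under eq_integral do rewrite alive_weight0 walk0 mul1e.
    by rewrite integral_cst// [X in _ * X](@probability_setT _ _ _ Q) mule1.
  rewrite big_ord_recr/=; apply: le_trans ih; rewrite -addeA leeD2l//.
  rewrite (integral_alive_succ n mg' g0') -/(I _) -ge0_integralD//; last 4 first.
  - by move=> t _; rewrite mule_ge0.
  - by apply: emeasurable_funM => //; exact: (measurableT_comp mell).
  - by move=> t _; apply: mule_ge0 => //; exact: I0.
  - by apply: emeasurable_funM => //; exact: (measurableT_comp mI (mS n)).
  apply: ge0_le_integral => //.
  - by move=> t _; apply: adde_ge0; apply: mule_ge0 => //; exact: I0.
  - apply: emeasurable_funD; apply: emeasurable_funM => //.
      exact: (measurableT_comp mell).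
    exact: (measurableT_comp mI (mS n)).
  - by apply: emeasurable_funM => //; exact: (measurableT_comp mg').
  move=> t _ /=; have [Sb|bS] := leP (S n t) b; last first.
    by rewrite (alive_weight_out _ b0 bS) !mul0e adde0.
  rewrite -ge0_muleDr // ?I0 //.
  by apply: lee_wpmul2l => //; exact: drift.
apply: lime_le.
  by apply: is_cvg_nneseries => n _ _; apply: integral_ge0 => t _; rewrite mule_ge0.
apply: nearW => n; rewrite big_mkord (le_trans _ (partial n))// leeDl//.
by apply: integral_ge0 => t _; apply: mule_ge0 => //; rewrite lee_fin.
Qed.

End one_law.

Section change_of_law.
Context {d d' : measure_display} {T : measurableType d} {T' : measurableType d'}.
Variables (Q : probability T R) (Y : nat -> {RV Q >-> R}).
Variables (P : probability T' R) (X : nat -> {RV P >-> R}) (b : R).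
Variables q rho q' rho' : R -> R -> R.
Hypothesis mq : measurable_fun setT (fun z : R * R => q z.1 z.2).
Hypothesis q0 : forall s x, (0 <= q s x)%R.
Hypothesis lawY : path_law Y q.
Hypothesis mrho : measurable_fun setT (fun z : R * R => rho z.1 z.2).
Hypothesis rho0 : forall s x, (0 <= rho s x)%R.
Hypothesis mq' : measurable_fun setT (fun z : R * R => q' z.1 z.2).
Hypothesis q'0 : forall s x, (0 <= q' s x)%R.
Hypothesis lawX : path_law X q'.
Hypothesis mrho' : measurable_fun setT (fun z : R * R => rho' z.1 z.2).
Hypothesis rho'0 : forall s x, (0 <= rho' s x)%R.
Hypothesis balance : forall s x, (q s x * rho s x = q' s x * rho' s x)%R.

Local Notation aliveY := (alive_weight b (fun n => Y n : T -> R)).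
Local Notation aliveX := (alive_weight b (fun n => X n : T' -> R)).
Local Notation hitY := (hit_weight b (fun n => Y n : T -> R)).
Local Notation hitX := (hit_weight b (fun n => X n : T' -> R)).

(** [balance] makes the weighted one-step kernels coincide, so the last step of both chains can be
    absorbed into [h]; hence the induction over all [h] at once. *)
Lemma integral_alive_change n (h : R -> \bar R) :
  measurable_fun setT h -> (forall s, 0 <= h s) ->
  \int[Q]_t ((aliveY rho n t)%:E * h (walk (fun n => Y n : T -> R) n t)) =
  \int[P]_t ((aliveX rho' n t)%:E * h (walk (fun n => X n : T' -> R) n t)).
Proof.
elim: n h => [|n ih] h mh h0.
  under eq_integral do rewrite alive_weight0 walk0 mul1e.
  under [RHS]eq_integral do rewrite alive_weight0 walk0 mul1e.
  rewrite [LHS]integral_cst// [RHS]integral_cst//.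
  by congr (_ * _); rewrite [LHS]probability_setT [RHS]probability_setT.
rewrite (integral_alive_succ _ mq q0 lawY mrho rho0 n mh h0).
rewrite (integral_alive_succ _ mq' q'0 lawX mrho' rho'0 n mh h0).
pose I s := \int[lebesgue_measure]_x ((q s x)%:E *
      ((rho s x * (s + x <= b)%R%:R)%:E * h (s + x)%R)).
rewrite (ih I); last 2 first.
- exact: (measurable_step_integral mq q0 (measurable_alive_kernel b mrho mh)
    (fun z => alive_kernel_ge0 b rho0 z h0)).
- move=> s; apply: integral_ge0 => x _.
  by rewrite mule_ge0 ?lee_fin// (alive_kernel_ge0 b rho0 (s, x) h0).
apply: eq_integral => t _; congr (_ * _); apply: eq_integral => x _.
by rewrite !muleA -!EFinM !mulrA balance.
Qed.

Lemma integral_hit_change n :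
  \int[Q]_t (hitY rho n t)%:E = \int[P]_t (hitX rho' n t)%:E.
Proof.
rewrite (integral_hit _ mq q0 lawY mrho rho0) (integral_hit _ mq' q'0 lawX mrho' rho'0).
pose I s := \int[lebesgue_measure]_x ((q s x)%:E *
    (rho s x * (b < s + x)%R%:R)%:E).
rewrite (integral_alive_change n (h := I)); last 2 first.
- apply: (measurable_step_integral mq q0 (measurable_hit_kernel b mrho)).
  by move=> z; rewrite lee_fin mulr_ge0.
- by move=> s; apply: integral_ge0 => x _; rewrite mule_ge0 ?lee_fin// mulr_ge0.
apply: eq_integral => t _; congr (_ * _); apply: eq_integral => x _.
by rewrite -!EFinM !mulrA balance.
Qed.

End change_of_law.

End lyapunov.

(** * The random walk and a lower bound for the crossing probability *)

Section iid_path_law.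
Local Open Scope ereal_scope.
Context {d : measure_display} {T : measurableType d} {R : realType}.
Variables (P : probability T R) (X : nat -> {RV P >-> R}) (f : R -> R).
Hypothesis X_iid : iid X.
Hypothesis X_density : has_density (X 0%N) f.

Let cylinder n (B : nat -> set R) := \bigcap_(i in [set` seq.iota 0 n]) (X i @^-1` B i).
Let cylinders n :=
  [set A | exists2 B : nat -> set R, (forall i, measurable (B i)) & A = cylinder n B].

Let measurable_preimage i (B : set R) : measurable B -> measurable (X i @^-1` B).
Proof. by move=> mB; rewrite -[X in measurable X]setTI; exact: (measurable_funP (X i)). Qed.

Let measurable_cylinder n B : (forall i, measurable (B i)) -> measurable (cylinder n B).
Proof.
move=> mB; apply: fin_bigcap_measurable => // i _.
exact: measurable_preimage.
Qed.

Let cylinderP n B t : cylinder n B t <-> forall i, (i < n)%N -> B i (X i t).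
Proof.
split=> [tB i ii|tB i ii]; first by apply: tB; rewrite /mkset mem_iota add0n.
by apply: tB; move: ii; rewrite /mkset mem_iota add0n.
Qed.

Let cylinder_prob n B : (forall i, measurable (B i)) ->
  P (cylinder n B) = \prod_(i <- seq.iota 0 n) P (X i @^-1` B i).
Proof. by move=> mB; case: X_iid => ind _; apply: ind => //; exact: iota_uniq. Qed.

(** Both sides are finite measures in [A], the restriction of [P] to the event and a multiple of
    [P]. They agree on cylinders by independence, and the cylinders of the first [n] increments
    generate a sigma-algebra containing the history. *)
Lemma independent_next n (A : set T) (B : set R) :
  history (fun n => X n : T -> R) n A -> measurable B ->
  P (A `&` X n @^-1` B) = P A * P (X n @^-1` B).
Proof.
move=> hA mB.
have mXB := measurable_preimage n mB.
have PB_fin : P (X n @^-1` B) \is a fin_num by exact: fin_num_measure.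
have r0 : (0 <= fine (P (X n @^-1` B)))%R by rewrite fine_ge0.
pose m1 := mrestr P mXB.
pose m2 := mscale (NngNum r0) P.
have sA : <<s cylinders n >> A.
  pose TG := g_sigma_algebraType (cylinders n).
  have mX i : (i < n)%N -> measurable_fun setT (X i : TG -> R).
    move=> ik _ C mC; rewrite setTI; apply: sub_sigma_algebra.
    exists (fun j => if j == i then C else setT) => [j|].
      by case: ifPn.
    apply/seteqP; split => [t XC|t /cylinderP/(_ i ik)]; last by rewrite eqxx.
    by apply/cylinderP => j _; case: eqP => [->|].
  have mS k : (k <= n)%N -> measurable_fun setT (walk (fun n => X n : T -> R) k : TG -> R).
    move=> kn; rewrite /walk.
    apply: (@measurable_sum _ TG R setT _ _ (fun i : 'I_k => X i)) => i.
    by apply: mX; exact: leq_trans (ltn_ord i) kn.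
  apply: hA; split.
    exact: (@sigma_algebra_measurable _ TG).
  move=> _ [k [C [kn mC ->]]].
  by have := mS k kn measurableT _ mC; rewrite setTI.
have -> : P (A `&` X n @^-1` B) = m1 A by [].
have -> : P A * P (X n @^-1` B) = m2 A.
  by rewrite /m2 /mscale muleC -[in LHS](fineK PB_fin).
apply: (g_sigma_algebra_measure_unique (cylinders n) _ (fun _ => setT)) => //.
- by move=> _ [C mC ->]; exact: measurable_cylinder.
- move=> _; exists (fun _ => setT) => //.
  by apply/seteqP; split.
- by rewrite bigcup_const.
- move=> _ _ [C mC ->] [D mD ->]; exists (fun i => C i `&` D i).
    by move=> i; exact: measurableI.
  apply/seteqP; split => [t [/cylinderP tC /cylinderP tD]|t /cylinderP tCD].
    by apply/cylinderP => i ii; split; [exact: tC|exact: tD].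
  by split; apply/cylinderP => i ii; have [] := tCD i ii.
- move=> _ [C mC ->].
  transitivity (P (cylinder n C) * P (X n @^-1` B)); last first.
    by rewrite /m2 /mscale muleC -[in LHS](fineK PB_fin).
  pose C' i := if i == n then B else C i.
  have mC' i : measurable (C' i) by rewrite /C'; case: ifPn.
  have CE : cylinder n C `&` X n @^-1` B = cylinder n.+1 C'.
    apply/seteqP; split => [t [/cylinderP tC tB]|t /cylinderP tC'].
      apply/cylinderP => i; rewrite ltnS /C'; case: eqVneq => [->//|ni] ii.
      by apply: tC; rewrite ltn_neqAle ni.
    split; last by have := tC' n (ltnSn n); rewrite /C' eqxx.
    apply/cylinderP => i ii.
    by have := tC' i (ltnW ii); rewrite /C' (ltn_eqF ii).
  transitivity (P (cylinder n.+1 C')); first by rewrite -CE.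
  rewrite !cylinder_prob// -[in seq.iota 0 n.+1]addn1 iotaD big_cat big_seq1 add0n.
  congr (_ * _).
    rewrite big_seq [in RHS]big_seq; apply: eq_bigr => i; rewrite mem_iota add0n => ii.
    by rewrite /C' (ltn_eqF ii).
  by rewrite /C' eqxx.
- move=> _; apply: (@le_lt_trans _ _ 1); last exact: ltry.
  by apply: probability_le1; rewrite setTI.
Qed.

(** The nominal walk is itself a path law, with a kernel that ignores the position, so the one-step
    calculus applies to both walks. *)
Lemma iid_path_law : path_law X (fun _ => f).
Proof.
move=> n A hA B mB.
rewrite integral_cst; last exact: history_measurable hA.
rewrite independent_next// muleC; congr (_ * _).
have [_ same] := X_iid; have [_ _ dens] := X_density.
transitivity (distribution P (X n) B) => //.
by rewrite same//; exact: dens.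
Qed.

Lemma integral_density_RV (h : R -> \bar R) :
  measurable_fun setT h -> (forall x, 0 <= h x) ->
  \int[P]_t h (X 0%N t) = \int[lebesgue_measure]_x ((f x)%:E * h x).
Proof.
move=> mh h0; have [mf f0 dens] := X_density.
pose R' := measurableTypeR R.
pose X' : {mfun T >-> R'} := HB.pack (X 0%N : T -> R')
  (isMeasurableFun.Build _ _ _ _ (X 0%N : T -> R') (measurable_funP (X 0%N))).
transitivity (\int[distribution P X']_x h x).
  by rewrite ge0_integral_pushforward// preimage_setT.
exact: ge0_integral_density.
Qed.

End iid_path_law.

(** * The tail and the expected excess of an integrable variable *)

Section expected_excess.
Context {d : measure_display} {T : measurableType d} {R : realType}.
Variables (P : probability T R) (X : {RV P >-> R}).
Hypothesis X_integrable : P.-integrable setT (EFin \o X).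

Definition tail (x : R) : R := fine (ccdf X x).

Definition excess (w : R) : R := fine (\int[P]_t (Num.max (X t - w) 0)%:E).

Lemma measurable_indicator_gt (x : R) :
  measurable_fun setT (fun t => ((x < X t)%R%:R)%:E : \bar R).
Proof.
apply/measurable_EFinP; exact: (measurableT_comp (measurable_gt_indicator x)).
Qed.

Lemma tailE x : (tail x)%:E = ccdf X x.
Proof. by rewrite /tail fineK// fin_num_measure. Qed.

Lemma tail_integral x : (tail x)%:E = (\int[P]_t ((x < X t)%R%:R)%:E)%E.
Proof.
rewrite tailE /ccdf /distribution /pushforward.
rewrite -[in LHS](setIT (X @^-1` _)) -integral_indic//; last first.
  by rewrite -[X in measurable X]setTI; exact: measurable_funP.
apply: eq_integral => t _; rewrite indicE; congr ((nat_of_bool _)%:R%:E).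
by apply/idP/idP; rewrite inE/= in_itv/= andbT.
Qed.

Lemma tail_noninc x y : x <= y -> tail y <= tail x.
Proof. by move=> xy; rewrite -lee_fin !tailE; exact: ccdf_nonincreasing. Qed.

Lemma tail_le1 x : tail x <= 1.
Proof. by rewrite -lee_fin tailE; exact: probability_le1. Qed.

Lemma tail_ge0 x : 0 <= tail x.
Proof. by rewrite -lee_fin tailE. Qed.

Lemma measurable_norm_RV : measurable_fun setT (fun t => (`|X t|)%:E).
Proof. by apply/measurable_EFinP; exact: measurableT_comp. Qed.

Lemma measurable_excess w : measurable_fun setT (fun t => (Num.max (X t - w) 0)%:E).
Proof.
apply/measurable_EFinP; apply: measurable_maxr => //.
by apply: measurable_funB.
Qed.

Lemma excess_integrand_ge0 w t : (0 <= (Num.max (X t - w) 0)%:E)%E.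
Proof. by rewrite lee_fin le_max lexx orbT. Qed.

Lemma excessE w : (excess w)%:E = (\int[P]_t (Num.max (X t - w) 0)%:E)%E.
Proof.
rewrite /excess fineK// ge0_fin_numE; last first.
  by apply: integral_ge0 => t _; exact: excess_integrand_ge0.
have [_ Xfin] := integrableP _ _ _ X_integrable.
apply: (@le_lt_trans _ _ (\int[P]_t ((`|X t|)%:E + (`|w|)%:E))%E).
  apply: ge0_le_integral => //.
  - by move=> t _; exact: excess_integrand_ge0.
  - exact: measurable_excess.
  - by apply: emeasurable_funD => //; exact: measurable_norm_RV.
  - move=> t _; rewrite -EFinD lee_fin ge_max addr_ge0// andbT.
    by rewrite (le_trans (ler_norm _))// ler_normB.
rewrite ge0_integralD//; last exact: measurable_norm_RV.
rewrite lte_add_pinfty// integral_cst// [X in (_ * X)%E](@probability_setT _ _ _ P).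
by rewrite mule1 ltry.
Qed.

(** Integrates the pointwise bound (X - x)^+ <= (X - y)^+ + (y - x) 1{X > x}; the next lemma
    integrates the reverse bound with 1{X > y}. *)
Lemma excess_incr_le x y : x <= y -> excess x - excess y <= (y - x) * tail x.
Proof.
move=> xy; rewrite lerBlDl -lee_fin EFinD EFinM !excessE tail_integral.
rewrite -ge0_integralZl//; last 2 first.
- exact: measurable_indicator_gt.
- by rewrite lee_fin subr_ge0.
rewrite -ge0_integralD//; last 4 first.
- by move=> t _; exact: excess_integrand_ge0.
- exact: measurable_excess.
- by move=> t _; rewrite mule_ge0 ?lee_fin ?subr_ge0.
- by apply: emeasurable_funM => //; exact: measurable_indicator_gt.
apply: ge0_le_integral => //.
- by move=> t _; exact: excess_integrand_ge0.
- exact: measurable_excess.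
- apply: emeasurable_funD; first exact: measurable_excess.
  by apply: emeasurable_funM => //; exact: measurable_indicator_gt.
move=> t _; rewrite -EFinM -EFinD lee_fin.
have [Xx|Xx] := ltP x (X t); have [h1|h1] := leP (X t - x) 0;
  have [h2|h2] := leP (X t - y) 0; rewrite ?mulr1 ?mulr0; lra.
Qed.

Lemma excess_incr_ge x y : x <= y -> (y - x) * tail y <= excess x - excess y.
Proof.
move=> xy; rewrite lerBrDl -lee_fin EFinD EFinM !excessE tail_integral.
rewrite -ge0_integralZl//; last 2 first.
- exact: measurable_indicator_gt.
- by rewrite lee_fin subr_ge0.
rewrite -ge0_integralD//; last 4 first.
- by move=> t _; exact: excess_integrand_ge0.
- exact: measurable_excess.
- by move=> t _; rewrite mule_ge0 ?lee_fin ?subr_ge0.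
- by apply: emeasurable_funM => //; exact: measurable_indicator_gt.
apply: ge0_le_integral => //.
- move=> t _; apply: adde_ge0; first exact: excess_integrand_ge0.
  by rewrite mule_ge0 ?lee_fin ?subr_ge0.
- apply: emeasurable_funD; first exact: measurable_excess.
  by apply: emeasurable_funM => //; exact: measurable_indicator_gt.
- exact: measurable_excess.
move=> t _; rewrite -EFinM -EFinD lee_fin.
have [Xx|Xx] := ltP y (X t); have [h1|h1] := leP (X t - x) 0;
  have [h2|h2] := leP (X t - y) 0; rewrite ?mulr1 ?mulr0; lra.
Qed.

(** Dominated convergence along integer truncation levels, with |X| as the dominating function. *)
Lemma tail_integrable (e : R) : 0 < e -> exists2 A, 0 <= A &
  (\int[P]_t (`|X t| * (A < `|X t|)%R%:R)%:E <= e%:E)%E.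
Proof.
move=> e0.
have mX : measurable_fun setT (fun t => `|X t|) by apply: measurableT_comp.
pose f_ (n : nat) t := (`|X t| * (n%:R < `|X t|)%R%:R)%:E.
have f_cvg : (\int[P]_t f_ n t @[n --> \oo] --> \int[P]_t (cst 0 t))%E.
  apply: (@dominated_cvg _ _ _ P setT _ f_ _ (fun t => `|(X t)%:E|%E)) => //.
  - move=> n; apply/measurable_EFinP; apply: measurable_funM => //.
    exact: (measurableT_comp (measurable_gt_indicator n%:R)).
  - move=> t _; apply: cvg_near_cst.
    exists (Num.truncn `|X t|).+1 => // n /= hn.
    rewrite /f_ ltNge (_ : (_ <= n%:R) = true) ?mulr0//.
    by rewrite (le_trans (ltW (truncnS_gt _)))// ler_nat.
  - exact: integrable_abse.
  - move=> n t _; rewrite /f_ abse_EFin lee_fin ger0_norm ?mulr_ge0//.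
    by case: ltP => _; rewrite ?mulr1 ?mulr0.
rewrite integral_cst// mul0e in f_cvg.
have := f_cvg => /fine_cvgP[fin_near /cvgrPdist_le/(_ _ e0) near_e].
near \oo => n.
exists n%:R; first exact: ler0n.
have : (\int[P]_t f_ n t)%E \is a fin_num by near: n.
have : `|0 - fine (\int[P]_t f_ n t)| <= e by near: n.
move=> + /fineK <-; rewrite lee_fin sub0r normrN => /(le_trans (ler_norm _)).
by [].
Unshelve. all: by end_near. Qed.

Lemma excess_cvg0 : excess x @[x --> +oo] --> (0 : R).
Proof.
apply/cvgrPdist_le => e e0.
have [A A0 hA] := tail_integrable e0.
near=> w.
have Aw : A <= w by near: w; exact: (nbhs_pinfty_ge (num_real _)).
rewrite sub0r normrN ger0_norm -lee_fin excessE; last first.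
  by apply: integral_ge0 => t _; exact: excess_integrand_ge0.
apply: le_trans hA; apply: ge0_le_integral => //.
- by move=> t _; exact: excess_integrand_ge0.
- exact: measurable_excess.
- apply/measurable_EFinP; apply: measurable_funM; first exact: measurableT_comp.
  apply: (measurableT_comp (measurable_gt_indicator A)); exact: measurableT_comp.
move=> t _; rewrite lee_fin.
have [h1|h1] := leP (X t - w) 0; first by rewrite mulr_ge0.
have Xt : A < X t by lra.
rewrite ger0_norm; last lra.
rewrite Xt mulr1; lra.
Unshelve. all: by end_near. Qed.

End expected_excess.

Section passage_event.
Context {d : measure_display} {T : measurableType d} {R : realType}.
Variables (Q : probability T R) (Y : nat -> {RV Q >-> R}) (b : R).

Lemma measurable_passage :
  measurable [set t | (passage_time b (fun n => Y n : T -> R) t < +oo)%E].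
Proof.
rewrite (_ : [set t | _] = \bigcup_n [set t | b < walk (fun n => Y n : T -> R) n.+1 t]).
  apply: bigcupT_measurable => n.
  rewrite (_ : [set t | _] = walk (fun n => Y n : T -> R) n.+1 @^-1` `]b, +oo[%classic).
    by rewrite -[X in measurable X]setTI; exact: measurable_walk.
  by apply/seteqP; split => t /=; rewrite in_itv/= andbT.
apply/seteqP; split => t /=.
  have [[n [bn _]] _|nb] := passesP b (fun n => Y n : T -> R) t; first by exists n.
  by rewrite passage_time_never.
move=> [n _ bn].
have [[k pk]|nb] := passesP b (fun n => Y n : T -> R) t.
  by rewrite (passage_time_passes pk) ltry.
by move: bn; rewrite /= ltNge nb.
Qed.

Lemma passage_prob_series :
  Q [set t | (passage_time b (fun n => Y n : T -> R) t < +oo)%E] =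
  (\sum_(n <oo) \int[Q]_t (hit_weight b (fun n => Y n : T -> R) (fun _ _ => 1) n t)%:E)%E.
Proof.
rewrite -integral_nneseries//; last 2 first.
- by move=> n; apply/measurable_EFinP; exact: measurable_hit.
- by move=> n t _; rewrite lee_fin hit_weight_ge0.
rewrite -[in LHS](setIT [set t | _]) -integral_indic//; last exact: measurable_passage.
apply: eq_integral => t _; rewrite -passage_time_lty indicE.
by congr ((nat_of_bool _)%:R%:E); apply/idP/idP; rewrite inE.
Qed.

End passage_event.

Section crossing_probability.
Context {d : measure_display} {T : measurableType d} {R : realType}.
Variables (P : probability T R) (X : nat -> {RV P >-> R}) (f : R -> R).
Hypothesis X_iid : iid X.
Hypothesis X_density : has_density (X 0%N) f.
Hypothesis X_integrable : P.-integrable setT (EFin \o X 0%N).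
Hypothesis X_mean : ('E_P[X 0%N] < 0)%E.

Local Notation S := (walk (fun n => X n : T -> R)).
Local Notation alive b := (alive_weight b (fun n => X n : T -> R) (fun _ _ => 1)).
Local Notation hit b := (hit_weight b (fun n => X n : T -> R) (fun _ _ => 1)).

Definition abs_mean : R := fine (\int[P]_t (`|X 0%N t|)%:E).

Lemma abs_meanE : (abs_mean%:E = \int[P]_t (`|X 0%N t|)%:E)%E.
Proof.
rewrite /abs_mean fineK// ge0_fin_numE; first by case/integrableP: X_integrable.
by apply: integral_ge0 => t _; rewrite lee_fin.
Qed.

Lemma abs_mean_gt0 : 0 < abs_mean.
Proof.
rewrite -lte_fin abs_meanE lt_neqAle eq_sym integral_ge0 ?andbT => [|t _]; last first.
  by rewrite lee_fin.
apply/eqP => E0; have := X_mean; rewrite unlock.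
have mX : measurable_fun setT (EFin \o X 0%N) by exact/measurable_EFinP.
have /(ae_eq_integral_abs P measurableT mX) X0 : (\int[P]_t `|(EFin \o X 0%N) t| = 0)%E by [].
by rewrite (ae_eq_integral (cst 0%E))// integral0 ltxx.
Qed.

Lemma abs_mean_iid i : (\int[P]_t (`|X i t|)%:E = abs_mean%:E)%E.
Proof.
have [_ same] := X_iid; rewrite abs_meanE.
have mabs : measurable_fun setT (fun x : R => (`|x|)%:E).
  by apply/measurable_EFinP; exact: normr_measurable.
transitivity (\int[distribution P (X i)]_x (`|x|)%:E)%E.
  by rewrite ge0_integral_pushforward ?preimage_setT// => x _; rewrite lee_fin.
transitivity (\int[distribution P (X 0%N)]_x (`|x|)%:E)%E.
  by apply: eq_measure_integral => A mA _; exact: same.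
by rewrite ge0_integral_pushforward ?preimage_setT// => x _; rewrite lee_fin.
Qed.

(* Markov's inequality in place of the law of large numbers: with slope
   2 * E|X| the walk is above a decreasing line with probability at least 1/2. *)
Lemma walk_lower_tail n :
  (\int[P]_t ((S n t < - (n%:R * (2 * abs_mean)))%R%:R)%:E <= (2^-1 : R)%:E)%E.
Proof.
have a0 := abs_mean_gt0.
case: n => [|n].
  rewrite (eq_integral (cst 0%E)); first by rewrite integral0 lee_fin invr_ge0.
  by move=> t _; rewrite walk0 mul0r oppr0 ltxx.
pose c : R := n.+1%:R * (2 * abs_mean).
have c0 : 0 < c by rewrite mulr_gt0// mulr_gt0.
have mS := measurable_walk X n.+1.
have mI : measurable_fun setT (fun t => ((S n.+1 t < - c)%R%:R)%:E : \bar R).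
  rewrite (_ : (fun t => _) = (fun t => ((c < - S n.+1 t)%R%:R)%:E)); last first.
    by apply/funext => t; rewrite ltrNr.
  apply/measurable_EFinP/(measurableT_comp (measurable_gt_indicator c)).
  exact: measurableT_comp.
rewrite -/c -(@lee_pmul2l _ c%:E)// -ge0_integralZl//; last by rewrite lee_fin ltW.
apply: (@le_trans _ _ (\int[P]_t (\sum_(i < n.+1) (`|X i t|)%:E))%E).
  apply: ge0_le_integral => //.
  - by move=> t _; rewrite mule_ge0 ?lee_fin// ltW.
  - exact: emeasurable_funM.
  - apply: emeasurable_sum => i; apply/measurable_EFinP; exact: measurableT_comp.
  move=> t _; rewrite -EFinM sumEFin lee_fin.
  apply: (@le_trans _ _ `|S n.+1 t|); last by rewrite /walk ler_norm_sum.
  have [Sc|_] := ltP (S n.+1 t) (- c); last by rewrite mulr0.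
  rewrite mulr1 ltr0_norm; lra.
rewrite ge0_integral_sum//; last first.
  by move=> i; apply/measurable_EFinP; exact: measurableT_comp.
under eq_bigr do rewrite abs_mean_iid.
rewrite sumEFin sumr_const card_ord -EFinM lee_fin /c -mulr_natl.
lra.
Qed.

Section level.
Variable b : R.

Lemma crossing_probE : (crossing_prob X b)%:E = (\sum_(n <oo) \int[P]_t (hit b n t)%:E)%E.
Proof.
rewrite /crossing_prob -passage_prob_series fineK//.
by apply: fin_num_measure; exact: measurable_passage.
Qed.

(** After [n] steps the walk is uncrossed and above the decreasing line with probability at least 1
    - 1/4 - 1/2 = 1/4; from there an increment larger than b plus the depth of the line crosses the
    level. *)
Lemma integral_hit_ge n : crossing_prob X b <= 4^-1 ->
  ((4^-1 * tail (X 0%N) (b + n%:R * (2 * abs_mean)))%:E <= \int[P]_t (hit b n t)%:E)%E.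
Proof.
move=> u4.
have [mf f0 _] := X_density.
have mf' : measurable_fun setT (fun z : R * R => f z.2).
  exact: (measurableT_comp mf measurable_snd).
have m1 : measurable_fun setT (fun z : R * R => 1 : R) by exact: measurable_cst.
rewrite (integral_hit b mf' (fun _ => f0) (iid_path_law X_iid X_density) m1)//.
set c := n%:R * _.
have mS := measurable_walk X n.
have malive : measurable_fun setT (fun t => (alive b n t)%:E).
  by apply/measurable_EFinP; exact: measurable_alive.
have mIc : measurable_fun setT (fun t => ((- c <= S n t)%R%:R)%:E : \bar R).
  rewrite (_ : (fun t => _) = (fun t => ((- S n t <= c)%R%:R)%:E)); last first.
    by apply/funext => t; rewrite lerNl.
  apply/measurable_EFinP/(measurableT_comp (measurable_le_indicator c)).
  exact: measurableT_comp.
have alive0 t : (0 <= (alive b n t)%:E)%E by rewrite lee_fin alive_weight_ge0.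
have inner s : (\int[lebesgue_measure]_x ((f x)%:E * (1 * (b < s + x)%R%:R)%:E) =
    (tail (X 0%N) (b - s))%:E)%E.
  have mh : measurable_fun setT (fun x : R => (1 * (b < s + x)%R%:R)%:E : \bar R).
    apply/measurable_EFinP; apply: measurable_funM => //.
    apply: (measurableT_comp (measurable_gt_indicator b)).
    exact: measurable_funD.
  rewrite -(integral_density_RV X_density mh) ?tail_integral.
    by apply: eq_integral => t _; rewrite mul1r ltrBlDl.
  by move=> x; rewrite lee_fin mul1r.
under eq_integral do rewrite inner.
(* Pointwise, three indicators cover everything: uncrossed and above the line at time [n], crossing
   at some time, below the line at time [n]. *)
have key : (1 <= \int[P]_t ((alive b n t)%:E * ((- c <= S n t)%R%:R)%:E) +
    (crossing_prob X b)%:E + (2^-1)%:E)%E.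
  pose J t : R := (passage_time b (fun n => X n : T -> R) t < +oo)%E%:R.
  have mJ : measurable_fun setT (fun t => (J t)%:E).
    rewrite (_ : (fun t => _) =
      EFin \o \1_[set t | (passage_time b (fun n => X n : T -> R) t < +oo)%E]).
      by apply/measurable_EFinP/measurable_indic; exact: measurable_passage.
    apply/funext => t /=; rewrite indicE; congr ((nat_of_bool _)%:R%:E).
    by apply/idP/idP; rewrite inE.
  have uJ : (crossing_prob X b)%:E = (\int[P]_t (J t)%:E)%E.
    rewrite /crossing_prob fineK; last first.
      by apply: fin_num_measure; exact: measurable_passage.
    rewrite -[in LHS](setIT [set t | _]) -integral_indic//; last exact: measurable_passage.
    apply: eq_integral => t _; rewrite indicE.
    by congr ((nat_of_bool _)%:R%:E); apply/idP/idP; rewrite inE.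
  have mI : measurable_fun setT (fun t => ((S n t < - c)%R%:R)%:E : \bar R).
    rewrite (_ : (fun t => _) = (fun t => ((c < - S n t)%R%:R)%:E)); last first.
      by apply/funext => t; rewrite ltrNr.
    apply/measurable_EFinP/(measurableT_comp (measurable_gt_indicator c)).
    exact: measurableT_comp.
  apply: (@le_trans _ _ (\int[P]_t ((alive b n t)%:E * ((- c <= S n t)%R%:R)%:E) +
      (crossing_prob X b)%:E + \int[P]_t ((S n t < - c)%R%:R)%:E)%E); last first.
    by apply: leeD2l; exact: (walk_lower_tail n).
  have maI : measurable_fun setT (fun t => ((alive b n t)%:E * ((- c <= S n t)%R%:R)%:E)%E).
    exact: emeasurable_funM.
  have aI0 t : (0 <= (alive b n t)%:E * ((- c <= S n t)%R%:R)%:E)%E.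
    by apply: mule_ge0 => //; rewrite lee_fin.
  have e1 : (\int[P]_t ((alive b n t)%:E * ((- c <= S n t)%R%:R)%:E + (J t)%:E) =
      \int[P]_t ((alive b n t)%:E * ((- c <= S n t)%R%:R)%:E) + \int[P]_t (J t)%:E)%E.
    by rewrite ge0_integralD// => t _; rewrite lee_fin.
  rewrite uJ -e1 -ge0_integralD//; last 2 first.
  - by move=> t _; apply: adde_ge0 => //; rewrite lee_fin.
  - exact: emeasurable_funD.
  rewrite -[leLHS](@probability_setT _ _ _ P) -[leLHS]mul1e -integral_cst//.
  apply: ge0_le_integral => //.
    by apply: emeasurable_funD => //; exact: emeasurable_funD.
  move=> t _; rewrite -EFinM -!EFinD lee_fin.
  have al0 : 0 <= alive b n t by rewrite -lee_fin.
  have J0 : 0 <= J t by rewrite /J.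
  have [Sc|cS] := ltP (S n t) (- c).
    by rewrite mulr0 add0r lerDr.
  rewrite mulr1 addr0.
  have [[k pk]|nb] := passesP b (fun n => X n : T -> R) t.
    by rewrite /J (passage_time_passes pk) ltry lerDr.
  rewrite /J (passage_time_never nb) ltxx addr0 /alive_weight big1// => i _.
  by rewrite nb mulr1.
have I4 : ((4^-1)%:E <= \int[P]_t ((alive b n t)%:E * ((- c <= S n t)%R%:R)%:E))%E.
  rewrite -(@leeD2rE _ (4^-1 + 2^-1)%:E)// -EFinD.
  have -> : 4^-1 + (4^-1 + 2^-1) = 1 :> R by lra.
  by rewrite (le_trans key)// EFinD addeA leeD2r// leeD2l// lee_fin.
have t0 := tail_ge0 (X 0%N) (b + c).
apply: (@le_trans _ _ ((tail (X 0%N) (b + c))%:E *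
    \int[P]_t ((alive b n t)%:E * ((- c <= S n t)%R%:R)%:E))%E).
  by rewrite EFinM muleC lee_wpmul2l// lee_fin.
have mtail : measurable_fun setT (fun t => (tail (X 0%N) (b - S n t))%:E).
  have mt : measurable_fun setT (fun s : R => tail (X 0%N) s).
    rewrite /tail; apply: measurableT_comp => //; exact: ccdf_measurable.
  apply/measurable_EFinP/(measurableT_comp mt).
  exact: measurable_funB.
rewrite -ge0_integralZl//; last 2 first.
- exact: emeasurable_funM.
- by move=> t _; apply: mule_ge0 => //; rewrite lee_fin.
apply: ge0_le_integral => //.
- move=> t _; apply: mule_ge0; first by rewrite lee_fin.
  by apply: mule_ge0 => //; rewrite lee_fin.
- by apply: emeasurable_funM => //; exact: emeasurable_funM.
- exact: emeasurable_funM.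
move=> t _; rewrite muleCA; apply: lee_wpmul2l => //.
rewrite -EFinM lee_fin.
have [cS|_] := leP (- c) (S n t); last by rewrite mulr0 tail_ge0.
by rewrite mulr1; apply: tail_noninc; lra.
Qed.

End level.

(* When the crossing probability is at most 1/4, summing integral_hit_ge over n
   gives a Riemann sum of the tail; otherwise the bound is trivial. *)
Lemma crossing_prob_ge_excess : exists2 k, 0 < k & forall b, 0 <= b ->
  k * excess (X 0%N) b <= crossing_prob X b.
Proof.
have a0 := abs_mean_gt0.
pose A := 2 * abs_mean; have A0 : 0 < A by rewrite mulr_gt0.
pose H0 := excess (X 0%N) 0.
have H00 : 0 <= H0.
  by rewrite -lee_fin excessE//; apply: integral_ge0 => t _; exact: excess_integrand_ge0.
(* One constant for both cases: [H0] in the denominator gives k * H b <= 1/4 when the crossing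
   probability exceeds 1/4, and [A], the mesh of the Riemann sum, serves the other case. *)
pose k := (4 * (A + H0))^-1.
have AH0 : 0 < A + H0 by rewrite ltr_wpDr.
have k0 : 0 < k by rewrite invr_gt0 mulr_gt0.
exists k => // b b0.
have Hnoninc x y : x <= y -> excess (X 0%N) y <= excess (X 0%N) x.
  move=> xy; rewrite -subr_ge0 (le_trans _ (excess_incr_ge X_integrable xy))//.
  by rewrite mulr_ge0 ?subr_ge0// tail_ge0.
have Hb0 : 0 <= excess (X 0%N) b.
  by rewrite -lee_fin excessE//; apply: integral_ge0 => t _; exact: excess_integrand_ge0.
have [u4|u4] := leP (crossing_prob X b) 4^-1; last first.
  apply: le_trans (ltW u4); rewrite /k invfM -mulrA ler_piMr//.
  rewrite ler_pdivrMl// mulr1 (le_trans (Hnoninc 0 b b0))// -/H0.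
  by rewrite lerDr ltW.
suff h : excess (X 0%N) b <= 4 * A * crossing_prob X b.
  rewrite /k ler_pdivrMl ?mulr_gt0// (le_trans h)//.
  have u0 : 0 <= crossing_prob X b by rewrite fine_ge0.
  by have := mulr_ge0 H00 u0; lra.
apply/ler_addgt0Pr => e e0.
(* Cutting the Riemann sum at this [n] costs at most the arbitrary [e]. *)
have [n hn] : exists n : nat, excess (X 0%N) (b + n%:R * A) <= e.
  have := excess_cvg0 X_integrable => /cvgr_le/(_ e e0)[M [Mr hM]].
  exists (Num.truncn (`|M| / A)).+1; apply: hM.
  have := truncnS_gt (`|M| / A); rewrite ltr_pdivrMr// => h1.
  by rewrite (le_lt_trans (ler_norm M))// (lt_le_trans h1)// lerDr.
have step m : excess (X 0%N) b - excess (X 0%N) (b + m%:R * A) <=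
    A * \sum_(i < m) tail (X 0%N) (b + i%:R * A).
  elim: m => [|m ih]; first by rewrite mul0r addr0 subrr big_ord0 mulr0.
  rewrite big_ord_recr/= mulrDr.
  have bA : b + m%:R * A <= b + m.+1%:R * A.
    by rewrite lerD2l ler_pM2r// ler_nat.
  have := excess_incr_le X_integrable bA.
  have -> : b + m.+1%:R * A - (b + m%:R * A) = A by rewrite -natr1; ring.
  lra.
have sum_le : \sum_(i < n) 4^-1 * tail (X 0%N) (b + i%:R * A) <= crossing_prob X b.
  rewrite -lee_fin crossing_probE// -sumEFin.
  apply: (@le_trans _ _ (\sum_(i < n) \int[P]_t (hit b i t)%:E)%E).
    by apply: lee_sum => i _; exact: integral_hit_ge.
  rewrite [leRHS](nneseries_split 0 n) => [|i _]; last first.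
    by apply: integral_ge0 => t _; rewrite lee_fin hit_weight_ge0.
  rewrite add0n big_mkord leeDl//; apply: nneseries_ge0 => i _ _.
  by apply: integral_ge0 => t _; rewrite lee_fin hit_weight_ge0.
have := step n; move: sum_le; rewrite -mulr_sumr => s1 s2.
have : A * \sum_(i < n) tail (X 0%N) (b + i%:R * A) <= A * (4 * crossing_prob X b).
  by rewrite ler_pM2l//; lra.
lra.
Qed.

End crossing_probability.

(** * Sample means of heavy-tailed variables *)

Section product_of_independent.
Local Open Scope ereal_scope.
Context {d : measure_display} {T : measurableType d} {R : realType}.
Variable Q : probability T R.

(** The joint law agrees with the product of the marginals on rectangles, hence everywhere, and
    Tonelli separates the two factors. *)
Lemma integralM_independent (X Y : T -> R) (h : R -> R) :
  measurable_fun setT X -> measurable_fun setT Y ->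
  measurable_fun setT h -> (forall x, (0 <= h x)%R) ->
  (forall A B, measurable A -> measurable B ->
    Q (X @^-1` A `&` Y @^-1` B) = Q (X @^-1` A) * Q (Y @^-1` B)) ->
  \int[Q]_t (h (X t) * h (Y t))%:E =
  \int[Q]_t (h (X t))%:E * \int[Q]_t (h (Y t))%:E.
Proof.
move=> mX mY mh h0 ind.
pose X' : {mfun T >-> R} := HB.pack X (isMeasurableFun.Build _ _ _ _ X mX).
pose Y' : {mfun T >-> R} := HB.pack Y (isMeasurableFun.Build _ _ _ _ Y mY).
have mXY : measurable_fun setT (fun t => (X t, Y t)) by exact: measurable_fun_pair.
pose XY : {mfun T >-> (R * R)%type} :=
  HB.pack (fun t => (X t, Y t)) (isMeasurableFun.Build _ _ _ _ _ mXY).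
pose dX := distribution Q X'; pose dY := distribution Q Y'.
have mh' : measurable_fun setT (fun x => (h x)%:E) by exact/measurable_EFinP.
have h0' x : 0 <= (h x)%:E by rewrite lee_fin.
pose F (z : R * R) := (h z.1 * h z.2)%:E.
have mF : measurable_fun setT F.
  apply/measurable_EFinP; apply: measurable_funM.
    exact: (measurableT_comp mh measurable_fst).
  exact: (measurableT_comp mh measurable_snd).
have F0 z : 0 <= F z by rewrite lee_fin mulr_ge0.
have intX : \int[Q]_t (h (X t))%:E = \int[dX]_x (h x)%:E.
  by rewrite /dX ge0_integral_pushforward ?preimage_setT.
have intY : \int[Q]_t (h (Y t))%:E = \int[dY]_x (h x)%:E.
  by rewrite /dY ge0_integral_pushforward ?preimage_setT.
transitivity (\int[distribution Q XY]_z F z).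
  by rewrite ge0_integral_pushforward ?preimage_setT.
transitivity (\int[dX \x dY]_z F z).
  apply: eq_measure_integral => C mC _.
  by apply/esym; apply: (product_measure_unique (m' := distribution Q XY)).
rewrite (fubini_tonelli1 _ mF F0) intX intY.
have inner x : fubini_F dY F x = (h x)%:E * \int[dY]_y (h y)%:E.
  by rewrite /fubini_F -ge0_integralZl.
under eq_integral do rewrite inner.
rewrite ge0_integralZr//.
by apply: integral_ge0.
Qed.

Lemma mutually_independent_pair (I : choiceType) (Z : I -> T -> R) i j :
  mutually_independent Q Z -> i != j ->
  forall A B : set R, measurable A -> measurable B ->
    Q (Z i @^-1` A `&` Z j @^-1` B) = Q (Z i @^-1` A) * Q (Z j @^-1` B).
Proof.
move=> ind ij A B mA mB.
pose C k := if k == i then A else B.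
have mC k : measurable (C k) by rewrite /C; case: ifPn.
have uij : uniq [:: i; j] by rewrite /= inE ij.
have := ind [:: i; j] C uij mC.
rewrite big_cons big_seq1 /C eqxx eq_sym (negbTE ij) => <-; congr (Q _).
apply/seteqP; split => [t [tA tB] k /=|t tAB].
  rewrite !inE => /orP[/eqP ->|/eqP ->]; first by rewrite eqxx.
  by rewrite eq_sym (negbTE ij).
split.
  by have := tAB i; rewrite /= !inE eqxx; apply.
by have := tAB j; rewrite /= !inE eqxx orbT eq_sym (negbTE ij); apply.
Qed.

End product_of_independent.

Section heavy_tailed_mean.
Context {d : measure_display} {T : measurableType d} {R : realType}.
Variables (Q : probability T R) (n : nat) (Z : 'I_n -> T -> R).
Hypothesis mZ : forall i, measurable_fun setT (Z i).
Hypothesis Z0 : forall i t, 0 <= Z i t.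
Hypothesis indZ : mutually_independent Q Z.
Hypothesis n0 : (0 < n)%N.

Section truncation.
Variable L : R.
Hypothesis L0 : 0 < L.

(** The absolute value makes [phi] nonnegative on all of [R], as the product formula for independent
    variables asks; on the nonnegative [Z i] it is plain truncation at [L]. *)
Let phi (z : R) : R := `|z| * (z <= L)%R%:R.

Let phi_ge0 z : 0 <= phi z.
Proof. by rewrite mulr_ge0. Qed.

Let mphi : measurable_fun setT phi.
Proof. by apply: measurable_funM => //; exact: measurable_le_indicator. Qed.

Let mphiZ i : measurable_fun setT (fun t => (phi (Z i t))%:E).
Proof. apply/measurable_EFinP; exact: measurableT_comp. Qed.

Let phiZ0 i t : 0 <= phi (Z i t).
Proof. by rewrite mulr_ge0. Qed.

Let phiZ_le i t : phi (Z i t) <= L.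
Proof.
by rewrite /phi ger0_norm//; have [h|_] := leP (Z i t) L; rewrite ?mulr1 ?mulr0// ltW.
Qed.

Let c i : R := fine (\int[Q]_t (phi (Z i t))%:E).

Let cE i : ((c i)%:E = \int[Q]_t (phi (Z i t))%:E)%E.
Proof.
rewrite /c fineK// ge0_fin_numE; last first.
  by apply: integral_ge0 => t _; rewrite lee_fin.
apply: (@le_lt_trans _ _ (\int[Q]_t (cst L%:E t))%E).
  by apply: ge0_le_integral => // [t _|t _]; rewrite lee_fin.
by rewrite integral_cst// [X in (_ * X)%E](@probability_setT _ _ _ Q) mule1 ltry.
Qed.

Let c0 i : 0 <= c i.
Proof. by rewrite -lee_fin cE; apply: integral_ge0 => t _; rewrite lee_fin. Qed.

Let W t := \sum_(i < n) phi (Z i t).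
Let C := \sum_(i < n) c i.

(** The square is expanded; off-diagonal terms factor by pairwise independence, and the diagonal
    terms c i * c i of C ^ 2 are bounded below by 0. *)
Lemma truncated_variance : (\int[Q]_t ((W t - C) ^+ 2)%:E <=
  \sum_(i < n) \int[Q]_t (phi (Z i t) ^+ 2)%:E)%E.
Proof.
have mW : measurable_fun setT W by apply: measurable_sum => i; exact: measurableT_comp.
have W0 t : 0 <= W t by rewrite sumr_ge0.
have C0 : 0 <= C by rewrite sumr_ge0.
have intW : (\int[Q]_t (W t)%:E = C%:E)%E.
  under eq_integral do rewrite /W -sumEFin.
  rewrite ge0_integral_sum//; last by move=> i t _; rewrite lee_fin.
  by under eq_bigr do rewrite -cE; rewrite sumEFin.
have intW2 : (\int[Q]_t (W t ^+ 2)%:E <=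
    \sum_(i < n) \int[Q]_t (phi (Z i t) ^+ 2)%:E + (C ^+ 2)%:E)%E.
  have W2E t : (W t ^+ 2)%:E =
      (\sum_(i < n) \sum_(j < n) (phi (Z i t) * phi (Z j t))%:E)%E.
    rewrite expr2 /W mulr_suml -sumEFin; apply: eq_bigr => i _.
    by rewrite mulr_sumr -sumEFin.
  have mpp i j : measurable_fun setT (fun t => (phi (Z i t) * phi (Z j t))%:E).
    by apply/measurable_EFinP; apply: measurable_funM; exact: measurableT_comp.
  under eq_integral do rewrite W2E.
  rewrite ge0_integral_sum//; last 2 first.
  - by move=> i; exact: emeasurable_sum.
  - by move=> i t _; apply: sume_ge0 => j _; rewrite lee_fin mulr_ge0.
  have -> : (C ^+ 2)%:E = (\sum_(i < n) \sum_(j < n) (c i * c j)%:E)%E.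
    rewrite expr2 /C mulr_suml -sumEFin; apply: eq_bigr => i _.
    by rewrite mulr_sumr -sumEFin.
  rewrite -big_split/=; apply: lee_sum => i _.
  rewrite ge0_integral_sum//; last by move=> j t _; rewrite lee_fin mulr_ge0.
  rewrite [leLHS](bigD1 i)//=; apply: leeD.
    by under eq_integral do rewrite -expr2.
  rewrite [leRHS](bigD1 i)//=.
  rewrite [leLHS](_ : _ = \sum_(j < n | j != i) (c i * c j)%:E)%E.
    by rewrite leeDr// lee_fin mulr_ge0.
  apply: eq_bigr => j ji; rewrite EFinM !cE.
  apply: integralM_independent => //.
  by apply: mutually_independent_pair => //; rewrite eq_sym.
(* The identity (W - C)^2 + 2 C W = W^2 + C^2 keeps every integrand nonnegative, so no difference of
   extended reals appears. *)
have intWC : (\int[Q]_t ((W t - C) ^+ 2)%:E + (2 * C * C)%:E =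
    \int[Q]_t (W t ^+ 2)%:E + (C ^+ 2)%:E)%E.
  have mD : measurable_fun setT (fun t => ((W t - C) ^+ 2)%:E).
    apply/measurable_EFinP; apply: measurable_funX.
    exact: measurable_funB.
  have mW2 : measurable_fun setT (fun t => (W t ^+ 2)%:E).
    by apply/measurable_EFinP; exact: measurable_funX.
  have mCW : measurable_fun setT (fun t => (2 * C * W t)%:E).
    by apply/measurable_EFinP; exact: measurable_funM.
  have -> : ((2 * C * C)%:E = \int[Q]_t (2 * C * W t)%:E)%E.
    under eq_integral do rewrite EFinM.
    have mWe : measurable_fun setT (fun t => (W t)%:E) by exact/measurable_EFinP.
    have C20 : (0 <= (2 * C)%:E)%E by rewrite lee_fin mulr_ge0.
    have W0e t : setT t -> (0 <= (W t)%:E)%E by rewrite lee_fin.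
    by rewrite (ge0_integralZl Q measurableT mWe W0e C20) intW EFinM.
  have -> : ((C ^+ 2)%:E = \int[Q]_t (cst (C ^+ 2)%:E t))%E.
    by rewrite integral_cst// [X in (_ * X)%E](@probability_setT _ _ _ Q) mule1.
  rewrite -ge0_integralD//; last 2 first.
  - by move=> t _; rewrite lee_fin sqr_ge0.
  - by move=> t _; rewrite lee_fin !mulr_ge0.
  rewrite -ge0_integralD//; last 2 first.
  - by move=> t _; rewrite lee_fin sqr_ge0.
  - by move=> t _; rewrite lee_fin sqr_ge0.
  by apply: eq_integral => t _; rewrite -!EFinD; congr (_%:E); ring.
rewrite -(@leeD2rE _ (2 * C * C)%:E)// intWC.
apply: (le_trans (leeD2r _ intW2)); rewrite -addeA leeD2l// -EFinD lee_fin.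
by rewrite le_eqVlt; apply/orP; left; apply/eqP; ring.
Qed.

Variables (g u B : R).
Hypothesis g01 : 0 < g < 1.
Hypothesis mean_Z : forall i, (\int[Q]_t (Z i t)%:E = u%:E)%E.
Hypothesis moment_Z : forall i, (\int[Q]_t (Z i t `^ (1 + g))%:E <= B%:E)%E.

Let mZpow i : measurable_fun setT (fun t => (Z i t `^ (1 + g))%:E).
Proof. by apply/measurable_EFinP; exact: (measurableT_comp (measurable_powR _)). Qed.

Let powRS (z : R) : 0 < z -> z `^ (1 + g) = z * z `^ g.
Proof.
by move=> z0; rewrite powRD ?(gt_eqF z0) ?implybT// powRr1// ltW.
Qed.

(** Truncation bias: above [L] one has Z <= L ^ (- g) * Z ^ (1 + g). *)
Let truncated_mean_ge i : u <= c i + B / L `^ g.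
Proof.
have /andP[g0 _] := g01.
have Lg0 : 0 < L `^ g by rewrite powR_gt0.
rewrite -lee_fin EFinD -(mean_Z i) cE.
apply: (@le_trans _ _ (\int[Q]_t (phi (Z i t))%:E +
    (L `^ g)^-1%:E * \int[Q]_t (Z i t `^ (1 + g))%:E)%E); last first.
  rewrite leeD2l// mulrC EFinM; apply: lee_wpmul2l => //.
  by rewrite lee_fin invr_ge0 ltW.
rewrite -ge0_integralZl//; last 2 first.
- by move=> t _; rewrite lee_fin powR_ge0.
- by rewrite lee_fin invr_ge0 ltW.
rewrite -ge0_integralD//; last 3 first.
- by move=> t _; rewrite lee_fin.
- by move=> t _; rewrite -EFinM lee_fin mulr_ge0 ?invr_ge0 ?powR_ge0.
- exact: emeasurable_funM.
apply: ge0_le_integral => //.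
- by move=> t _; rewrite lee_fin.
- by apply/measurable_EFinP.
- by apply: emeasurable_funD => //; exact: emeasurable_funM.
move=> t _; rewrite -EFinM -EFinD lee_fin /phi ger0_norm//.
have [ZL|LZ] := leP (Z i t) L.
  by rewrite mulr1 lerDl mulr_ge0 ?invr_ge0 ?powR_ge0.
have Zi0 : 0 < Z i t by exact: lt_trans LZ.
rewrite mulr0 add0r powRS// mulrCA ler_peMr// ler_pdivlMl// mulr1.
by rewrite ge0_ler_powR// ?nnegrE ?ltW.
Qed.

Let truncated_mean_le i : c i <= u.
Proof.
rewrite -lee_fin -(mean_Z i) cE; apply: ge0_le_integral => //.
- by move=> t _; rewrite lee_fin.
- exact/measurable_EFinP.
move=> t _; rewrite lee_fin /phi ger0_norm//.
by have [_|_] := leP (Z i t) L; rewrite ?mulr1 ?mulr0.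
Qed.

(** Below [L] one has Z^2 = Z ^ (1 - g) * Z ^ (1 + g) <= L ^ (1 - g) * Z ^ (1 + g), which uses g <
    1. *)
Let truncated_second_moment i :
  (\int[Q]_t (phi (Z i t) ^+ 2)%:E <= (L `^ (1 - g) * B)%:E)%E.
Proof.
have /andP[g0 g1] := g01.
apply: (@le_trans _ _ ((L `^ (1 - g))%:E * \int[Q]_t (Z i t `^ (1 + g))%:E)%E); last first.
  by rewrite EFinM lee_wpmul2l// lee_fin powR_ge0.
rewrite -ge0_integralZl//; last 2 first.
- by move=> t _; rewrite lee_fin powR_ge0.
- by rewrite lee_fin powR_ge0.
apply: ge0_le_integral => //.
- by move=> t _; rewrite lee_fin sqr_ge0.
- by apply/measurable_EFinP; apply: measurable_funX; exact: measurableT_comp.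
- exact: emeasurable_funM.
move=> t _; rewrite -EFinM lee_fin /phi ger0_norm//.
have [ZL|LZ] := leP (Z i t) L; last first.
  by rewrite mulr0 expr0n mulr_ge0 ?powR_ge0.
rewrite mulr1; have [->|Zn0] := eqVneq (Z i t) 0.
  by rewrite expr0n mulr_ge0 ?powR_ge0.
have Zi0 : 0 < Z i t by rewrite lt_neqAle eq_sym Zn0 Z0.
have -> : Z i t ^+ 2 = Z i t `^ (1 - g) * Z i t `^ (1 + g).
  rewrite -powRD ?(gt_eqF Zi0) ?implybT//.
  have -> : 1 - g + (1 + g) = 2%:R by ring.
  by rewrite powR_mulrn.
rewrite ler_wpM2r ?powR_ge0//.
by rewrite ge0_ler_powR// ?nnegrE ?(ltW L0)// subr_ge0 ltW.
Qed.

Let large_prob i :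
  (\int[Q]_t ((L < Z i t)%R%:R)%:E <= (B / L `^ (1 + g))%:E)%E.
Proof.
have /andP[g0 g1] := g01.
have Lp0 : 0 < L `^ (1 + g) by rewrite powR_gt0.
apply: (@le_trans _ _ ((L `^ (1 + g))^-1%:E * \int[Q]_t (Z i t `^ (1 + g))%:E)%E); last first.
  rewrite mulrC EFinM lee_wpmul2l// lee_fin invr_ge0 ltW//.
rewrite -ge0_integralZl//; last 2 first.
- by move=> t _; rewrite lee_fin powR_ge0.
- by rewrite lee_fin invr_ge0 ltW.
apply: ge0_le_integral => //.
- by apply/measurable_EFinP; exact: (measurableT_comp (measurable_gt_indicator L)).
- exact: emeasurable_funM.
move=> t _; rewrite -EFinM lee_fin.
have [LZ|_] := ltP L (Z i t); last by rewrite mulr_ge0 ?invr_ge0 ?powR_ge0.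
rewrite ler_pdivlMl// mulr1 ge0_ler_powR// ?nnegrE ?(ltW L0)//; lra.
Qed.

Let measurable_sumZ : measurable_fun setT (fun t => \sum_(i < n) Z i t).
Proof. exact: measurable_sum. Qed.

(** Let x = n * B / L ^ (1 + g). The union bound over the events Z i > L costs x. Otherwise the sum
    equals the truncated sum, whose mean is off by at most x * L <= L / 2, and Chebyshev's
    inequality at L / 2 costs 4 * x. Hence the factor 5. *)
Lemma sum_deviation_prob : n%:R * B / L `^ (1 + g) <= 2^-1 ->
  (\int[Q]_t ((L < `|\sum_(i < n) Z i t - n%:R * u|)%R%:R)%:E <=
    (5 * (n%:R * B / L `^ (1 + g)))%:E)%E.
Proof.
move=> small; have /andP[g0 g1] := g01.
have mW : measurable_fun setT W by apply: measurable_sum => i; exact: measurableT_comp.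
have Lp0 : 0 < L `^ (1 + g) by rewrite powR_gt0.
have mDev : measurable_fun setT (fun t => ((W t - C) ^+ 2)%:E).
  by apply/measurable_EFinP; apply: measurable_funX; exact: measurable_funB.
have mLarge i : measurable_fun setT (fun t => ((L < Z i t)%R%:R)%:E : \bar R).
  by apply/measurable_EFinP; exact: (measurableT_comp (measurable_gt_indicator L)).
have k0 : 0 <= 4 / L ^+ 2 by rewrite divr_ge0 ?sqr_ge0.
apply: (@le_trans _ _ (\int[Q]_t (\sum_(i < n) ((L < Z i t)%R%:R)%:E +
    (4 / L ^+ 2)%:E * ((W t - C) ^+ 2)%:E))%E).
  apply: ge0_le_integral => //.
  - apply/measurable_EFinP; apply: (measurableT_comp (measurable_gt_indicator L)).
    by apply: measurableT_comp => //; exact: measurable_funB.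
  - by apply: emeasurable_funD; [exact: emeasurable_sum|exact: emeasurable_funM].
  move=> t _; rewrite sumEFin -EFinM -EFinD lee_fin.
  have S0 : 0 <= \sum_(i < n) (L < Z i t)%R%:R :> R by rewrite sumr_ge0.
  have D0 : 0 <= 4 / L ^+ 2 * (W t - C) ^+ 2 by rewrite mulr_ge0 ?sqr_ge0.
  have [dev|_] := ltP L _; last by rewrite addr_ge0.
  have [[i Zi]|allZ] := pselect (exists i, L < Z i t).
    apply: (@le_trans _ _ (\sum_(i < n) (L < Z i t)%R%:R)); last by rewrite lerDl.
    by rewrite (bigD1 i)//= Zi lerDl sumr_ge0.
  have WE : \sum_(i < n) Z i t = W t.
    apply: eq_bigr => i _; rewrite /phi ger0_norm// leNgt.
    by case: ltP => [Zi|]; [case: allZ; exists i|rewrite mulr1].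
  have Cu : n%:R * u - L / 2 <= C <= n%:R * u.
    have -> : n%:R * u = \sum_(i < n) u by rewrite sumr_const card_ord mulr_natl.
    apply/andP; split; last by apply: ler_sum => i _; exact: truncated_mean_le.
    have h : \sum_(i < n) u <= \sum_(i < n) (c i + B / L `^ g).
      by apply: ler_sum => i _; exact: truncated_mean_ge.
    rewrite lerBlDr (le_trans h)// big_split/= lerD2l sumr_const card_ord.
    have Lg0 : 0 < L `^ g by rewrite powR_gt0.
    rewrite -[leLHS]mulr_natl mulrA ler_pdivrMr//.
    by move: small; rewrite powRS// ler_pdivrMr ?mulr_gt0//; lra.
  rewrite WE in dev.
  have half : L / 2 <= `|W t - C|.
    have := ler_normD (W t - C) (C - n%:R * u).
    have -> : W t - C + (C - n%:R * u) = W t - n%:R * u by ring.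
    have : `|C - n%:R * u| <= L / 2 by rewrite ler_norml; lra.
    lra.
  have : (L / 2) ^+ 2 <= (W t - C) ^+ 2.
    by rewrite -(real_normK (num_real (W t - C))) lerXn2r ?nnegrE// divr_ge0// ltW.
  have L2 : 0 < L ^+ 2 by rewrite exprn_gt0.
  move=> sq; apply: (@le_trans _ _ (4 / L ^+ 2 * (W t - C) ^+ 2)).
    by rewrite mulrAC ler_pdivlMr// mul1r; lra.
  by rewrite lerDr.
rewrite ge0_integralD//; last 4 first.
- by move=> t _; apply: sume_ge0 => i _; rewrite lee_fin.
- exact: emeasurable_sum.
- by move=> t _; rewrite -EFinM lee_fin mulr_ge0 ?sqr_ge0.
- exact: emeasurable_funM.
rewrite ge0_integral_sum// ge0_integralZl//; last by move=> t _; rewrite lee_fin sqr_ge0.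
have -> : 5 * (n%:R * B / L `^ (1 + g)) =
  \sum_(i < n) (B / L `^ (1 + g)) + 4 / L ^+ 2 * \sum_(i < n) (L `^ (1 - g) * B).
  rewrite !sumr_const card_ord -(mulr_natl (B / _)) -(mulr_natl (_ * B)).
  have L2 : 0 < L ^+ 2 by rewrite exprn_gt0.
  have -> : L `^ (1 - g) = L ^+ 2 / L `^ (1 + g).
    rewrite -(powR_mulrn 2 (ltW L0)) -powRB; last by rewrite (gt_eqF L0) implybT.
    by congr (_ `^ _); ring.
  by field; rewrite !gt_eqF.
rewrite EFinD -!sumEFin leeD//; first by apply: lee_sum => i _; exact: large_prob.
rewrite [leRHS]EFinM; apply: lee_wpmul2l; first by rewrite lee_fin.
rewrite (le_trans truncated_variance)// -sumEFin.
by apply: lee_sum => i _; exact: truncated_second_moment.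
Qed.

End truncation.

(** The truncation level is the tolerated error n * e * u of the sum. With a moment bound
    proportional to u ^ (1 + g) the mean [u] cancels, so the condition on [n] is uniform in it; 5 *
    x <= delta < 1 also gives x <= 1/2. *)
Lemma sample_mean_accuracy (g u K e delta : R) : 0 < g < 1 -> 0 < u -> 0 < e ->
  0 <= K -> delta < 1 ->
  (forall i, (\int[Q]_t (Z i t)%:E = u%:E)%E) ->
  (forall i, (\int[Q]_t (Z i t `^ (1 + g))%:E <= (K * u `^ (1 + g))%:E)%E) ->
  5 * K * (n%:R `^ (- g) * e `^ (- (1 + g))) <= delta ->
  ((1 - delta)%:E <= Q [set t | (`|(\sum_(i < n) Z i t) / n%:R - u| <= e * u)%R])%E.
Proof.
move=> g01 u0 e0 K0 d1 hu hm hd; have /andP[g0 g1] := g01.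
have n0R : 0 < n%:R :> R by rewrite ltr0n.
pose L := n%:R * e * u; have L0 : 0 < L by rewrite !mulr_gt0.
pose B := K * u `^ (1 + g).
have xE : n%:R * B / L `^ (1 + g) = K * (n%:R `^ (- g) * e `^ (- (1 + g))).
  have ne0 : 0 < n%:R * e by rewrite mulr_gt0.
  rewrite /L /B (powRM _ (ltW ne0) (ltW u0)) (powRM _ (ltW n0R) (ltW e0)).
  rewrite !powRN (_ : n%:R `^ (1 + g) = n%:R * n%:R `^ g); last first.
    by rewrite powRD ?(gt_eqF n0R) ?implybT// powRr1// ltW.
  by field; rewrite !gt_eqF ?powR_gt0.
have small : n%:R * B / L `^ (1 + g) <= 2^-1 by rewrite xE; lra.
have := sum_deviation_prob L0 g01 hu hm small; rewrite xE => dev.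
pose A := [set t | `|(\sum_(i < n) Z i t) / n%:R - u| <= e * u].
have mS : measurable_fun setT (fun t => \sum_(i < n) Z i t) by exact: measurable_sum.
have mA : measurable A.
  rewrite -[A]setTI; apply: (@measurable_fun_le _ _ _ setT
    (fun t => `|(\sum_(i < n) Z i t) / n%:R - u|) (fun _ => e * u)) => //.
  by apply: measurableT_comp => //; apply: measurable_funB => //; exact: measurable_funM.
have badE : (\int[Q]_t ((L < `|\sum_(i < n) Z i t - n%:R * u|)%R%:R)%:E = Q (~` A))%E.
  rewrite -(setIT (~` A)) -integral_indic//; last exact: measurableC.
  apply: eq_integral => t _; rewrite indicE; congr ((nat_of_bool _)%:R%:E).
  have -> : \sum_(i < n) Z i t - n%:R * u = n%:R * ((\sum_(i < n) Z i t) / n%:R - u).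
    by field; rewrite gt_eqF.
  rewrite normrM (ger0_norm (ltW n0R)) /L -mulrA ltr_pM2l//.
  apply/idP/idP; rewrite in_setC notin_setE /A/= => h; first by apply/negP; rewrite -ltNge.
  by rewrite ltNge; apply/negP.
rewrite -/A -[A]setCK probability_setC; last exact: measurableC.
rewrite EFinB leeB// -badE (le_trans dev)// lee_fin; lra.
Qed.

End heavy_tailed_mean.

(** * The mixture and its drift inequalities *)

Section affine_bound.
Context {d : measure_display} {T : measurableType d} {R : realType}.
Variables (P : probability T R) (X : {RV P >-> R}).
Hypothesis X_integrable : P.-integrable setT (EFin \o X).
Variables (m mabs : R).
Hypothesis meanX : (\int[P]_t (X t)%:E = (- m)%:E)%E.
Hypothesis absX : (\int[P]_t (`|X t|)%:E = mabs%:E)%E.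

(** Every drift estimate below uses a pointwise majorant of this shape, integrated by linearity.
    Only [a4] needs a sign, since the truncated absolute mean is known through the upper bound
    [e]. *)
Lemma integral_le_affine (h : T -> R) (a0 a1 a2 a3 a4 c A e : R) :
  measurable_fun setT h -> (forall t, 0 <= h t) -> 0 <= a4 ->
  (\int[P]_t (`|X t| * (A < `|X t|)%R%:R)%:E <= e%:E)%E ->
  (forall t, h t <= a0 + a1 * (X t <= c)%R%:R + a2 * X t + a3 * `|X t| +
    a4 * (`|X t| * (A < `|X t|)%R%:R)) ->
  (\int[P]_t (h t)%:E <=
    (a0 + a1 * (1 - tail X c) + a2 * (- m) + a3 * mabs + a4 * e)%:E)%E.
Proof.
move=> mh h0 a40 he hle.
have iabs : P.-integrable setT (fun t => (`|X t|)%:E).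
  exact: (integrable_abse X_integrable).
pose I1 t : R := (X t <= c)%R%:R.
pose J t : R := `|X t| * (A < `|X t|)%R%:R.
have mI1 : measurable_fun setT (fun t => (I1 t)%:E).
  by apply/measurable_EFinP; exact: (measurableT_comp (measurable_le_indicator c)).
have mJ : measurable_fun setT (fun t => (J t)%:E).
  apply/measurable_EFinP; apply: measurable_funM; first exact: measurableT_comp.
  by apply: (measurableT_comp (measurable_gt_indicator A)); exact: measurableT_comp.
have i0 : P.-integrable setT (fun _ => 1%:E : \bar R).
  by apply: finite_measure_integrable_cst.
have i1 : P.-integrable setT (fun t => (I1 t)%:E).
  apply: le_integrable i0 => // t _; rewrite lee_fin /I1 normr1.
  by case: (X t <= c); rewrite ?normr1 ?normr0.
have iJ : P.-integrable setT (fun t => (J t)%:E).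
  apply: le_integrable iabs => // t _; rewrite lee_fin /J normrM normr_id.
  by case: (A < `|X t|); rewrite ?normr1 ?normr0 ?mulr1 ?mulr0.
have intI1 : (\int[P]_t (I1 t)%:E = (1 - tail X c)%:E)%E.
  have e1 : (\int[P]_t (I1 t)%:E + (tail X c)%:E = 1%:E)%E.
    rewrite tail_integral -ge0_integralD//; last 2 first.
    - by move=> t _; rewrite lee_fin.
    - exact: measurable_indicator_gt.
    rewrite (eq_integral (cst 1%:E)).
      by rewrite integral_cst// [X in (_ * X)%E](@probability_setT _ _ _ P) mule1.
    move=> t _; rewrite -EFinD /I1; congr (_%:E).
    by have [_|_] := leP (X t) c; rewrite ?addr0 ?add0r.
  by rewrite EFinB -e1 addeK.
apply: (@le_trans _ _ (\int[P]_t ((a0%:E * 1%:E + a1%:E * (I1 t)%:E +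
    a2%:E * (X t)%:E + a3%:E * (`|X t|)%:E) + a4%:E * (J t)%:E))%E).
  apply: ge0_le_integral => //.
  - by move=> t _; rewrite lee_fin.
  - exact/measurable_EFinP.
  - do ! (apply: emeasurable_funD); apply: emeasurable_funM => //; apply/measurable_EFinP => //.
    exact: measurableT_comp.
  - by move=> t _; rewrite -!EFinM -!EFinD lee_fin mulr1; exact: hle.
have iX : P.-integrable setT (fun t => (X t)%:E) by exact: X_integrable.
have Z0 := integrableZl measurableT a0 i0.
have Z1 := integrableZl measurableT a1 i1.
have Z2 := integrableZl measurableT a2 iX.
have Z3 := integrableZl measurableT a3 iabs.
have Z4 := integrableZl measurableT a4 iJ.
have D1 := integrableD measurableT Z0 Z1.
have D2 := integrableD measurableT D1 Z2.
have D3 := integrableD measurableT D2 Z3.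
rewrite (integralD measurableT D3 Z4) (integralD measurableT D2 Z3).
rewrite (integralD measurableT D1 Z2) (integralD measurableT Z0 Z1).
rewrite !integralZl// intI1 meanX absX integral_cst//.
rewrite [X in (_ * (_ * X))%E](@probability_setT _ _ _ P) !mule1.
by rewrite !EFinD !EFinM leeD2l// lee_wpmul2l.
Qed.

End affine_bound.

(** * Position of the cutoff *)

Section cutoff_asymptotics.
Context {R : realType}.
Variables (N Lambda : R -> R) (iota : R).
Hypothesis hazardN : forall x, N x = expR (- Lambda x).
Hypothesis N_noninc : forall x y : R, x <= y -> N y <= N x.
Hypothesis iota_gt1 : 1 < iota.
Hypothesis N_rv : forall t : R, 0 < t -> t <= 1 ->
  N (x * t) / N x @[x --> +oo] --> t `^ (- iota).

Let N_gt0 x : 0 < N x.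
Proof. by rewrite hazardN expR_gt0. Qed.

Let iota0 : 0 < iota. Proof. exact: lt_trans ltr01 iota_gt1. Qed.

(* Chosen so that expR (jump_gap z) = z `^ (- 2 iota), which puts the cutoff
   near z ^+ 2 * w, strictly between z ^+ 3 * w and z * w. *)
Definition jump_gap (z : R) : R := - (2 * iota * ln z).

Lemma jump_gap_gt0 z : 0 < z < 1 -> 0 < jump_gap z.
Proof.
by move=> z01; rewrite oppr_gt0 pmulr_rlt0 ?ln_lt0// mulr_gt0.
Qed.

Lemma expR_jump_gap z : 0 < z -> expR (jump_gap z) = z `^ (- (2 * iota)).
Proof. by move=> z0; rewrite /powR gt_eqF// /jump_gap mulNr. Qed.

Lemma powRN_ltr (z p r : R) : 0 < z < 1 -> p < r -> z `^ (- p) < z `^ (- r).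
Proof.
move=> z01 pr; have /andP[z0 _] := z01.
rewrite /powR gt_eqF// ltr_expR !mulNr ltrN2 ltr_nM2r//.
exact: ln_lt0.
Qed.

Lemma powRN_gt1 (z : R) : 0 < z < 1 -> 1 < z `^ (- iota).
Proof.
move=> z01; rewrite -(powRr0 z) -[X in z `^ X < _]oppr0.
exact: powRN_ltr.
Qed.

Lemma hazard_ge z w x : 0 < z -> (Lambda w - jump_gap z <= Lambda x) =
  (N x <= z `^ (- (2 * iota)) * N w).
Proof.
move=> z0; rewrite -expR_jump_gap// !hazardN -expRD ler_expR.
by rewrite -lerN2 opprB addrC.
Qed.

(** The cutoff is where the tail equals about z ^ (- 2 iota) * N w. At z * w the tail is about z ^
    (- iota) * N w, already below; at z ^ 3 * w it is about z ^ (- 3 iota) * N w, still above. The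
    last item will give a positive [a_star]: w minus the cutoff is at most (1 - z ^ 3) * w, where
    the tail exceeds N w by a factor. *)
Lemma cutoff_asymptotics z : 0 < z < 1 ->
  \forall w \near +oo, let y := geninv Lambda (Lambda w - jump_gap z) in
  [/\ y \is a fin_num, z ^+ 3 * w <= fine y <= z * w &
      Lambda (w - fine y) < Lambda w].
Proof.
move=> z01; have /andP[z0 z1] := z01; have i0 := iota0.
have z30 : 0 < z ^+ 3 by rewrite exprn_gt0.
have z31 : z ^+ 3 < 1 by rewrite exprn_ilt1// ltW.
have zi : z `^ (- iota) < z `^ (- (2 * iota)) by apply: powRN_ltr => //; lra.
have z3E : (z ^+ 3) `^ (- iota) = z `^ (- (3 * iota)).
  by rewrite -(powR_mulrn 3 (ltW z0)) -powRrM mulrN.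
have zi3 : z `^ (- (2 * iota)) < z `^ (- (3 * iota)) by apply: powRN_ltr => //; lra.
(* Midpoints, here and in [k1], leave room on both sides of the limit given by regular variation. *)
pose k3 := (z `^ (- (2 * iota)) + z `^ (- (3 * iota))) / 2.
have k3l : z `^ (- (2 * iota)) < k3 by rewrite /k3; lra.
have k3r : k3 < (z ^+ 3) `^ (- iota) by rewrite z3E /k3; lra.
have t01 : 0 < 1 - z ^+ 3 < 1 by lra.
have /andP[t0 t1] := t01.
pose k1 := (1 + (1 - z ^+ 3) `^ (- iota)) / 2.
have k1l : 1 < k1 by have := powRN_gt1 t01; rewrite /k1; lra.
have k1r : k1 < (1 - z ^+ 3) `^ (- iota) by have := powRN_gt1 t01; rewrite /k1; lra.
near=> w; set y := geninv _ _.
have Nw := N_gt0 w.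
have zw : N (z * w) <= z `^ (- (2 * iota)) * N w.
  by near: w; exact: (tail_ratio_le N_gt0 N_rv z0 (ltW z1) zi).
have z3w : k3 * N w <= N (z ^+ 3 * w).
  by near: w; exact: (tail_ratio_ge N_gt0 N_rv z30 (ltW z31) k3r).
have tw : k1 * N w <= N ((1 - z ^+ 3) * w).
  by near: w; exact: (tail_ratio_ge N_gt0 N_rv t0 (ltW t1) k1r).
have y_le : (y <= (z * w)%:E)%E.
  apply: ereal_inf_lbound; exists (z * w) => //=.
  by rewrite hazard_ge.
have y_ge : ((z ^+ 3 * w)%:E <= y)%E.
  apply: le_ereal_inf_tmp => _ [x /= + <-].
  rewrite hazard_ge// => hx; rewrite lee_fin leNgt; apply/negP => /ltW /N_noninc h.
  have : z `^ (- (2 * iota)) * N w < k3 * N w by rewrite ltr_pM2r.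
  lra.
have y_fin : y \is a fin_num.
  by rewrite fin_numElt (lt_le_trans (ltNyr _) y_ge) (le_lt_trans y_le (ltry _)).
have cl : z ^+ 3 * w <= fine y by rewrite -lee_fin fineK.
have cr : fine y <= z * w by rewrite -lee_fin fineK.
split => //; first by rewrite cl cr.
suff : N w < N (w - fine y) by rewrite !hazardN ltr_expR ltrN2.
have h : N ((1 - z ^+ 3) * w) <= N (w - fine y) by apply: N_noninc; lra.
have : N w < k1 * N w by rewrite ltr_pMl.
lra.
Unshelve. all: by end_near. Qed.

End cutoff_asymptotics.

Section drift_arithmetic.
Context {R : realType}.

(** If q = alpha * f, then q * (f / q) ^ (1 + g) = f * alpha ^ (- g): moments of the likelihood
    ratio under the mixture become moments of one order less under the nominal law. *)
Lemma likelihood_cost (alpha y g : R) : 0 < alpha -> 0 <= y ->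
  alpha * y * (y / (alpha * y)) `^ (1 + g) <= y * (alpha^-1) `^ g.
Proof.
move=> a0; rewrite le_eqVlt => /predU1P[<-|y0].
  by rewrite mulr0 !mul0r.
have -> : y / (alpha * y) = alpha^-1 by field; rewrite !gt_eqF.
have ai0 : 0 < alpha^-1 by rewrite invr_gt0.
rewrite powRD; last by rewrite (gt_eqF ai0) implybT.
rewrite powRr1 ?invr_ge0 ?(ltW a0)//.
rewrite le_eqVlt; apply/orP; left; apply/eqP.
by field; rewrite gt_eqF.
Qed.

(* With theta = z (1 + g) m / g the loss from the likelihood ratios of the
   regular steps is at most (1 + z) / 2 times the gain from the negative mean. *)
Lemma moment_arithmetic (g z m r theta C H N Nc Dc : R) :
  0 < g < 1 -> 0 < z < 1 -> 0 < m -> 0 < H -> 0 < N -> r = N / H ->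
  theta = z * (1 + g) * m / g ->
  theta * r <= (1 - z) / (1 + z) -> (1 + g) * m * r <= 1 ->
  0 < Nc -> Nc <= Dc * N ->
  Dc `^ (1 + g) * theta `^ (- g) <= C * ((1 + g) * m * (1 - z) / 4) ->
  ((1 - theta * r)^-1) `^ g * (C * H `^ (1 + g)) *
    (1 - (1 + g) * r * (m - m * (1 - z) / 4)) +
  (Nc / (theta * r)) `^ g * Nc <= C * H `^ (1 + g).
Proof.
move=> /andP[g0 g1] /andP[z0 z1] m0 H0 N0 rE thE p1 u1 Nc0 NcD CD.
have r0 : 0 < r by rewrite rE divr_gt0.
have th0 : 0 < theta by rewrite thE divr_gt0// !mulr_gt0//; lra.
have p0 : 0 < theta * r by rewrite mulr_gt0.
have z1' : (1 - z) / (1 + z) < 1 by rewrite ltr_pdivrMr; lra.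
have q0 : 0 < 1 - theta * r by lra.
have Dc0 : 0 < Dc by rewrite -(pmulr_lgt0 _ N0) (lt_le_trans Nc0).
pose u := (1 + g) * m * r.
have u0 : 0 < u by rewrite !mulr_gt0//; lra.
have gp : g * (theta * r) = z * u.
  by rewrite thE /u; field; rewrite gt_eqF.
(* By concavity the likelihood loss is at most g * p / (1 - p) with p = theta * r and g * p = z * u.
   The bound p <= (1 - z) / (1 + z) means 1 - p >= 2 z / (1 + z), which turns the loss into u * (1 +
   z) / 2. *)
have K1 : ((1 - theta * r)^-1) `^ g <= 1 + u * ((1 + z) / 2).
  have -> : (1 - theta * r)^-1 = 1 + theta * r / (1 - theta * r).
    by field; rewrite gt_eqF.
  have y0 : 0 <= theta * r / (1 - theta * r) by rewrite divr_ge0// ltW.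
  have g01 : 0 < g < 1 by rewrite g0.
  apply: (le_trans (powR1D_le y0 g01)); rewrite lerD2l mulrA gp.
  rewrite ler_pdivrMr//.
  have p1' : theta * r * (1 + z) <= 1 - z by rewrite -ler_pdivlMr; lra.
  have : u * (theta * r * (1 + z)) <= u * (1 - z) by rewrite ler_pM2l.
  lra.
pose X := C * H `^ (1 + g).
have Hp : H `^ (1 + g) = H * H `^ g.
  by rewrite powRD ?(gt_eqF H0) ?implybT// powRr1// ltW.
have Hg0 : 0 < H `^ g by rewrite powR_gt0.
have beta0 : 0 < (1 + g) * m * (1 - z) / 4 by rewrite divr_gt0// !mulr_gt0//; lra.
have C0 : 0 < C.
  rewrite -(pmulr_lgt0 _ beta0) (lt_le_trans _ CD)//.
  by rewrite mulr_gt0// powR_gt0.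
have X0 : 0 < X by rewrite mulr_gt0// powR_gt0.
have jump : (Nc / (theta * r)) `^ g * Nc <= X * (u * (1 - z) / 4).
  have e1 : Nc / (theta * r) <= Dc * (theta^-1 * H).
    rewrite rE; have -> : Dc * (theta^-1 * H) = Dc * N / (theta * (N / H)).
      by field; rewrite !gt_eqF.
    by rewrite ler_pM2r// invr_gt0 -rE.
  have e2 : (Nc / (theta * r)) `^ g <= (Dc * (theta^-1 * H)) `^ g.
    apply: ge0_ler_powR => //; rewrite ?nnegrE ?(ltW g0)//.
      by rewrite divr_ge0 ?(ltW Nc0)// ltW.
    by rewrite !mulr_ge0 ?invr_ge0 ?(ltW Dc0) ?(ltW th0) ?(ltW H0).
  apply: (@le_trans _ _ ((Dc * (theta^-1 * H)) `^ g * (Dc * N))).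
    by apply: ler_pM => //; rewrite ?powR_ge0 ?(ltW Nc0).
  have ti0 : 0 <= theta^-1 by rewrite invr_ge0 ltW.
  rewrite (powRM _ (ltW Dc0)) ?mulr_ge0 ?(ltW H0)// (powRM _ ti0 (ltW H0)).
  have -> : theta^-1 `^ g = theta `^ (- g).
    by rewrite -(powR_inv1 (ltW th0)) -powRrM mulN1r.
  have -> : Dc `^ g * (theta `^ (- g) * H `^ g) * (Dc * N) =
      Dc `^ (1 + g) * theta `^ (- g) * (H `^ g * N).
    by rewrite powRD ?(gt_eqF Dc0) ?implybT// powRr1 ?(ltW Dc0)//; ring.
  have -> : X * (u * (1 - z) / 4) =
      C * ((1 + g) * m * (1 - z) / 4) * (H `^ g * N).
    by rewrite /X Hp /u rE; field; rewrite gt_eqF.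
  by rewrite ler_pM2r// mulr_gt0.
(* The mean contributes the gain u * (3 + z) / 4, the likelihood ratio the loss u * (1 + z) / 2; the
   difference u * (1 - z) / 4 is what [jump] consumes. *)
have main : ((1 - theta * r)^-1) `^ g * (1 - (1 + g) * r * (m - m * (1 - z) / 4)) <=
    1 - u * (1 - z) / 4.
  have -> : (1 + g) * r * (m - m * (1 - z) / 4) = u * ((3 + z) / 4).
    by rewrite /u; field.
  have f0 : 0 <= 1 - u * ((3 + z) / 4).
    have : u * ((3 + z) / 4) <= u * 1 by rewrite ler_pM2l//; lra.
    rewrite /u in u1 *; lra.
  apply: (le_trans (ler_wpM2r f0 K1)).
  have : 0 <= u * ((1 + z) / 2) * (u * ((3 + z) / 4)).
    by rewrite !mulr_ge0 ?(ltW u0)//; lra.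
  lra.
rewrite -/X mulrAC.
apply: (@le_trans _ _ ((1 - u * (1 - z) / 4) * X + X * (u * (1 - z) / 4))).
  by rewrite lerD// ler_pM2r.
lra.
Qed.

(** A jump removes at least r1 * c, so on average r1 * p * c >= r1 * (m + s). Regular steps, after
    conditioning and truncation, add at most r1 * (m + s / 2). The net decrease r1 * s / 2 = 1 pays
    for the step. *)
Lemma time_arithmetic (m s r0 r1 w c p F Nc : R) :
  0 < m -> 0 < s -> r1 = 2 / s -> 0 <= p < 1 -> 0 < F -> F = 1 - Nc -> 0 < Nc ->
  Nc * (m + s / 2) <= s / 4 -> m + s <= p * c ->
  p / Nc * (r0 + r1 * (w - c)) +
    ((1 - p) / F * (r0 + r1 * w) - p / Nc * (r0 + r1 * (w - c))) * (1 - Nc) +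
    - (r1 * ((1 - p) / F)) * - m + r1 * ((1 - p) / F) * (s / 4) + 1 <= r0 + r1 * w.
Proof.
move=> m0 s0 r1E /andP[p0 p1] F0 FE Nc0 small pc.
have r10 : 0 < r1 by rewrite r1E divr_gt0.
rewrite -FE.
have -> : p / Nc * (r0 + r1 * (w - c)) +
    ((1 - p) / F * (r0 + r1 * w) - p / Nc * (r0 + r1 * (w - c))) * F =
  p * (r0 + r1 * (w - c)) * ((1 - F) / Nc) + (1 - p) * (r0 + r1 * w).
  by field; rewrite !gt_eqF.
have -> : (1 - F) / Nc = 1 by rewrite FE; field; rewrite gt_eqF.
have h : (1 - p) / F * (m + s / 4) <= m + s / 2.
  rewrite mulrAC ler_pdivrMr//.
  have : 0 <= p * (m + s / 4) by rewrite mulr_ge0//; lra.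
  rewrite FE; lra.
have h1 := ler_wpM2l (ltW r10) h.
have h2 := ler_wpM2l (ltW r10) pc.
have h3 : r1 * s = 2 by rewrite r1E divfK// gt_eqF.
lra.
Qed.

End drift_arithmetic.

Section measurable_inverse.
Context {d : measure_display} {T : measurableType d} {R : realType}.

Lemma measurable_invr_ge0 (h : T -> R) : (forall t, 0 <= h t) ->
  measurable_fun setT h -> measurable_fun setT (fun t => (h t)^-1).
Proof.
move=> h0 mh; under eq_fun do rewrite -powR_inv1//.
exact: (measurableT_comp (measurable_powR _)).
Qed.

End measurable_inverse.

(** * The mixture with jump probability proportional to N / H *)

Section tail_proportional_mixture.
Context {d : measure_display} {T : measurableType d} {R : realType}.
Variables (P : probability T R) (X : {RV P >-> R}) (f Lambda : R -> R).
Variables (theta a eta : R).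

Local Notation N := (tail X).
Local Notation H := (excess X).
Local Notation c w := (fine (geninv Lambda (Lambda w - a))).

(* By Karamata's theorem this is asymptotically theta * (iota - 1) / w. *)
Definition jump_prob (w : R) : R := theta * (N w / H w).

(** [a_star] is defined backwards from the cutoff, so that Lambda w - a_star w is exactly Lambda (w
    - c w); then w - c w lies between the two generalized inverses. *)
Definition tail_mixture : mixture R :=
  Mixture eta (fun w => 1 - jump_prob w) jump_prob
    (fun w => Lambda w - Lambda (w - c w)) a.

Hypothesis X_integrable : P.-integrable setT (EFin \o X).
Hypothesis hazardN : forall x, N x = expR (- Lambda x).
Hypothesis mf : measurable_fun setT f.
Hypothesis f0 : forall x, 0 <= f x.
Hypothesis eta0 : 0 < eta.
Hypothesis a0 : 0 < a.
Hypothesis theta0 : 0 < theta.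
Hypothesis cut_fin : forall w, eta <= w ->
  geninv Lambda (Lambda w - a) \is a fin_num.
Hypothesis cut_hazard : forall w, eta <= w -> Lambda (w - c w) < Lambda w.
Hypothesis jump_lt1 : forall w, eta <= w -> jump_prob w < 1.
Hypothesis cut_tail : forall w, eta <= w -> N (c w) < 1.

Let N_gt0 x : 0 < N x.
Proof. by rewrite hazardN expR_gt0. Qed.

Let H_gt0 x : 0 < H x.
Proof.
apply: (integrated_tail_gt0 N_gt0); last exact: excess_cvg0.
exact: excess_incr_ge.
Qed.

Let jump_gt0 w : 0 < jump_prob w.
Proof. by rewrite mulr_gt0// divr_gt0. Qed.

Let measurable_tail : measurable_fun setT (fun x : R => N x).
Proof. by rewrite /tail; apply: measurableT_comp => //; exact: ccdf_measurable. Qed.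

Let measurable_excess_fun : measurable_fun setT H.
Proof.
apply: nonincreasing_measurable => // x y.
exact: integrated_tail_noninc N_gt0 (excess_incr_ge X_integrable) _ _.
Qed.

Let measurable_jump : measurable_fun setT jump_prob.
Proof.
rewrite /jump_prob; apply: measurable_funM => //; apply: measurable_funM => //.
by apply: measurable_invr_ge0 => // x; exact: ltW (H_gt0 x).
Qed.

Lemma tail_mixture_in_family : in_mixture_family Lambda tail_mixture.
Proof.
split => //=; first exact: measurable_funB.
move=> w /ltW ew; have j1 := jump_lt1 ew; have j0 := jump_gt0 w.
split => //=; first lra.
- by rewrite ltW.
- by rewrite subrK.
- by rewrite subr_gt0; exact: cut_hazard.
split; first exact: cut_fin.
rewrite /cutoff/=; apply/andP; split.
  by apply: ereal_inf_lbound; exists (w - c w) => //=; rewrite subKr.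
by apply: ereal_sup_ubound; exists (w - c w) => //=; rewrite subKr.
Qed.

Local Notation q := (q_density X f Lambda tail_mixture).

Let cdfE x : fine (cdf X x) = 1 - N x.
Proof.
by rewrite cdf_1_ccdf -tailE.
Qed.

Definition density_factor (w x : R) : R :=
  if x <= c w then (1 - jump_prob w) / (1 - N (c w)) else jump_prob w / N (c w).

Lemma q_densityE b s x : q b s x =
  if eta < b - s then density_factor (b - s) x * f x else f x.
Proof.
rewrite /q_density/=; case: ifPn => // ew.
rewrite /f_star /f_2star /cutoff/= cdfE -/(N _) /density_factor.
by case: leP => _; rewrite ?mulr0 ?addr0 ?add0r mulrA mulrAC.
Qed.

Lemma density_factor_gt0 w x : eta <= w -> 0 < density_factor w x.
Proof.
move=> ew; rewrite /density_factor; case: ifPn => _; rewrite divr_gt0//.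
  by have := jump_lt1 ew; lra.
by have := cut_tail ew; lra.
Qed.

Lemma q_density_ge0 b s x : 0 <= q b s x.
Proof.
rewrite q_densityE; case: ifPn => // /ltW ew.
by rewrite mulr_ge0// ltW// density_factor_gt0.
Qed.

(** Where [f] vanishes both sides are 0; elsewhere the density factor is positive, so the division
    by [q] is genuine. *)
Lemma q_density_balance b s x : q b s x * (f x / q b s x) = f x.
Proof.
have [fx|fx] := eqVneq (f x) 0; first by rewrite fx mul0r mulr0.
rewrite mulrC divfK// q_densityE; case: ifPn => // /ltW ew.
by rewrite mulf_neq0// gt_eqF// density_factor_gt0.
Qed.

Lemma measurable_q_density b : measurable_fun setT (fun z : R * R => q b z.1 z.2).
Proof.
(* [fine] sends -oo to 0, so the cutoff itself need not be monotone below eta. *)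
pose c' w := c (Num.max w eta).
have c'_nd : {homo c' : x y / x <= y}.
  move=> x y xy; rewrite /c' fine_le ?cut_fin ?le_max ?lexx ?orbT//.
  apply: le_ereal_inf => _ [u /= hu <-]; exists u => //=.
  apply: le_trans hu; rewrite lerD2r.
  have : N (Num.max y eta) <= N (Num.max x eta).
    by apply: tail_noninc; rewrite ge_max !le_max xy lexx !orbT.
  by rewrite !hazardN ler_expR lerN2.
have mc' : measurable_fun setT c' by exact: nondecreasing_measurable.
have mw : measurable_fun setT (fun z : R * R => b - z.1) by exact: measurable_funB.
have mcw := measurableT_comp mc' mw.
have mI : measurable_fun setT (fun z : R * R => (z.2 <= c' (b - z.1))%R%:R : R).
  rewrite (_ : (fun z => _) = (fun z : R * R => (z.2 - c' (b - z.1) <= 0)%R%:R)).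
    by apply: (measurableT_comp (measurable_le_indicator 0)); exact: measurable_funB.
  by apply/funext => z; rewrite subr_le0.
have mE : measurable_fun setT (fun z : R * R => (eta < b - z.1)%R%:R : R).
  exact: (measurableT_comp (measurable_gt_indicator eta) mw).
have mj := measurableT_comp measurable_jump mw.
have mNc := measurableT_comp measurable_tail mcw.
have mff : measurable_fun setT (fun z : R * R => f z.2).
  exact: (measurableT_comp mf measurable_snd).
pose I (z : R * R) : R := (z.2 <= c' (b - z.1))%R%:R.
pose E (z : R * R) : R := (eta < b - z.1)%R%:R.
rewrite (_ : (fun z => _) = (fun z : R * R => (E z * (I z *
    ((1 - jump_prob (b - z.1)) * (1 - N (c' (b - z.1)))^-1) +
    (1 - I z) * (jump_prob (b - z.1) * (N (c' (b - z.1)))^-1)) + (1 - E z)) * f z.2)).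
  apply: measurable_funM => //; apply: measurable_funD; last exact: measurable_funB.
  apply: measurable_funM => //; apply: measurable_funD; apply: measurable_funM => //.
  - apply: measurable_funM; first exact: measurable_funB.
    apply: measurable_invr_ge0; last exact: measurable_funB.
    by move=> z; rewrite subr_ge0 tail_le1.
  - exact: measurable_funB.
  - apply: measurable_funM => //; apply: measurable_invr_ge0 => // z.
    exact: ltW (N_gt0 _).
apply/funext => z; rewrite q_densityE /E; case: ifPn => [ew|_]; last first.
  by rewrite mul0r add0r subr0 mul1r.
have c'E : c' (b - z.1) = c (b - z.1) by rewrite /c' max_l// ltW.
rewrite mul1r subrr addr0; congr (_ * _).
rewrite /density_factor /I c'E; case: ifPn => _.
  by rewrite mul1r subrr mul0r addr0.
by rewrite mul0r add0r subr0 mul1r.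
Qed.

End tail_proportional_mixture.

Section tail_mixture_drift.
Context {d : measure_display} {T : measurableType d} {R : realType}.
Variables (P : probability T R) (X : {RV P >-> R}) (f Lambda : R -> R).
Variables (theta a eta : R).

Local Notation N := (tail X).
Local Notation H := (excess X).
Local Notation c w := (fine (geninv Lambda (Lambda w - a))).
Local Notation jump := (jump_prob X theta).
Local Notation q := (q_density X f Lambda (tail_mixture X Lambda theta a eta)).

Hypothesis X_integrable : P.-integrable setT (EFin \o X).
Hypothesis hazardN : forall x, N x = expR (- Lambda x).
Hypothesis mf : measurable_fun setT f.
Hypothesis f0 : forall x, 0 <= f x.
Hypothesis transfer : forall h : R -> \bar R, measurable_fun setT h ->
  (forall x, (0 <= h x)%E) ->
  (\int[P]_t h (X t) = \int[lebesgue_measure]_x ((f x)%:E * h x))%E.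
Hypothesis eta0 : 0 < eta.
Hypothesis theta0 : 0 < theta.
Hypothesis cut_fin : forall w, eta <= w ->
  geninv Lambda (Lambda w - a) \is a fin_num.
Hypothesis jump_lt1 : forall w, eta <= w -> jump w < 1.
Hypothesis cut_tail : forall w, eta <= w -> N (c w) < 1.

Variables (m mabs A tau : R).
Hypothesis m0 : 0 < m.
Hypothesis meanX : (\int[P]_t (X t)%:E = (- m)%:E)%E.
Hypothesis absX : (\int[P]_t (`|X t|)%:E = mabs%:E)%E.
Hypothesis tau_bound : (\int[P]_t (`|X t| * (A < `|X t|)%R%:R)%:E <= tau%:E)%E.
Hypothesis cut_ge : forall w, eta <= w -> A <= c w.
Hypothesis cut_gt0 : forall w, eta <= w -> 0 < c w.

Let N_gt0 x : 0 < N x.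
Proof. by rewrite hazardN expR_gt0. Qed.

Let H_noninc x y : x <= y -> H y <= H x.
Proof. exact: integrated_tail_noninc N_gt0 (excess_incr_ge X_integrable) _ _. Qed.

Let H_gt0 x : 0 < H x.
Proof.
apply: (integrated_tail_gt0 N_gt0); last exact: excess_cvg0.
exact: excess_incr_ge.
Qed.

Let jump_gt0 w : 0 < jump w.
Proof. by rewrite mulr_gt0// divr_gt0. Qed.

Let factor_gt0 w x : eta <= w -> 0 < density_factor X Lambda theta a w x.
Proof. exact: density_factor_gt0. Qed.

Let measurable_q b s : measurable_fun setT (fun x : R => q b s x).
Proof.
have mq := measurable_q_density theta X_integrable hazardN mf cut_fin b.
have h : measurable_fun setT (fun x : R => (s, x)) by exact: measurable_fun_pair.
exact: (measurableT_comp mq h).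
Qed.

Let q_ge0 b s x : 0 <= q b s x.
Proof. exact: q_density_ge0. Qed.

(** Moves an integral against the mixture density to an expectation under the nominal law, where the
    moments of [X] are available. *)
Lemma integral_density_le (k h : R -> R) (B : \bar R) :
  measurable_fun setT k -> measurable_fun setT h ->
  (forall x, 0 <= k x) -> (forall x, 0 <= h x) ->
  (forall x, k x <= f x * h x) ->
  (\int[P]_t (h (X t))%:E <= B)%E ->
  (\int[lebesgue_measure]_x (k x)%:E <= B)%E.
Proof.
move=> mk mh k0 h0 kh; apply: le_trans.
rewrite (transfer (h := fun x => (h x)%:E)); last 2 first.
- exact/measurable_EFinP.
- by move=> x; rewrite lee_fin.
apply: ge0_le_integral => //.
- by move=> x _; rewrite lee_fin.
- exact: (measurable_EFinP _ _).2.
- by apply: emeasurable_funM; apply/measurable_EFinP.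
- by move=> x _; rewrite -EFinM lee_fin.
Qed.

Section second_moment.
Variables (g z Dc M e C : R).
Hypothesis g01 : 0 < g < 1.
Hypothesis z01 : 0 < z < 1.
Hypothesis thetaE : theta = z * (1 + g) * m / g.
Hypothesis M0 : 0 <= M.
Hypothesis e0 : 0 <= e.
Hypothesis jump_small : forall w, eta <= w -> jump w <= (1 - z) / (1 + z).
Hypothesis ratio_small : forall w, eta <= w -> (1 + g) * m * (N w / H w) <= 1.
Hypothesis cut_tail_le : forall w, eta <= w -> N (c w) <= Dc * N w.
Hypothesis expansion : forall w, eta <= w -> forall x, x <= c w ->
  (H (w - x) / H w) `^ (1 + g) <= 1 + (1 + g) * (N w / H w) *
      (x + e * `|x| + M * (if A < `|x| then `|x| else 0)).
Hypothesis errors : e * mabs + M * tau <= m * (1 - z) / 4.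
Hypothesis CE : C = (H eta `^ (1 + g))^-1.
Hypothesis C_large :
  Dc `^ (1 + g) * theta `^ (- g) <= C * ((1 + g) * m * (1 - z) / 4).

(* The excess is nonincreasing and C normalizes the second branch to 1 at eta,
   so this is the minimum of both branches. *)
Definition moment_lyapunov (w : R) : R :=
  if w <= eta then 1 else C * H w `^ (1 + g).

Let g1 : 0 < 1 + g. Proof. by case/andP: g01 => ? _; lra. Qed.

Let C0 : 0 < C.
Proof. by rewrite CE invr_gt0 powR_gt0. Qed.

Let powH_le x y : x <= y -> C * H y `^ (1 + g) <= C * H x `^ (1 + g).
Proof.
move=> xy; rewrite (ler_pM2l C0); apply: ge0_ler_powR.
- exact: ltW.
- by rewrite nnegrE ltW.
- by rewrite nnegrE ltW.
- exact: H_noninc.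
Qed.

Let powH_eta : C * H eta `^ (1 + g) = 1.
Proof. by rewrite CE mulVf// gt_eqF// powR_gt0. Qed.

Lemma moment_lyapunov_le1 w : moment_lyapunov w <= 1.
Proof.
rewrite /moment_lyapunov; case: ifPn => //; rewrite -ltNge => /ltW ew.
by rewrite -[leRHS]powH_eta powH_le.
Qed.

Lemma moment_lyapunov_le w : moment_lyapunov w <= C * H w `^ (1 + g).
Proof.
rewrite /moment_lyapunov; case: ifPn => // we.
by rewrite -[leLHS]powH_eta powH_le.
Qed.

Lemma moment_lyapunov_ge0 w : 0 <= moment_lyapunov w.
Proof.
by rewrite /moment_lyapunov; case: ifPn => // _; rewrite mulr_ge0 ?powR_ge0// ltW.
Qed.

Lemma measurable_moment_lyapunov : measurable_fun setT moment_lyapunov.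
Proof.
apply: (nonincreasing_measurable measurableT) => x y xy.
rewrite {2}/moment_lyapunov; case: ifPn => [_|]; first exact: moment_lyapunov_le1.
rewrite -ltNge => ex; rewrite /moment_lyapunov [y <= eta]leNgt (lt_le_trans ex xy)/=.
exact: powH_le.
Qed.

Let measurable_factor w : measurable_fun setT (density_factor X Lambda theta a w).
Proof.
rewrite /density_factor; apply: measurable_fun_ifT => //.
exact: measurable_fun_ler.
Qed.

(** Up to [eta] the density is [f] and the function, equal to 1 there, is at its maximum. Beyond
    [eta] the regular part is handled by the tangent expansion of H ^ (1 + g), the jump part by the
    bound 1 on the function. *)
Lemma moment_drift b s :
  (\int[lebesgue_measure]_x (q b s x * (f x / q b s x) `^ (1 + g) *
     moment_lyapunov (b - s - x))%:E <= (moment_lyapunov (b - s))%:E)%E.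
Proof.
set w := b - s.
have mgw : measurable_fun setT (fun x : R => moment_lyapunov (w - x)).
  by apply: (measurableT_comp measurable_moment_lyapunov); exact: measurable_funB.
have mk : measurable_fun setT (fun x : R => q b s x * (f x / q b s x) `^ (1 + g) *
    moment_lyapunov (w - x)).
  apply: measurable_funM => //; apply: measurable_funM => //.
  apply: (measurableT_comp (measurable_powR _)); apply: measurable_funM => //.
  exact: measurable_invr_ge0.
have k0 x : 0 <= q b s x * (f x / q b s x) `^ (1 + g) * moment_lyapunov (w - x).
  by rewrite !mulr_ge0 ?powR_ge0 ?moment_lyapunov_ge0.
have [ew|we] := ltP eta w; last first.
  apply: (integral_density_le mk (h := fun _ => 1)) => //.
    move=> x; rewrite q_densityE// ltNge we/= mulr1.
    have := likelihood_cost g ltr01 (f0 x); rewrite !mul1r invr1 powR1 mulr1 => h.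
    apply: le_trans h; rewrite ler_piMr ?moment_lyapunov_le1//.
    by rewrite mulr_ge0 ?powR_ge0.
  rewrite /moment_lyapunov we integral_cst//.
  by rewrite [X in (_ * X)%E](@probability_setT _ _ _ P) mule1.
have ew' := ltW ew.
have [g0 g1'] := andP g01.
pose phi := density_factor X Lambda theta a w.
have phi0 x : 0 < phi x by exact: factor_gt0.
have mphi : measurable_fun setT phi by exact: measurable_factor.
apply: (integral_density_le mk
  (h := fun x => (phi x)^-1 `^ g * moment_lyapunov (w - x))) => //.
- apply: measurable_funM => //; apply: (measurableT_comp (measurable_powR _)).
  by apply: measurable_invr_ge0 => // x; exact: ltW.
- by move=> x; rewrite mulr_ge0 ?powR_ge0 ?moment_lyapunov_ge0.
- move=> x; rewrite q_densityE// ew/= mulrA ler_wpM2r ?moment_lyapunov_ge0//.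
  exact: likelihood_cost.
have j0 := jump_gt0 w; have j1 := jump_lt1 ew'.
have Nc0 := N_gt0 (c w); have Nc1 := cut_tail ew'.
have Hw0 := H_gt0 w; have Nw0 := N_gt0 w.
have q0 : 0 < 1 - jump w by lra.
pose K1 := (1 - jump w)^-1 `^ g.
pose X1 := K1 * (C * H w `^ (1 + g)).
pose k := (1 + g) * (N w / H w).
pose kap := (N (c w) / jump w) `^ g.
have X10 : 0 <= X1 by rewrite !mulr_ge0 ?powR_ge0// ltW.
have k0' : 0 <= k by rewrite mulr_ge0 ?divr_ge0// ltW.
have kap0 : 0 <= kap by exact: powR_ge0.
(* The majorant is the expansion, times the regular likelihood factor, plus kap * 1{x > c}, the
   indicator being written 1 - 1{x <= c}. Past the cutoff [x] is positive, so the expansion term is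
   nonnegative and may be kept there, which makes the full mean of [X] appear. *)
apply: (le_trans (integral_le_affine X_integrable meanX absX
    (a0 := X1 + kap) (a1 := - kap) (a2 := X1 * k) (a3 := X1 * k * e)
    (a4 := X1 * k * M) (c := c w) _ _ _ tau_bound _)).
- apply: measurable_funM.
    apply: (measurableT_comp (measurable_powR _)).
    apply: measurable_invr_ge0; first by move=> t; exact: ltW.
    exact: measurableT_comp.
  exact: (measurableT_comp mgw).
- by move=> t; rewrite mulr_ge0 ?powR_ge0 ?moment_lyapunov_ge0.
- exact: mulr_ge0 (mulr_ge0 X10 k0') M0.
- move=> t; move: (X t) => x.
  have [xc|cx] := leP x (c w).
    have -> : X1 + kap + - kap * 1 + X1 * k * x + X1 * k * e * `|x| +
        X1 * k * M * (`|x| * (A < `|x|)%R%:R) =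
      X1 * (1 + k * (x + e * `|x| + M * (if A < `|x| then `|x| else 0))).
      by case: (A < `|x|) => /=; ring.
    apply: (@le_trans _ _ (K1 * (C * H (w - x) `^ (1 + g)))).
      apply: ler_pM; rewrite ?powR_ge0 ?moment_lyapunov_ge0 ?moment_lyapunov_le//.
      apply: ge0_ler_powR; rewrite ?nnegrE ?invr_ge0 ?(ltW g0) ?(ltW q0) ?(ltW (phi0 x))//.
      rewrite /phi /density_factor xc invfM invrK mulrC ler_piMl ?invr_ge0 ?(ltW q0)//.
      by lra.
    rewrite /X1 -[leRHS]mulrA ler_wpM2l ?powR_ge0// -[leRHS]mulrA ler_wpM2l ?(ltW C0)//.
    have -> : H (w - x) `^ (1 + g) = H w `^ (1 + g) * (H (w - x) / H w) `^ (1 + g).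
      rewrite -powRM ?(ltW Hw0) ?divr_ge0 ?(ltW (H_gt0 _))//.
      by rewrite mulrC divfK// gt_eqF.
    by rewrite ler_wpM2l ?powR_ge0//; exact: expansion.
  have x0 : 0 < x by exact: lt_trans (cut_gt0 ew') cx.
  have Ax : A < `|x| by rewrite gtr0_norm// (le_lt_trans (cut_ge ew')).
  rewrite /phi /density_factor [x <= c w]leNgt cx/= invf_div -/kap Ax mulr1 mulr0 addr0.
  apply: (@le_trans _ _ kap).
    by rewrite ler_piMr// moment_lyapunov_le1.
  rewrite gtr0_norm//.
  have Xk0 := mulr_ge0 X10 k0'.
  have : 0 <= X1 * k * x by exact: mulr_ge0 (ltW x0).
  have : 0 <= X1 * k * e * x by exact: mulr_ge0 (mulr_ge0 Xk0 e0) (ltW x0).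
  have : 0 <= X1 * k * M * x by exact: mulr_ge0 (mulr_ge0 Xk0 M0) (ltW x0).
  lra.
rewrite lee_fin.
have err := ler_wpM2l (mulr_ge0 X10 k0') errors.
have := moment_arithmetic g01 z01 m0 Hw0 Nw0 erefl thetaE (jump_small ew')
  (ratio_small ew') Nc0 (cut_tail_le ew') C_large.
rewrite -/X1 -/kap -/k.
rewrite [X in _ -> _ <= X]/moment_lyapunov [w <= eta]leNgt ew/= => fin.
apply: le_trans fin.
lra.
Qed.

End second_moment.

Section passage_time_drift.
Variables (s0 r0 r1 : R).
Hypothesis s00 : 0 < s0.
Hypothesis r1E : r1 = 2 / s0.
Hypothesis tauE : tau = s0 / 4.
Hypothesis mabs0 : 0 <= mabs.
Hypothesis cut_le : forall w, eta <= w -> c w <= w.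
Hypothesis cut_tail_small : forall w, eta <= w -> N (c w) * (m + s0 / 2) <= s0 / 4.
Hypothesis jump_large : forall w, eta <= w -> m + s0 <= jump w * c w.
Hypothesis r0_large : 1 + r1 * (eta + mabs) <= r0 * N eta.

(** Zero after passage, with a jump of size [r0] at the level: the function drops by at least [r0]
    whenever the walk crosses. *)
Definition time_lyapunov (w : R) : R := if w < 0 then 0 else r0 + r1 * w.

Let r10 : 0 < r1.
Proof. by rewrite r1E divr_gt0. Qed.

Let r00 : 0 < r0.
Proof.
rewrite -(pmulr_lgt0 _ (N_gt0 eta)) (lt_le_trans _ r0_large)//.
by rewrite ltr_wpDr// mulr_ge0 ?(ltW r10)// addr_ge0// ltW.
Qed.

Lemma time_lyapunov_ge0 w : 0 <= time_lyapunov w.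
Proof.
rewrite /time_lyapunov; case: ltP => // w0.
by rewrite addr_ge0 ?(ltW r00)// mulr_ge0// ltW.
Qed.

Lemma time_lyapunov_nd x y : x <= y -> time_lyapunov x <= time_lyapunov y.
Proof.
move=> xy; rewrite {1}/time_lyapunov; case: ltP => [_|x0].
  exact: time_lyapunov_ge0.
by rewrite /time_lyapunov ltNge (le_trans x0 xy)/= lerD2l ler_wpM2l// ltW.
Qed.

Lemma measurable_time_lyapunov : measurable_fun setT time_lyapunov.
Proof. by apply: nondecreasing_measurable => // x y; exact: time_lyapunov_nd. Qed.

(** Up to [eta] there is no forced jump, but each step crosses with probability at least N eta; the
    drop [r0] is large enough to pay for the step and for an expected move back of at most E|X|.
    Beyond [eta] the forced jumps supply the drift. *)
Lemma time_drift b s : s <= b ->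
  (1 + \int[lebesgue_measure]_x (q b s x * time_lyapunov (b - s - x))%:E <=
   (time_lyapunov (b - s))%:E)%E.
Proof.
move=> sb; set w := b - s.
have w0 : 0 <= w by rewrite subr_ge0.
have mgw : measurable_fun setT (fun x : R => time_lyapunov (w - x)).
  by apply: (measurableT_comp measurable_time_lyapunov); exact: measurable_funB.
have mk : measurable_fun setT (fun x : R => q b s x * time_lyapunov (w - x)).
  exact: measurable_funM.
have k0 x : 0 <= q b s x * time_lyapunov (w - x).
  by rewrite mulr_ge0 ?time_lyapunov_ge0.
have vw : time_lyapunov w = r0 + r1 * w by rewrite /time_lyapunov ltNge w0.
suff : (\int[lebesgue_measure]_x (q b s x * time_lyapunov (w - x))%:E <=
    (r0 + r1 * w - 1)%:E)%E.
  move=> h; rewrite vw (_ : r0 + r1 * w = 1 + (r0 + r1 * w - 1)); last lra.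
  by rewrite EFinD leeD2l.
have tau0 : 0 < s0 / 4 by rewrite divr_gt0.
have [ew|we] := ltP eta w; last first.
  apply: (integral_density_le mk (h := fun x => time_lyapunov (w - x))) => //.
  - by move=> x; exact: time_lyapunov_ge0.
  - by move=> x; rewrite q_densityE// ltNge we.
  (* A step that does not cross has x <= w <= eta, so [r0] is charged only on 1{x <= eta}. *)
  apply: (le_trans (integral_le_affine X_integrable meanX absX
    (a0 := r1 * eta) (a1 := r0) (a2 := 0) (a3 := r1) (a4 := 0) (c := eta) _ _ _
    tau_bound _)).
  - exact: (measurableT_comp mgw).
  - by move=> t; exact: time_lyapunov_ge0.
  - by [].
  - move=> t; move: (X t) => x; rewrite !mul0r !addr0.
    have x0 := normr_ge0 x; have xx := lerNnormlW (lexx `|x|).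
    have rx : 0 <= r1 * `|x| by rewrite mulr_ge0// ltW.
    have re : 0 <= r1 * eta by rewrite mulr_ge0// ltW.
    rewrite /time_lyapunov; case: ltP => [_|wx].
      by rewrite !addr_ge0// mulr_ge0// ltW.
    have -> : x <= eta by lra.
    rewrite /= mulr1.
    have : r1 * (w - x) <= r1 * (eta + `|x|) by rewrite ler_pM2l//; lra.
    lra.
  rewrite lee_fin !mul0r !addr0.
  have : 0 <= r1 * w by rewrite mulr_ge0// ltW.
  have := r0_large; lra.
have ew' := ltW ew.
pose phi := density_factor X Lambda theta a w.
have phi0 x : 0 < phi x by exact: factor_gt0.
have mphi : measurable_fun setT phi.
  rewrite /phi /density_factor; apply: measurable_fun_ifT => //.
  exact: measurable_fun_ler.
apply: (integral_density_le mk
  (h := fun x => phi x * time_lyapunov (w - x))) => //.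
- exact: measurable_funM.
- by move=> x; rewrite mulr_ge0 ?(ltW (phi0 _))// time_lyapunov_ge0.
- by move=> x; rewrite q_densityE// ew/= -/(phi x) -mulrA mulrCA.
have j0 := jump_gt0 w; have j1 := jump_lt1 ew'.
have Nc0 := N_gt0 (c w); have Nc1 := cut_tail ew'.
have c0 := cut_gt0 ew'; have cw := cut_le ew'.
pose V := r0 + r1 * w; pose V' := r0 + r1 * (w - c w).
have V'0 : 0 <= V' by rewrite addr_ge0 ?(ltW r00)// mulr_ge0 ?(ltW r10)// subr_ge0.
pose pF := (1 - jump w) / (1 - N (c w)); pose pN := jump w / N (c w).
have pF0 : 0 < pF by rewrite divr_gt0//; lra.
have pN0 : 0 < pN by rewrite divr_gt0.
have rp : 0 < r1 * pF by rewrite mulr_gt0.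
(* The linear term - r1 * pF * x is correct up to the cutoff only. Beyond it x exceeds [A], so the
   last term with a4 = r1 * pF cancels it and leaves pN * V', a bound by monotonicity. *)
apply: (le_trans (integral_le_affine X_integrable meanX absX
    (a0 := pN * V') (a1 := pF * V - pN * V') (a2 := - (r1 * pF)) (a3 := 0)
    (a4 := r1 * pF) (c := c w) _ _ _ tau_bound _)).
- apply: measurable_funM; first exact: measurableT_comp.
  exact: (measurableT_comp mgw).
- by move=> t; rewrite mulr_ge0 ?(ltW (phi0 _))// time_lyapunov_ge0.
- exact: ltW.
- move=> t; move: (X t) => x; rewrite mul0r addr0 /phi /density_factor -/pF -/pN.
  have [xc|cx] := leP x (c w).
    have -> : time_lyapunov (w - x) = r0 + r1 * (w - x).
      by rewrite /time_lyapunov ltNge (_ : 0 <= w - x)//; lra.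
    have : 0 <= r1 * pF * (`|x| * (A < `|x|)%R%:R).
      by rewrite mulr_ge0 ?(ltW rp)// mulr_ge0.
    rewrite /V /= mulr1; lra.
  have x0 : 0 < x by lra.
  have Ax : A < x by exact: le_lt_trans (cut_ge ew') cx.
  rewrite gtr0_norm// Ax mulr0 !mulr1 addr0.
  have : time_lyapunov (w - x) <= V'.
    have -> : V' = time_lyapunov (w - c w).
      by rewrite /time_lyapunov ltNge subr_ge0 cw.
    by apply: time_lyapunov_nd; lra.
  move/(ler_wpM2l (ltW pN0)); lra.
have j01 : 0 <= jump w < 1 by rewrite (ltW j0).
have F0 : 0 < 1 - N (c w) by lra.
have := time_arithmetic r0 w m0 s00 r1E j01 F0 erefl Nc0 (cut_tail_small ew')
  (jump_large ew').
rewrite lee_fin -/pF -/pN -/V -/V' mul0r addr0 tauE; lra.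
Qed.

End passage_time_drift.
End tail_mixture_drift.

(** * Choice of the rate, the cutoff and the threshold *)

Section parameters.
Context {R : realType}.
Variables (N H Lambda : R -> R) (iota g m : R).
Hypothesis hazardN : forall x, N x = expR (- Lambda x).
Hypothesis N_noninc : forall x y : R, x <= y -> N y <= N x.
Hypothesis iota_gt1 : 1 < iota.
Hypothesis iota_lt2 : iota < 2.
Hypothesis g_range : 0 < g < (iota - 1) / (2 - iota).
Hypothesis m0 : 0 < m.
Hypothesis N_rv : forall t : R, 0 < t -> t <= 1 ->
  N (x * t) / N x @[x --> +oo] --> t `^ (- iota).
Hypothesis H_incr_le : forall x y : R, x <= y -> H x - H y <= (y - x) * N x.
Hypothesis H_incr_ge : forall x y : R, x <= y -> (y - x) * N y <= H x - H y.
Hypothesis H_cvg0 : H x @[x --> +oo] --> (0 : R).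

Let N_gt0 x : 0 < N x.
Proof. by rewrite hazardN expR_gt0. Qed.

Let H_gt0 x : 0 < H x.
Proof. exact: (integrated_tail_gt0 N_gt0 H_incr_ge H_cvg0). Qed.

(** The surplus over [m] of jump rate times distance covered, theta * (z ^ 3 * k) - m. The five
    factors [z] come from theta, from k = z * (iota - 1) and from the cutoff being at least z ^ 3 *
    w. *)
Let jump_margin (z : R) : R := m * (z ^+ 5 * ((1 + g) * (iota - 1) / g) - 1).

(* The window for g is exactly the condition under which the jump rate can be
   large enough for a linear mean passage time and small enough for a finite
   (1 + g)-th moment. *)
Lemma exists_jump_rate : exists2 z, 0 < z < 1 & 0 < jump_margin z.
Proof.
have i1 := iota_gt1; have i2 := iota_lt2; have /andP[g0 gi] := g_range.
have k1 : 1 < (1 + g) * (iota - 1) / g.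
  rewrite ltr_pdivlMr// mul1r.
  move: gi; rewrite ltr_pdivlMr; last lra.
  lra.
have [z /andP[z0 z1] zk] := powR_near1 (ltr0n R 5) k1.
exists z; first by rewrite z0.
have z5 : 0 < z ^+ 5 by rewrite exprn_gt0.
rewrite /jump_margin mulr_gt0// subr_gt0 mulrC -ltr_pdivrMr// mul1r.
by move: zk; rewrite powRN -(powR_mulrn 5 (ltW z0)).
Qed.

(** The critical rate of the moment constraint, reduced by [z]. *)
Definition jump_intensity (z : R) : R := z * (1 + g) * m / g.

(** Collects every asymptotic requirement at a single [eta]. [Dc] exceeds the limit of N (z ^ 3 * w)
    / N w and hence bounds N (c w) / N w; it is fixed before [eta], so the condition that couples
    them is not circular. *)
Lemma exists_threshold z A e M : 0 < z < 1 -> 0 < jump_margin z ->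
  (forall A e, 0 <= A -> 0 < e -> \forall w \near +oo, forall x, x <= z * w ->
    (H (w - x) / H w) `^ (1 + g) <= 1 + (1 + g) * (N w / H w) *
      (x + e * `|x| + M * (if A < `|x| then `|x| else 0))) ->
  0 <= A -> 0 < e ->
  let theta := jump_intensity z in
  let c w := fine (geninv Lambda (Lambda w - jump_gap iota z)) in
  exists Dc eta, [/\ 0 < eta,
    Dc `^ (1 + g) * theta `^ (- g) <=
      (H eta `^ (1 + g))^-1 * ((1 + g) * m * (1 - z) / 4) &
    forall w, eta <= w ->
    [/\ [/\ geninv Lambda (Lambda w - jump_gap iota z) \is a fin_num,
            Lambda (w - c w) < Lambda w, A <= c w, 0 < c w & c w <= w],
        [/\ theta * (N w / H w) < 1, theta * (N w / H w) <= (1 - z) / (1 + z) &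
            (1 + g) * m * (N w / H w) <= 1],
        [/\ N (c w) < 1, N (c w) <= Dc * N w &
            N (c w) * (m + jump_margin z / 2) <= jump_margin z / 4],
        m + jump_margin z <= theta * (N w / H w) * c w &
        forall x, x <= c w ->
          (H (w - x) / H w) `^ (1 + g) <= 1 + (1 + g) * (N w / H w) *
            (x + e * `|x| + M * (if A < `|x| then `|x| else 0))]].
Proof.
move=> z01 s0 expansion A0 e0 theta c.
have i1 := iota_gt1; have /andP[g0 _] := g_range; have m0' := m0.
have /andP[z0 z1] := z01.
set s := jump_margin z in s0 *.
have theta0 : 0 < theta by rewrite /theta divr_gt0// !mulr_gt0//; lra.
have z30 : 0 < z ^+ 3 by rewrite exprn_gt0.
have z31 : z ^+ 3 <= 1 by rewrite exprn_ile1// ltW.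
pose Dc := (z ^+ 3) `^ (- iota) + 1.
have Dc0 : 0 < Dc by rewrite ltr_wpDl ?powR_ge0.
have Dck : (z ^+ 3) `^ (- iota) < Dc by rewrite /Dc ltrDl.
pose e1 := Num.min ((1 - z) / (1 + z) / theta) ((1 + g) * m)^-1.
have gm0 : 0 < (1 + g) * m by rewrite mulr_gt0//; lra.
have e10 : 0 < e1.
  have zz0 : 0 < (1 - z) / (1 + z) by apply: divr_gt0; lra.
  by rewrite lt_min invr_gt0 gm0 andbT (divr_gt0 zz0 theta0).
pose e2 := Num.min (s / 4 / (m + s / 2)) 2^-1 / Dc.
have ms : 0 < m + s / 2 by rewrite addr_gt0// divr_gt0.
have e20 : 0 < e2.
  have s4 : 0 < s / 4 by exact: divr_gt0.
  by apply: divr_gt0 => //; rewrite lt_min invr_gt0 ltr0n andbT (divr_gt0 s4 ms).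
pose k := z * (iota - 1).
have k01 : 0 < k < iota - 1.
  by rewrite mulr_gt0 ?subr_gt0//= gtr_pMl// subr_gt0.
pose beta := (1 + g) * m * (1 - z) / 4.
have beta0 : 0 < beta by rewrite divr_gt0// mulr_gt0// subr_gt0.
(* H eta <= h0 is equivalent to the first inequality of the conclusion. As [H] tends to 0, a distant
   threshold makes the normalizing constant of the moment function as large as required. *)
pose B0 := beta / (Dc `^ (1 + g) * theta `^ (- g)).
have DT : 0 < Dc `^ (1 + g) * theta `^ (- g) by rewrite mulr_gt0 ?powR_gt0.
have B00 : 0 < B0 by rewrite divr_gt0.
pose h0 := B0 `^ (1 + g)^-1.
have h00 : 0 < h0 by rewrite powR_gt0.
have n1 := cutoff_asymptotics hazardN N_noninc i1 N_rv z01.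
have n2 := tail_ratio_le N_gt0 N_rv z30 z31 Dck.
have n3 := tail_small N_gt0 N_rv H_incr_ge H_cvg0 e10.
have n4 := expansion A e A0 e0.
have n5 := karamata_ge N_gt0 N_rv H_incr_le H_cvg0 k01.
have n6 := tail_small N_gt0 N_rv H_incr_ge H_cvg0 e20.
have n7 := cvgr_le _ H_cvg0 _ (@ltr01 R).
have n8 := cvgr_le _ H_cvg0 _ h00.
have good : \forall w \near +oo, [/\ [/\ 0 < w, A / z ^+ 3 <= w & H w <= h0],
    [/\ geninv Lambda (Lambda w - jump_gap iota z) \is a fin_num,
        z ^+ 3 * w <= c w, c w <= z * w & Lambda (w - c w) < Lambda w],
    [/\ N (z ^+ 3 * w) <= Dc * N w, N w <= e1 * H w, N w <= e2 * H w & H w <= 1],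
    k * H w <= w * N w &
    forall x, x <= z * w ->
      (H (w - x) / H w) `^ (1 + g) <= 1 + (1 + g) * (N w / H w) *
      (x + e * `|x| + M * (if A < `|x| then `|x| else 0))].
  near=> w.
  have [c1 c2 c3] : [/\ geninv Lambda (Lambda w - jump_gap iota z) \is a fin_num,
      z ^+ 3 * w <= c w <= z * w & Lambda (w - c w) < Lambda w] by near: w.
  have /andP[c21 c22] := c2.
  split; [split|by []|split|by near: w|by near: w]; try by near: w.
  - by near: w; exact: nbhs_pinfty_gt.
  - by near: w; exact: (nbhs_pinfty_ge (num_real _)).
  - by near: w; exact: n8.
  - by near: w; exact: n7.
have [w0 hw0] := filter_ex (near_pinfty_forall_ge good).
exists Dc, w0.
have [[w00 _ Hw0] _ _ _ _] := hw0 w0 (lexx _).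
split => // [|w ww].
  have h1 : H w0 `^ (1 + g) <= B0.
    have -> : B0 = h0 `^ (1 + g).
      by rewrite /h0 -powRrM mulVf ?powRr1 ?(ltW B00)// gt_eqF//; lra.
    by apply: ge0_ler_powR; rewrite ?nnegrE ?(ltW (H_gt0 _)) ?(ltW h00)//; lra.
  rewrite -/beta ler_pdivlMl ?powR_gt0//.
  by move: h1; rewrite /B0 ler_pdivlMr.
have [[wp Aw _] [c1 c2 c3 c4] [N1 N2 N3 H1] kar ex] := hw0 w ww.
have Hw := H_gt0 w; have Nw := N_gt0 w.
have ratio1 : N w / H w <= e1 by rewrite ler_pdivrMr.
have zw0 : 0 < z ^+ 3 * w by rewrite mulr_gt0.
have j1 : theta * (N w / H w) <= (1 - z) / (1 + z).
  rewrite mulrC -ler_pdivlMr//; apply: (le_trans ratio1).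
  by rewrite /e1 ge_min lexx.
have Ncw : N (c w) <= Dc * N w by rewrite (le_trans _ N1)// N_noninc.
have Nc2 : N (c w) <= Num.min (s / 4 / (m + s / 2)) 2^-1.
  apply: (le_trans Ncw).
  have : Dc * N w <= Dc * (e2 * H w) by rewrite ler_pM2l.
  have e2E : Dc * e2 = Num.min (s / 4 / (m + s / 2)) 2^-1.
    by rewrite /e2 mulrC divfK// gt_eqF.
  have : Dc * e2 * H w <= Dc * e2 * 1 by rewrite ler_pM2l// mulr_gt0.
  rewrite e2E; rewrite mulrA e2E; lra.
split.
- split => //.
  + rewrite (le_trans _ c2)// mulrC -ler_pdivrMr//.
  + exact: lt_le_trans c2.
  + by rewrite (le_trans c3)// ler_piMl// ltW.
- split => //.
    by rewrite (le_lt_trans j1)// ltr_pdivrMr; lra.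
  rewrite mulrC -ler_pdivlMr// mul1r (le_trans ratio1)//.
  by rewrite /e1 ge_min lexx orbT.
- split => //.
    apply: (le_lt_trans Nc2); rewrite gt_min invf_lt1 ?ltr1n ?orbT//.
  by rewrite -ler_pdivlMr// (le_trans Nc2)// ge_min lexx.
- have -> : m + s = theta * (z ^+ 3 * k).
    by rewrite /s /jump_margin /theta /jump_intensity /k; field; rewrite gt_eqF.
  rewrite -mulrA ler_pM2l//.
  apply: (@le_trans _ _ (N w / H w * (z ^+ 3 * w))); last first.
    by rewrite ler_pM2l// divr_gt0.
  have -> : N w / H w * (z ^+ 3 * w) = z ^+ 3 * (w * N w / H w) by ring.
  by rewrite ler_pM2l// ler_pdivlMr.
- by move=> x xc; apply: ex; exact: le_trans c3.
Unshelve. all: by end_near. Qed.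

End parameters.

(** * Efficiency of the mixture *)

Section simulation.
Context {R : realType}.

(** [n] is [k] rounded up, so n ^ (- g) <= e^2 * delta / (5 K + 1), and e^2 * e ^ (- (1 + g)) <= 1
    because g < 1. The 1 lost in rounding is absorbed since negative powers of [e] and [delta] are
    at least 1. *)
Lemma powR_nat_ge (K g e delta : R) : 0 < g < 1 -> 0 <= K -> 0 < e < 1 ->
  0 < delta < 1 ->
  exists2 n : nat, (0 < n)%N &
    5 * K * (n%:R `^ (- g) * e `^ (- (1 + g))) <= delta /\
    n%:R <= ((5 * K + 1) `^ g^-1 + 1) * (e `^ (- (2 / g)) * delta `^ (- (1 / g))).
Proof.
move=> /andP[g0 g1] K0 /andP[e0 e1] /andP[d0 d1].
have K1 : 0 < 5 * K + 1 by lra.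
pose k := (5 * K + 1) `^ g^-1 * (e `^ (- (2 / g)) * delta `^ (- (1 / g))).
have k0 : 0 < k by rewrite !mulr_gt0 ?powR_gt0.
exists (Num.truncn k).+1 => //; set n := (Num.truncn k).+1.
have kn : k <= n%:R by exact/ltW/truncnS_gt.
have n0 : 0 < n%:R :> R by rewrite ltr0n.
have kg : k `^ g = (5 * K + 1) * (e `^ (- 2) * delta^-1).
  have gn0 : g != 0 by rewrite gt_eqF.
  have dE : delta^-1 = delta `^ (- (1 / g) * g).
    by rewrite mulNr divfK// powRN powRr1// ltW.
  have eE : e `^ (- 2) = e `^ (- (2 / g) * g) by rewrite mulNr divfK.
  rewrite dE eE !powRrM /k powRM ?mulr_ge0 ?powR_ge0// powRM ?powR_ge0//.
  by rewrite -[_ `^ g^-1 `^ g]powRrM mulVf// powRr1// ltW.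
split.
  have ng : n%:R `^ (- g) <= (5 * K + 1)^-1 * (e ^+ 2 * delta).
    have -> : (5 * K + 1)^-1 * (e ^+ 2 * delta) = (k `^ g)^-1.
      by rewrite kg powRN powR_mulrn ?ltW// !invfM !invrK.
    rewrite powRN lef_pV2 ?posrE ?powR_gt0//.
    by apply: ge0_ler_powR; rewrite ?nnegrE ?(ltW g0) ?(ltW k0) ?(ltW n0).
  have ee : e ^+ 2 * e `^ (- (1 + g)) <= 1.
    rewrite -powR_mulrn ?(ltW e0)// -powRD ?(gt_eqF e0) ?implybT//.
    rewrite -[leRHS](powRr0 e); apply: ger_powR; first by rewrite e0 ltW.
    lra.
  have ep : 0 <= e `^ (- (1 + g)) by exact: powR_ge0.
  have K50 : 0 <= 5 * K by lra.
  apply: (@le_trans _ _ (5 * K * ((5 * K + 1)^-1 * (e ^+ 2 * delta) * e `^ (- (1 + g))))).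
    by rewrite ler_wpM2l// ler_wpM2r.
  have -> : 5 * K * ((5 * K + 1)^-1 * (e ^+ 2 * delta) * e `^ (- (1 + g))) =
      (5 * K / (5 * K + 1)) * delta * (e ^+ 2 * e `^ (- (1 + g))) by ring.
  have Kd : 5 * K / (5 * K + 1) <= 1 by rewrite ler_pdivrMr// mul1r; lra.
  have Kd0 : 0 <= 5 * K / (5 * K + 1) by rewrite divr_ge0// ltW.
  rewrite -[leRHS]mulr1; apply: ler_pM => //.
  - by rewrite mulr_ge0// ltW.
  - by rewrite mulr_ge0 ?sqr_ge0.
  - by rewrite ler_piMl// ltW.
have ge1 x p : 0 < x < 1 -> 0 <= p -> 1 <= x `^ (- p).
  move=> /andP[x0 x1] p0; rewrite -(powRr0 x).
  by apply: ger_powR; [rewrite x0 ltW|rewrite oppr_le0].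
have -> : n%:R = (Num.truncn k)%:R + 1 :> R by rewrite natr1.
have tk : (Num.truncn k)%:R <= k by rewrite truncn_le ltW.
rewrite [leRHS]mulrDl [X in _ <= _ + X]mul1r; apply: lerD; first exact: tk.
rewrite -[leLHS]mulr1; apply: ler_pM => //.
  by apply: ge1; rewrite ?e0// divr_ge0// ltW.
by apply: ge1; rewrite ?d0// divr_ge0// ltW.
Qed.

End simulation.

Section estimator_under_mixture.
Context {d : measure_display} {T : measurableType d} {R : realType}.
Variables (P : probability T R) (X : nat -> {RV P >-> R}) (f : R -> R).
Hypothesis X_iid : iid X.
Hypothesis X_density : has_density (X 0%N) f.
Variables (b : R) (q : R -> R -> R).
Hypothesis b0 : 0 <= b.
Hypothesis mq : measurable_fun setT (fun z : R * R => q z.1 z.2).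
Hypothesis q0 : forall s x, 0 <= q s x.
Hypothesis balance : forall s x, q s x * (f x / q s x) = f x.

Context {d' : measure_display} {T' : measurableType d'}.
Variables (Q : probability T' R) (Y : nat -> {RV Q >-> R}).
Hypothesis lawY : path_law Y q.

Local Notation Z := (estimator f q b (fun n => Y n : T' -> R)).
Local Notation tau := (passage_time b (fun n => Y n : T' -> R)).
Local Notation hit := (hit_weight b (fun n => Y n : T' -> R)).

Let mf : measurable_fun setT f. Proof. by case: X_density. Qed.
Let f0 x : 0 <= f x. Proof. by case: X_density. Qed.

Let r (s x : R) := f x / q s x.

Let r0 s x : 0 <= r s x.
Proof. by rewrite divr_ge0. Qed.

Let mr : measurable_fun setT (fun z : R * R => r z.1 z.2).
Proof.
apply: measurable_funM; first exact: (measurableT_comp mf measurable_snd).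
exact: measurable_invr_ge0.
Qed.

Let mrp p : measurable_fun setT (fun z : R * R => r z.1 z.2 `^ p).
Proof. exact: (measurableT_comp (measurable_powR p)). Qed.

Lemma estimator_ge0 t : 0 <= Z t.
Proof.
have [[n pn]|nb] := passesP b (fun n => Y n : T' -> R) t.
  by rewrite (estimator_passes _ _ pn) prodr_ge0// => i _; exact: r0.
by rewrite (estimator_never _ _ nb).
Qed.

Let estimator_series t : ((Z t)%:E = \sum_(n <oo) (hit r n t)%:E)%E.
Proof.
rewrite -[Z t]powRr1 ?estimator_ge0// estimator_powR//.
suff -> : (fun s x => (f x / q s x) `^ 1) = r by [].
by apply/funext => s; apply/funext => x; rewrite powRr1//; exact: r0.
Qed.

Lemma measurable_estimator : measurable_fun setT Z.
Proof.
apply/measurable_EFinP; rewrite (_ : _ \o _ = (fun t => \sum_(n <oo) (hit r n t)%:E)%E).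
  apply: ge0_emeasurable_sum => [n t _ _|n _].
    by rewrite lee_fin hit_weight_ge0.
  by apply/measurable_EFinP; exact: measurable_hit.
by apply/funext => t; exact: estimator_series.
Qed.

Lemma measurable_passage_time : measurable_fun setT tau.
Proof.
rewrite (_ : tau = (fun t => \sum_(n <oo)
    (alive_weight b (fun n => Y n : T' -> R) (fun _ _ => 1) n t)%:E)%E).
  apply: ge0_emeasurable_sum => [n t _ _|n _].
    by rewrite lee_fin alive_weight_ge0.
  by apply/measurable_EFinP; exact: measurable_alive.
by apply/funext => t; exact: passage_time_alive.
Qed.

(** Term by term change of law: the weight f / q under the mixture against the weight 1 under the
    nominal density. *)
Lemma estimator_unbiased : (\int[Q]_t (Z t)%:E = (crossing_prob X b)%:E)%E.
Proof.
under eq_integral do rewrite estimator_series.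
rewrite integral_nneseries//; last 2 first.
- by move=> n; apply/measurable_EFinP; exact: measurable_hit.
- by move=> n t _; rewrite lee_fin hit_weight_ge0.
rewrite crossing_probE; apply: eq_eseriesr => n _.
apply: (integral_hit_change _ mq q0 lawY mr r0 (q' := fun _ => f)) => //.
- exact: (measurableT_comp mf measurable_snd).
- exact: iid_path_law.
- by move=> s x; rewrite mulr1; exact: balance.
Qed.

(** Since [v] is 1 past the level, the payoff at a crossing and the continuation value merge into
    one integral, the one in the drift hypothesis. For the passage time [v] is 0 there, as nothing
    more is paid. *)
Lemma estimator_moment_le (p : R) (v : R -> R) : 0 < p ->
  measurable_fun setT v -> (forall w, 0 <= v w) -> (forall w, w < 0 -> v w = 1) ->
  (forall s, s <= b -> (\int[lebesgue_measure]_x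
    (q s x * (f x / q s x) `^ p * v (b - s - x))%:E <= (v (b - s))%:E)%E) ->
  (\int[Q]_t (Z t `^ p)%:E <= (v b)%:E)%E.
Proof.
move=> p0 mv v0 v1 drift.
pose rp (s x : R) := r s x `^ p.
have rp0 s x : 0 <= rp s x by exact: powR_ge0.
have mrp' := mrp p.
under eq_integral do rewrite estimator_powR// -/rp.
rewrite integral_nneseries//; last 2 first.
- by move=> n; apply/measurable_EFinP; exact: measurable_hit.
- by move=> n t _; rewrite lee_fin hit_weight_ge0.
pose ell s := (\int[lebesgue_measure]_x ((q s x)%:E *
    (rp s x * (b < s + x)%R%:R)%:E))%E.
have mell : measurable_fun setT ell.
  apply: (measurable_step_integral mq q0 (measurable_hit_kernel b mrp')).
  by move=> z; rewrite lee_fin mulr_ge0.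
have ell0 s : (0 <= ell s)%E.
  by apply: integral_ge0 => x _; rewrite -EFinM lee_fin !mulr_ge0.
under eq_eseriesr => n _ do rewrite (integral_hit b mq q0 lawY mrp' rp0) -/(ell _).
have mg : measurable_fun setT (fun s : R => v (b - s)).
  by apply: (measurableT_comp mv); exact: measurable_funB.
have := lyapunov_series b0 mq q0 lawY mrp' rp0 mg (fun s => v0 (b - s)) mell ell0.
rewrite subr0; apply => s sb; apply: le_trans (drift s sb).
have mqs : measurable_fun setT (fun x : R => q s x).
  have h : measurable_fun setT (fun x : R => (s, x)) by exact: measurable_fun_pair.
  exact: (measurableT_comp mq h).
have mrs : measurable_fun setT (fun x : R => rp s x).
  have h : measurable_fun setT (fun x : R => (s, x)) by exact: measurable_fun_pair.
  exact: (measurableT_comp mrp' h).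
have msx : measurable_fun setT (fun x : R => s + x) by exact: measurable_funD.
have m1 := measurableT_comp (measurable_gt_indicator b) msx.
have m2 := measurableT_comp (measurable_le_indicator b) msx.
have m3 := measurableT_comp mg msx.
rewrite /ell -ge0_integralD//; last 4 first.
- by move=> x _; rewrite -EFinM lee_fin !mulr_ge0.
- under eq_fun do rewrite -EFinM.
  by apply/measurable_EFinP; do 2 apply: measurable_funM => //.
- by move=> x _; rewrite -!EFinM lee_fin !mulr_ge0.
- under eq_fun do rewrite -!EFinM.
  apply/measurable_EFinP; apply: measurable_funM => //.
  by apply: measurable_funM => //; exact: measurable_funM.
rewrite le_eqVlt; apply/orP; left; apply/eqP; apply: eq_integral => x _.
rewrite -!EFinM -EFinD; congr (_%:E); rewrite -/(r s x) -/(rp s x).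
rewrite opprD addrA; have [sx|sx] := leP (s + x) b.
  by rewrite /= !mulr0 add0r mulr1 mulrA.
by rewrite v1 /= ?mulr1 ?mulr0 ?mul0r ?mulr0 ?addr0//; lra.
Qed.

Lemma passage_time_integral_le (v : R -> R) :
  measurable_fun setT v -> (forall w, 0 <= v w) -> (forall w, w < 0 -> v w = 0) ->
  (forall s, s <= b -> (1 + \int[lebesgue_measure]_x
    (q s x * v (b - s - x))%:E <= (v (b - s))%:E)%E) ->
  (\int[Q]_t tau t <= (v b)%:E)%E.
Proof.
move=> mv v0 v1 drift.
have m1 : measurable_fun setT (fun z : R * R => 1 : R) by exact: measurable_cst.
under eq_integral do rewrite passage_time_alive.
rewrite integral_nneseries//; last 2 first.
- by move=> n; apply/measurable_EFinP; exact: measurable_alive.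
- by move=> n t _; rewrite lee_fin alive_weight_ge0.
have mg : measurable_fun setT (fun s : R => v (b - s)).
  by apply: (measurableT_comp mv); exact: measurable_funB.
have := lyapunov_series b0 mq q0 lawY m1 (fun _ _ => ler01) mg (fun s => v0 (b - s))
  (ell := fun _ => 1%E) (measurable_cst _) (fun _ => lee01).
rewrite subr0 => lyap; apply: le_trans (lyap _); last first.
  move=> s sb; apply: le_trans (drift s sb); rewrite leeD2l//.
  rewrite le_eqVlt; apply/orP; left; apply/eqP; apply: eq_integral => x _.
  rewrite -!EFinM; congr (_%:E); rewrite opprD addrA mul1r.
  have [sx|sx] := leP (s + x) b; first by rewrite /= mul1r.
  by rewrite v1 ?mulr0//; lra.
by under [leRHS]eq_eseriesr => n _ do under eq_integral do rewrite mule1.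
Qed.

End estimator_under_mixture.

Section efficient_mixture.
Context {R : realType} {d : measure_display} {T : measurableType d}.
Variables (P : probability T R) (X : nat -> {RV P >-> R}).
Variables (f Lambda : R -> R) (iota g : R).
Hypothesis X_iid : iid X.
Hypothesis X_integrable : P.-integrable setT (EFin \o X 0%N).
Hypothesis X_mean : ('E_P[X 0%N] < 0)%E.
Hypothesis Fbar_hazard : forall x, ccdf (X 0%N) x = (expR (- Lambda x))%:E.
Hypothesis X_density : has_density (X 0%N) f.
Hypothesis hA : assumptionA (fun x => fine (ccdf (X 0%N) x)) iota.
Hypothesis iota_lt2 : iota < 2.
Hypothesis g_range : 0 < g < (iota - 1) / (2 - iota).
Hypothesis g_lt1 : g < 1.

Local Notation N := (tail (X 0%N)).
Local Notation H := (excess (X 0%N)).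

Lemma regularly_varying_ccdf (t : R) : 0 < t -> t <= 1 ->
  N (x * t) / N x @[x --> +oo] --> t `^ (- iota).
Proof.
move=> t0 t1; have [_ [L sv LE]] := hA.
have h : L (x * t) / L x * t `^ (- iota) @[x --> +oo] --> 1 * t `^ (- iota).
  by apply: cvgMl; exact: sv.
rewrite mul1r in h; apply: cvg_trans h; apply: near_eq_cvg; near=> x.
have x0 : 0 < x by near: x; exact: nbhs_pinfty_gt.
rewrite -[N (x * t)]/(fine (ccdf (X 0%N) (x * t))) -[N x]/(fine (ccdf (X 0%N) x)).
rewrite !LE ?mulr_gt0// powRM ?(ltW x0) ?(ltW t0)//.
have xi : x `^ (- iota) != 0 by rewrite gt_eqF// powR_gt0.
rewrite invfM mulrACA; congr (_ * _).
by rewrite mulrAC divff// mul1r.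
Unshelve. all: by end_near. Qed.

(** The level enters only as the initial distance w = b, so the mixture and all constants are fixed
    before [b]. *)
Lemma efficient_mixture : exists K, exists m : mixture R, exists rho0 rho1,
  [/\ [/\ 0 < K, 0 < rho0, 0 < rho1 & in_mixture_family Lambda m],
    (forall b, [/\ measurable_fun setT
          (fun z : R * R => q_density (X 0%N) f Lambda m b z.1 z.2),
        (forall s x, 0 <= q_density (X 0%N) f Lambda m b s x) &
        (forall s x, q_density (X 0%N) f Lambda m b s x *
          (f x / q_density (X 0%N) f Lambda m b s x) = f x)]),
    (forall b, 0 < b -> 0 < crossing_prob X b) &
    (forall b : R, 0 < b ->
      forall (d' : measure_display) (T' : measurableType d')
        (Q : probability T' R) (Y : nat -> {RV Q >-> R}),
      path_law Y (q_density (X 0%N) f Lambda m b) ->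
      let Z := estimator f (q_density (X 0%N) f Lambda m b) b
        (fun n => Y n : T' -> R) in
      (\int[Q]_t (Z t `^ (1 + g))%:E <= (K * crossing_prob X b `^ (1 + g))%:E)%E /\
      (\int[Q]_t passage_time b (fun n => Y n : T' -> R) t <=
        (rho0 + rho1 * b)%:E)%E)].
Proof.
have [iota_gt1 _] := hA; have /andP[g0 gi] := g_range.
have g01 : 0 < g < 1 by rewrite g0.
have hazardN x : N x = expR (- Lambda x) by rewrite /tail Fbar_hazard.
have N_gt0 x : 0 < N x by rewrite hazardN expR_gt0.
have N_noninc := @tail_noninc _ _ _ P (X 0%N).
have H_le := excess_incr_le X_integrable.
have H_ge := excess_incr_ge X_integrable.
have H_0 := excess_cvg0 X_integrable.
have N_rv := regularly_varying_ccdf.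
have [mf f0 _] := X_density.
have transfer := integral_density_RV X_density.
pose m := - fine ('E_P[X 0%N]).
have EX_fin : ('E_P[X 0%N] \is a fin_num)%E.
  by rewrite unlock; exact: integrable_fin_num.
have m0 : 0 < m by rewrite oppr_gt0 -lte_fin fineK.
have meanX : (\int[P]_t (X 0%N t)%:E = (- m)%:E)%E.
  by rewrite opprK fineK// unlock.
have absX := esym (abs_meanE X_integrable).
have mabs0 := abs_mean_gt0 X_integrable X_mean.
set mabs := abs_mean X in absX mabs0.
have [z z01 s0] := exists_jump_rate iota_gt1 iota_lt2 g_range m0.
set s := _ * _ in s0.
have /andP[z0 z1] := z01.
have [M M1 expansion] :=
  integrated_tail_powR_expansion N_gt0 N_noninc iota_gt1 N_rv H_le H_ge H_0 g0 z01.
have M0 : 0 < M by rewrite (lt_le_trans ltr01).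
have mz0 : 0 < m * (1 - z) / 8 by rewrite divr_gt0// mulr_gt0// subr_gt0.
(* The allowed error m * (1 - z) / 4 of the moment drift is split evenly between [e * mabs] and
   [M * tau]; the bound s / 4 serves the time drift. *)
pose tau := Num.min (s / 4) (m * (1 - z) / 8 / M).
have tau0 : 0 < tau by rewrite lt_min (divr_gt0 s0)// (divr_gt0 mz0).
pose e := m * (1 - z) / 8 / mabs.
have e0 : 0 < e by rewrite divr_gt0.
have [A A0 tauA] := tail_integrable X_integrable tau0.
have tauA' : (\int[P]_t (`|X 0%N t| * (A < `|X 0%N t|)%R%:R)%:E <= (s / 4)%:E)%E.
  by apply: (le_trans tauA); rewrite lee_fin ge_min lexx.
have errors : e * mabs + M * tau <= m * (1 - z) / 4.
  have -> : e * mabs = m * (1 - z) / 8 by rewrite /e divfK// gt_eqF.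
  have : M * tau <= m * (1 - z) / 8.
    by rewrite mulrC -ler_pdivlMr// ge_min lexx orbT.
  lra.
have [Dc [eta [eta0 C_large good]]] := exists_threshold hazardN N_noninc
  iota_gt1 g_range m0 N_rv H_le H_ge H_0 z01 s0 expansion A0 e0.
set theta := jump_intensity g m z in C_large good.
set a := jump_gap iota z in good.
have theta0 : 0 < theta.
  by rewrite divr_gt0// mulr_gt0// mulr_gt0// addr_gt0.
have a0 : 0 < a by exact: jump_gap_gt0.
pose mix := tail_mixture (X 0%N) Lambda theta a eta.
have cut_fin w (ew : eta <= w) : geninv Lambda (Lambda w - a) \is a fin_num.
  by have [[]] := good w ew.
have cut_hazard w (ew : eta <= w) :
    Lambda (w - fine (geninv Lambda (Lambda w - a))) < Lambda w.
  by have [[]] := good w ew.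
have jump_lt1 w (ew : eta <= w) : jump_prob (X 0%N) theta w < 1.
  by have [_ []] := good w ew.
have cut_tail w (ew : eta <= w) : N (fine (geninv Lambda (Lambda w - a))) < 1.
  by have [_ _ []] := good w ew.
have cut_ge w (ew : eta <= w) : A <= fine (geninv Lambda (Lambda w - a)).
  by have [[]] := good w ew.
have cut_gt0 w (ew : eta <= w) : 0 < fine (geninv Lambda (Lambda w - a)).
  by have [[]] := good w ew.
pose C := (H eta `^ (1 + g))^-1.
have C0 : 0 < C.
  by rewrite invr_gt0 powR_gt0// (integrated_tail_gt0 N_gt0 H_ge H_0).
pose r1 := 2 / s.
have r10 : 0 < r1 by rewrite divr_gt0.
pose r0 := (1 + r1 * (eta + mabs)) / N eta.
have r0N : r0 * N eta = 1 + r1 * (eta + mabs) by rewrite divfK// gt_eqF.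
have r00 : 0 < r0.
  by rewrite divr_gt0// addr_gt0// mulr_gt0// addr_gt0.
have [k k0 hk] := crossing_prob_ge_excess X_iid X_density X_integrable X_mean.
have u0 b : 0 < b -> 0 < crossing_prob X b.
  move=> /ltW /hk; apply: lt_le_trans.
  by rewrite mulr_gt0// (integrated_tail_gt0 N_gt0 H_ge H_0).
have mq b := measurable_q_density theta X_integrable hazardN mf cut_fin b.
have q0 b s' x := q_density_ge0 X_integrable hazardN f0 theta0 jump_lt1 cut_tail b s' x.
have bal b s' x := q_density_balance f X_integrable hazardN theta0 jump_lt1 cut_tail b s' x.
have in_family := tail_mixture_in_family X_integrable hazardN eta0 a0 theta0
  cut_fin cut_hazard jump_lt1.
(* The moment is at most C * H b ^ (1 + g), and k * H b is at most the crossing probability. *)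
exists (C * k^-1 `^ (1 + g)), mix, r0, r1; split => //.
  by split => //; rewrite mulr_gt0// powR_gt0// invr_gt0.
move=> b b0 d' T' Q Y lawY Z; split.
  apply: (@le_trans _ _ (moment_lyapunov (X 0%N) eta g C b)%:E).
    apply: (estimator_moment_le X_density (ltW b0) (mq b) (q0 b) lawY).
    - by rewrite addr_gt0.
    - exact: (measurable_moment_lyapunov X_integrable hazardN g01 erefl).
    - move=> w; exact: (moment_lyapunov_ge0 X_integrable hazardN erefl).
    - by move=> w w0; rewrite /moment_lyapunov ltW// (lt_trans w0).
    move=> s' _; apply: (moment_drift X_integrable hazardN mf f0 transfer theta0
      cut_fin jump_lt1 cut_tail m0 meanX absX tauA cut_ge cut_gt0 g01 z01 erefl
      (ltW M0) (ltW e0) _ _ _ _ errors erefl C_large).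
    - by move=> w /good[_ []].
    - by move=> w /good[_ []].
    - by move=> w /good[_ _ []].
    - by move=> w /good[].
  rewrite lee_fin; apply: (le_trans
    (moment_lyapunov_le X_integrable hazardN g01 erefl b)).
  rewrite -mulrA ler_pM2l// -powRM ?invr_ge0 ?(ltW k0) ?(ltW (u0 b b0))//.
  have Hb0 := integrated_tail_gt0 N_gt0 H_ge H_0 b.
  apply: ge0_ler_powR; rewrite ?nnegrE ?(ltW Hb0)//.
  - by rewrite addr_ge0// ltW.
  - by rewrite mulr_ge0 ?invr_ge0 ?(ltW k0) ?(ltW (u0 b b0)).
  - by rewrite ler_pdivlMl//; exact/hk/ltW.
have -> : r0 + r1 * b = time_lyapunov r0 r1 b.
  by rewrite /time_lyapunov ltNge ltW.
have r0_large : 1 + r1 * (eta + mabs) <= r0 * N eta by rewrite r0N.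
apply: (passage_time_integral_le (ltW b0) (mq b) (q0 b) lawY).
- exact: (measurable_time_lyapunov hazardN eta0 s0 erefl (ltW mabs0) r0_large).
- move=> w; exact: (time_lyapunov_ge0 hazardN eta0 s0 erefl (ltW mabs0) r0_large).
- by move=> w w0; rewrite /time_lyapunov w0.
move=> s' sb; apply: (time_drift X_integrable hazardN mf f0 transfer eta0 theta0
  cut_fin jump_lt1 cut_tail m0 meanX absX tauA' cut_ge cut_gt0 s0 erefl erefl
  (ltW mabs0) _ _ _ r0_large sb).
- by move=> w /good[[]].
- by move=> w /good[_ _ []].
- by move=> w /good[].
Qed.

End efficient_mixture.

Theorem theorem4 (R : realType) (d : measure_display) (T : measurableType d)
    (P : probability T R) (X : nat -> {RV P >-> R})
    (lambda Lambda : R -> R) (iota : R)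
    (X_iid : iid X)
    (X_integrable : P.-integrable setT (EFin \o X 0%N))
    (X_mean : ('E_P[X 0%N] < 0)%E)
    (Fbar_hazard : forall x, ccdf (X 0%N) x = (expR (- Lambda x))%:E)
    (X_density : has_density (X 0%N) (hazard_density lambda Lambda))
    (hA : assumptionA (fun x => fine (ccdf (X 0%N) x)) iota)
    (iota_range : 1 < iota <= 3 / 2)
    (gamma : R) (gamma_range : 0 < gamma < (iota - 1) / (2 - iota)) :
  let f := hazard_density lambda Lambda in
  let u := crossing_prob X in
  exists K : R, exists m : mixture R, exists rho0 rho1 : R,
  let q := q_density (X 0%N) f Lambda m in
  [/\ [/\ 0 < K, 0 < rho0, 0 < rho1 & in_mixture_family Lambda m],
      (forall b : R, 0 < b ->
       forall (d' : measure_display) (T' : measurableType d')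
         (Q : probability T' R) (Y : nat -> {RV Q >-> R}),
       path_law Y (q b) ->
       let Z := estimator f (q b) b (fun n => Y n : T' -> R) in
       let tau := passage_time b (fun n => Y n : T' -> R) in
       ('E_Q[fun t => (Z t `^ (1 + gamma))%R] <= (K * u b `^ (1 + gamma))%:E)%E /\
       (\int[Q]_t tau t <= (rho0 + rho1 * b)%:E)%E) &
      (forall kappa : R, 0 < kappa ->
       exists2 C : R, 0 < C &
       forall b eps delta : R, 1 <= b -> 0 < eps < 1 -> 0 < delta < 1 ->
       exists2 n : nat, (0 < n)%N &
       forall (d' : measure_display) (T' : measurableType d')
         (Q : probability T' R) (Y : 'I_n -> nat -> {RV Q >-> R})
         (c : 'I_n -> nat -> {RV Q >-> R}),
       let path i := fun k => Y i k : T' -> R in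
       let Z i := estimator f (q b) b (path i) in
       (forall i, path_law (Y i) (q b)) ->
       mutually_independent Q Z ->
       (forall i j t, 0 <= c i j t <= kappa) ->
       let uhat t := (\sum_(i < n) Z i t) / n%:R in
       let cost t := (\sum_(i < n)
         replication_cost (fun j => c i j : T' -> R) b (path i) t)%E in
       ((1 - delta)%:E <= Q [set t | (`|uhat t - u b| <= eps * u b)%R])%E /\
       (\int[Q]_t cost t <=
          (C * (eps `^ (- (2 / gamma)) * delta `^ (- (1 / gamma)) * b))%:E)%E)].
Proof.
move=> f u.
have /andP[i1 i32] := iota_range; have /andP[g0 gi] := gamma_range.
have iota_lt2 : iota < 2 by lra.
(* From iota <= 3 / 2 follows iota - 1 <= 2 - iota, so the window for [gamma] lies below 1. *)
have g_lt1 : gamma < 1.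
  by apply: (lt_le_trans gi); rewrite ler_pdivrMr; lra.
have g01 : 0 < gamma < 1 by rewrite g0.
have [K [m [rho0 [rho1 [[K0 r00 r10 fam] qfacts u0 perf]]]]] :=
  efficient_mixture X_iid X_integrable X_mean Fbar_hazard X_density hA iota_lt2
    gamma_range g_lt1.
exists K, m, rho0, rho1 => q; split => //.
  move=> b b0 d' T' Q Y lawY Z tau; have [h1 h2] := perf b b0 d' T' Q Y lawY.
  by split => //; rewrite unlock.
move=> kappa kappa0.
pose B := (5 * K + 1) `^ gamma^-1 + 1.
have B0 : 0 < B by rewrite ltr_wpDl ?powR_ge0.
exists (B * kappa * (rho0 + rho1)); first by rewrite !mulr_gt0// addr_gt0.
move=> b eps delta b1 eps01 delta01.
have b0 : 0 < b by exact: lt_le_trans b1.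
have [n n0 [n_small n_le]] := powR_nat_ge g01 (ltW K0) eps01 delta01.
exists n => // d' T' Q Y c path Z lawY ind c_range uhat cost.
have [mq q0 bal] := qfacts b.
have /andP[e0 e1] := eps01; have /andP[d0 d1] := delta01.
have f0 x : 0 <= f x by case: X_density.
split.
  apply: (@sample_mean_accuracy _ _ _ _ _ _ _ _ ind n0 gamma (u b) K eps delta) => //.
  - by move=> i; exact: (measurable_estimator X_density b mq q0 (Y i)).
  - by move=> i t; exact: (estimator_ge0 X_density b q0 (Y i)).
  - exact: u0.
  - exact: ltW.
  - by move=> i; exact: (estimator_unbiased X_iid X_density b mq q0 bal (lawY i)).
  - by move=> i; have [] := perf b b0 d' T' Q (Y i) (lawY i).
have mcost i : measurable_fun setT
    (replication_cost (fun j => c i j : T' -> R) b (path i)).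
  rewrite (_ : replication_cost _ _ _ = fun t => (\sum_(j <oo)
      (c i j t * alive_weight b (path i) (fun _ _ => 1) j t)%:E)%E); last first.
    by apply/funext => t; exact: replication_costE.
  apply: ge0_emeasurable_sum => [j t _ _|j _].
    rewrite lee_fin mulr_ge0 ?alive_weight_ge0//.
    by have /andP[] := c_range i j t.
  by apply/measurable_EFinP; apply: measurable_funM => //; exact: measurable_alive.
have cost0 i t : (0 <= replication_cost (fun j => c i j : T' -> R) b (path i) t)%E.
  rewrite replication_costE; apply: nneseries_ge0 => j _ _.
  rewrite lee_fin mulr_ge0 ?alive_weight_ge0//.
  by have /andP[] := c_range i j t.
rewrite ge0_integral_sum//.
have cost_le i : (\int[Q]_t replication_cost (fun j => c i j : T' -> R) b (path i) t <=
    (kappa * (rho0 + rho1 * b))%:E)%E.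
  have [_ htau] := perf b b0 d' T' Q (Y i) (lawY i).
  apply: (@le_trans _ _ (kappa%:E * \int[Q]_t passage_time b (path i) t)%E); last first.
    by rewrite EFinM; apply: lee_wpmul2l => //; rewrite lee_fin ltW.
  have mtau := measurable_passage_time b (Y i).
  rewrite -ge0_integralZl//; last 2 first.
  - by move=> t _; exact: passage_time_ge0.
  - by rewrite lee_fin ltW.
  apply: ge0_le_integral => //.
  - exact: measurable_funeM.
  - by move=> t _; apply: replication_cost_le => j; exact: c_range.
apply: (@le_trans _ _ (\sum_(i < n) (kappa * (rho0 + rho1 * b))%:E)%E).
  by apply: lee_sum => i _; exact: cost_le.
rewrite sumEFin sumr_const card_ord lee_fin -[leLHS]mulr_natl.
set w := _ * delta `^ _ in n_le *.
have w0 : 0 < w by rewrite mulr_gt0 ?powR_gt0.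
(* Here b >= 1 absorbs [rho0] into rho0 * b. *)
apply: (@le_trans _ _ (B * w * (kappa * ((rho0 + rho1) * b)))).
  apply: ler_pM => //.
    by rewrite mulr_ge0 ?(ltW kappa0)// addr_ge0 ?(ltW r00)// mulr_ge0 ?(ltW r10) ?(ltW b0).
  rewrite ler_pM2l// [leRHS]mulrDl lerD2r.
  by rewrite -[leLHS]mulr1 ler_pM2l.
by rewrite le_eqVlt; apply/orP; left; apply/eqP; ring.
Qed.
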